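(* Let $K$ be a field of characteristic $0$ and let $\mathcal{M}$ be a rigid $K$-linear tensor category with $\operatorname{End}_{\mathcal{M}}(\mathbf{1})=K$. Let $M\simeq M^+\oplus M^-$ be a finite-dimensional object of $\mathcal{M}$ and let $M^*$ be its dual. Then, as an identity of rational functions in $T$ with coefficients in $K_0(\mathcal{M})$, $$Z_{\mathcal{M}}(M^*,T^{-1})=(-1)^{\chi^+(M)}\,[\det(M)]\, T^{\chi(M)}\, Z_{\mathcal{M}}(M,T).$$
   Context: A $K$-linear tensor category is a $K$-linear pseudo-abelian symmetric monoidal category whose tensor product $\otimes$ is bilinear; rigid means that every object $M$ has a dual $M^*$. The symmetric powers $S^n(M)$ and exterior powers $\Lambda^n(M)$ are the direct summands of $M^{\otimes n}$ cut out by the usual projectors for the action of the symmetric group. $K_0(\mathcal{M})$ is the (split) Grothendieck ring of $\mathcal{M}$: addition comes from $\oplus$, multiplication from $\otimes$; it is commutative. Euler characteristic: $\chi(M)=\operatorname{tr}(1_M)\in \operatorname{End}(\mathbf{1})=K$. The object $M$ is positive if $\Lambda^N(M)=0$ for some $N>0$, negative if $S^N(M)=0$ for some $N>0$, and finite-dimensional if $M\simeq M^+\oplus M^-$ with $M^+$ positive and $M^-$ negative; such a decomposition is unique up to isomorphism. For $M$ positive (resp. negative), $\chi(M)$ is a nonnegative (resp. nonpositive) integer and the smallest such $N$ is $\chi(M)+1$ (resp. $-\chi(M)+1$). For $M$ finite-dimensional put $\chi^+(M)=\chi(M^+)$ and $\chi^-(M)=\chi(M^-)$, so that $\chi(M)=\chi^+(M)+\chi^-(M)$.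 An object $L$ is invertible if $L\otimes T\simeq\mathbf{1}$ for some object $T$; one writes $T=L^{-1}$, and $L^{-1}\simeq L^*$. If $M$ is positive, $\Lambda^{\chi(M)}(M)$ is invertible; if $M$ is negative, $S^{-\chi(M)}(M)$ is invertible. The determinant of a finite-dimensional $M\simeq M^+\oplus M^-$ is the invertible object (well defined up to isomorphism) $$\det(M)=\Lambda^{\chi^+(M)}(M^+)\otimes S^{-\chi^-(M)}(M^-)^{-1}.$$ The zeta function of $M$ is $Z_{\mathcal{M}}(M,T)=\sum_{n\ge 0}[S^n(M)]T^n\in K_0(\mathcal{M})[[T]]$. For $M$ finite-dimensional it is the rational function $$Z_{\mathcal{M}}(M,T)=\frac{\sum_{n=0}^{-\chi^-(M)}[S^n(M^-)]T^n}{\sum_{n=0}^{\chi^+(M)}[\Lambda^n(M^+)](-T)^n},$$ viewed in the localisation of $K_0(\mathcal{M})[T,T^{-1}]$ at the polynomials with constant coefficient $1$ and invertible leading coefficient; in this ring the substitution $T\mapsto T^{-1}$ makes sense, and this is the meaning of $Z_{\mathcal{M}}(M^*,T^{-1})$. *)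

(* Defs.v *)
From HB Require Import structures.
From mathcomp Require Import all_boot all_order all_algebra all_fingroup.
From mathcomp Require Import generic_quotient.
From mathcomp Require Import boolp ring.

Set Implicit Arguments.
Unset Strict Implicit.
Unset Printing Implicit Defensive.

Import GRing.Theory.
Local Open Scope ring_scope.
Local Open Scope quotient_scope.

Section Denominators.
Variable R : comNzRingType.
Implicit Types D E : {poly R}.

(* A power of T times a polynomial with constant coefficient 1 and invertible
   leading coefficient. *)
Definition ratden D : Prop :=
  exists (k : nat) (Q : {poly R}),
    [/\ D = 'X^k * Q, Q`_0 = 1 & exists c, c * lead_coef Q = 1].

Lemma lreg_linv (a c : R) : c * a = 1 -> GRing.lreg a.
Proof. by move=> ca x y e; rewrite -[x]mul1r -[y]mul1r -ca -!mulrA e. Qed.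

Lemma ratden_lreg D : ratden D -> GRing.lreg D.
Proof.
move=> [k [Q [-> _ [c cQ]]]]; apply: lregM; apply: lreg_lead.
  by rewrite lead_coefXn; exact: lreg1.
exact: lreg_linv cQ.
Qed.

Lemma ratdenXn k : ratden 'X^k.
Proof.
exists k, 1; split; rewrite ?mulr1 ?coef1 //.
by exists 1; rewrite lead_coef1 mulr1.
Qed.

Lemma ratden1 : ratden 1.
Proof. exact: (ratdenXn 0). Qed.

Lemma ratdenM D E : ratden D -> ratden E -> ratden (D * E).
Proof.
move=> [k [P [-> P0 [c cP]]]] [l [Q [-> Q0 [d dQ]]]].
have cdPQ : c * d * (lead_coef P * lead_coef Q) = 1.
  by rewrite mulrACA cP dQ mulr1.
exists (k + l)%N, (P * Q); split; first by rewrite exprD mulrACA.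
  by rewrite coefM big_ord1 P0 Q0 mulr1.
exists (c * d); rewrite lead_coef_proper_mul //.
by apply/eqP => z; move/eqP: cdPQ; rewrite z mulr0 eq_sym oner_eq0.
Qed.

End Denominators.

(* The ring of rational functions: the localisation of R[T, T^-1] at the
   polynomials with constant coefficient 1 and invertible leading coefficient.
   It is presented as the localisation of R[T] at the polynomials D such that
   ratden D.  These are regular (ratden_lreg), so that P / D = P' / D' if and
   only if P D' = P' D. *)
Module Ratfun.
Section Ratfun.
Variable R : comNzRingType.

Record frac := Frac { num : {poly R}; den : {poly R}; denP : ratden den }.

HB.instance Definition _ := gen_eqMixin frac.
HB.instance Definition _ := gen_choiceMixin frac.

Definition eqv (x y : frac) := num x * den y == num y * den x.

Lemma eqv_refl : reflexive eqv.
Proof. by move=> x; rewrite /eqv. Qed.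

Lemma eqv_sym : symmetric eqv.
Proof. by move=> x y; rewrite /eqv eq_sym. Qed.

Lemma eqv_trans : transitive eqv.
Proof.
move=> y x z /eqP xy /eqP yz; apply/eqP; apply: (ratden_lreg (denP y)).
have -> : den y * (num x * den z) = num x * den y * den z by ring.
have -> : den y * (num z * den x) = num z * den y * den x by ring.
by rewrite xy -yz; ring.
Qed.

Canonical eqv_equiv := EquivRel eqv eqv_refl eqv_sym eqv_trans.

Definition type := {eq_quot eqv}.
HB.instance Definition _ : EqQuotient _ eqv type := EqQuotient.on type.
HB.instance Definition _ := Choice.on type.

Lemma pi_eq (x y : frac) :
  num x * den y = num y * den x -> \pi_type x = \pi_type y.
Proof. by move=> e; apply/eqmodP; apply/eqP. Qed.

Lemma repr_eq (x : frac) :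
  num (repr (\pi_type x)) * den x = num x * den (repr (\pi_type x)).
Proof.
have /eqmodP/eqP // : repr (\pi_type x) = x %[mod type] by rewrite reprK.
Qed.

Definition addf (x y : frac) :=
  Frac (num x * den y + num y * den x) (ratdenM (denP x) (denP y)).
Definition oppf (x : frac) := Frac (- num x) (denP x).
Definition mulf (x y : frac) :=
  Frac (num x * num y) (ratdenM (denP x) (denP y)).
Definition polyf (P : {poly R}) := Frac P (ratden1 R).

Definition add (a b : type) : type := \pi_type (addf (repr a) (repr b)).
Definition opp (a : type) : type := \pi_type (oppf (repr a)).
Definition mul (a b : type) : type := \pi_type (mulf (repr a) (repr b)).
Definition of_poly (P : {poly R}) : type := \pi_type (polyf P).

Lemma addE x y : add (\pi_type x) (\pi_type y) = \pi_type (addf x y).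
Proof.
apply: pi_eq => /=; have ex := repr_eq x; have ey := repr_eq y.
set x' := repr _ in ex *; set y' := repr _ in ey *.
transitivity (num x' * den x * (den y' * den y)
            + num y' * den y * (den x' * den x)); first by ring.
by rewrite ex ey; ring.
Qed.

Lemma oppE x : opp (\pi_type x) = \pi_type (oppf x).
Proof. by apply: pi_eq => /=; rewrite !mulNr repr_eq. Qed.

Lemma mulE x y : mul (\pi_type x) (\pi_type y) = \pi_type (mulf x y).
Proof. by apply: pi_eq => /=; rewrite mulrACA !repr_eq mulrACA. Qed.

Lemma addA : associative add.
Proof.
elim/quotW=> x; elim/quotW=> y; elim/quotW=> z.
rewrite (addE y z) (addE x y) (addE x (addf y z)) (addE (addf x y) z).
by apply: pi_eq => /=; ring.
Qed.

Lemma addC : commutative add.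
Proof.
by elim/quotW=> x; elim/quotW=> y; rewrite (addE x) (addE y); apply: pi_eq => /=; ring.
Qed.

Lemma add0 : left_id (of_poly 0) add.
Proof. by elim/quotW=> x; rewrite addE; apply: pi_eq => /=; ring. Qed.

Lemma addN : left_inverse (of_poly 0) opp add.
Proof. by elim/quotW=> x; rewrite oppE addE; apply: pi_eq => /=; ring. Qed.

HB.instance Definition _ := GRing.isZmodule.Build type addA addC add0 addN.

Lemma mulA : associative mul.
Proof.
elim/quotW=> x; elim/quotW=> y; elim/quotW=> z.
rewrite (mulE y z) (mulE x y) (mulE x (mulf y z)) (mulE (mulf x y) z).
by apply: pi_eq => /=; ring.
Qed.

Lemma mulC : commutative mul.
Proof.
by elim/quotW=> x; elim/quotW=> y; rewrite (mulE x) (mulE y); apply: pi_eq => /=; ring.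
Qed.

Lemma mul1 : left_id (of_poly 1) mul.
Proof. by elim/quotW=> x; rewrite mulE; apply: pi_eq => /=; ring. Qed.

Lemma mulDl : left_distributive mul add.
Proof.
elim/quotW=> x; elim/quotW=> y; elim/quotW=> z.
rewrite (addE x y) (mulE x z) (mulE y z) (mulE (addf x y)) (addE (mulf x z)).
by apply: pi_eq => /=; ring.
Qed.

Lemma nonzero1 : of_poly 1 != 0 :> type.
Proof.
by apply/eqP => /eqmodP /eqP; rewrite /= !mulr1 => /eqP; rewrite oner_eq0.
Qed.

HB.instance Definition _ :=
  GRing.Zmodule_isComNzRing.Build type mulA mulC mul1 mulDl nonzero1.

Definition unit : {pred type} := [pred a | `[< exists b, b * a = 1 >]].
Definition inv (a : type) : type :=
  if pselect (exists b, b * a = 1) is left h then projT1 (cid h) else a.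

Lemma mulVr : {in unit, left_inverse 1 inv *%R}.
Proof.
move=> a /asboolP ua; rewrite /inv; case: pselect => // h.
by case: cid.
Qed.

Lemma unitP a b : b * a = 1 -> a \in unit.
Proof. by move=> ba; apply/asboolP; exists b. Qed.

Lemma invr_out : {in [predC unit], inv =1 id}.
Proof.
by move=> a /asboolP ua; rewrite /inv; case: pselect.
Qed.

HB.instance Definition _ :=
  GRing.ComNzRing_hasMulInverse.Build type mulVr unitP invr_out.

Lemma of_poly_zmod : zmod_morphism of_poly.
Proof.
move=> P Q; change (of_poly (P - Q) = add (of_poly P) (opp (of_poly Q))).
rewrite (oppE (polyf Q)) (addE (polyf P)).
by apply: pi_eq => /=; ring.
Qed.

Lemma of_poly_monoid : monoid_morphism of_poly.
Proof.
split=> // P Q; change (of_poly (P * Q) = mul (of_poly P) (of_poly Q)).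
by rewrite (mulE (polyf P)); apply: pi_eq => /=; ring.
Qed.

HB.instance Definition _ :=
  GRing.isZmodMorphism.Build {poly R} type of_poly of_poly_zmod.
HB.instance Definition _ :=
  GRing.isMonoidMorphism.Build {poly R} type of_poly of_poly_monoid.

End Ratfun.
End Ratfun.
HB.export Ratfun.

Notation ratfun := Ratfun.type.

Section RatfunOps.
Variable R : comNzRingType.

Definition ratpoly : {poly R} -> ratfun R := @Ratfun.of_poly R.
HB.instance Definition _ := GRing.RMorphism.on ratpoly.
Definition ratC (c : R) : ratfun R := ratpoly c%:P.
HB.instance Definition _ := GRing.RMorphism.copy ratC (ratpoly \o polyC).
Definition ratT : ratfun R := ratpoly 'X.

Lemma ratpoly_unit D : ratden D -> ratpoly D \is a GRing.unit.
Proof.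
move=> dD; pose b : ratfun R := \pi_(ratfun R) (Ratfun.Frac 1 dD).
apply: (@Ratfun.unitP _ (ratpoly D) b).
by rewrite [LHS]Ratfun.mulE; apply: Ratfun.pi_eq => /=; ring.
Qed.

Lemma ratpoly_inj : injective ratpoly.
Proof. by move=> P Q /eqmodP/eqP /=; rewrite !mulr1. Qed.

Lemma ratfunE f : f = ratpoly (Ratfun.num (repr f)) / ratpoly (Ratfun.den (repr f)).
Proof.
have dD := Ratfun.denP (repr f); apply: (mulIr (ratpoly_unit dD)).
rewrite mulrVK ?ratpoly_unit // -{1}[f]reprK [LHS]Ratfun.mulE.
by apply: Ratfun.pi_eq => /=; ring.
Qed.

(* P(T^-1) *)
Definition evalV (P : {poly R}) : ratfun R := (map_poly ratC P).[ratT^-1].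

(* The substitution T := T^-1; see ratsubV_frac. *)
Definition ratsubV (f : ratfun R) : ratfun R :=
  evalV (Ratfun.num (repr f)) / evalV (Ratfun.den (repr f)).

(* The power series \sum_n (u n) T^n is the expansion of f at T = 0. *)
Definition ratexp (f : ratfun R) (u : nat -> R) : Prop :=
  exists P Q : {poly R},
    [/\ Q`_0 = 1, exists c, c * lead_coef Q = 1,
        f * ratpoly Q = ratpoly P
      & forall n, \sum_(i < n.+1) Q`_i * u (n - i)%N = P`_n].

Lemma ratexp_uniq f g u : ratexp f u -> ratexp g u -> f = g.
Proof.
move=> [P [Q [Q0 Ql fQ QP]]] [P' [Q' [Q0' Ql' gQ' QP']]].
have dQ : ratden Q by exists 0%N, Q; split; rewrite ?mul1r.
have dQ' : ratden Q' by exists 0%N, Q'; split; rewrite ?mul1r.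
have e : Q' * P = Q * P'.
  apply/polyP => n; pose U := \poly_(i < n.+1) u i.
  have h (A B : {poly R}) : (forall k, \sum_(i < k.+1) A`_i * u (k - i)%N = B`_k) ->
      forall k, (k <= n)%N -> (A * U)`_k = B`_k.
    move=> AB k kn; rewrite -AB coefM; apply: eq_bigr => i _.
    by rewrite coef_poly ltnS (leq_trans (leq_subr _ _) kn).
  have hQ := h _ _ QP; have hQ' := h _ _ QP'.
  have c (A B : {poly R}) : (forall k, (k <= n)%N -> (B * U)`_k = A`_k) ->
      forall D : {poly R}, (D * A)`_n = (D * (B * U))`_n.
    move=> BA D; rewrite !coefMr; apply: eq_bigr => i _.
    by rewrite BA // -ltnS.
  by rewrite (c _ _ hQ) (c _ _ hQ') mulrCA.
apply: (mulIr (ratpoly_unit dQ)); apply: (mulIr (ratpoly_unit dQ')).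
rewrite fQ mulrAC gQ' mulrC.
by rewrite -!rmorphM e mulrC.
Qed.

Lemma evalV_ratden D : ratden D -> evalV D \is a GRing.unit.
Proof.
move=> [k [Q [-> Q0 [c cQ]]]].
have uT : ratT \is a GRing.unit.
  by apply: ratpoly_unit; rewrite -['X]expr1; exact: ratdenXn.
have uTV : ratT^-1 \is a GRing.unit by rewrite unitrV.
rewrite /evalV rmorphM hornerM rmorphXn /= map_polyX hornerXn.
rewrite unitrMr ?unitrX //.
set m := (size Q).-1; pose S := \poly_(j < m.+1) (c * Q`_(m - j)).
have sQ : (size Q = m.+1)%N.
  rewrite /m prednK // size_poly_gt0; apply/eqP => z; move: Q0.
  by rewrite z coef0 => /eqP; rewrite eq_sym oner_eq0.
have c0 : c != 0.
  by apply/eqP => z; move/eqP: cQ; rewrite z mul0r eq_sym oner_eq0.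
have dS : ratden S.
  exists 0%N, S; split; first by rewrite mul1r.
    by rewrite coef_poly subn0 -[Q`_m]/(lead_coef Q).
  exists (lead_coef Q); rewrite lead_coef_poly ?subnn ?Q0 ?mulr1 //.
  by rewrite mulrC.
have eS : ratC c * ((map_poly ratC Q).[ratT^-1] * ratT ^+ m) = ratpoly S.
  rewrite horner_poly sQ mulr_suml mulr_sumr /S poly_def rmorph_sum.
  rewrite [RHS](reindex_inj rev_ord_inj) /=; apply: eq_bigr => i _ /=.
  have im : (i <= m)%N by rewrite -ltnS.
  rewrite subSS subKn // -mul_polyC polyCM !rmorphM rmorphXn /=.
  rewrite -!mulrA; congr (_ * (_ * _)).
  have -> : ratT ^+ m = ratT ^+ (m - i) * ratT ^+ i by rewrite -exprD subnK.
  by rewrite mulrCA -exprMn mulVr // expr1n mulr1.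
have := ratpoly_unit dS; rewrite -eS mulrCA unitrM.
by case/andP.
Qed.

Lemma ratsubV_frac P D : ratden D ->
  ratsubV (ratpoly P / ratpoly D) = evalV P / evalV D.
Proof.
move=> dD; set f := _ / _; rewrite /ratsubV.
set N := Ratfun.num _; set E := Ratfun.den _.
have dE : ratden E by exact: Ratfun.denP.
have e : N * D = P * E.
  have fE : f * ratpoly E = ratpoly N.
    by rewrite [f in LHS]ratfunE divrK // ratpoly_unit.
  apply: ratpoly_inj; rewrite !rmorphM /= -fE /f mulrAC divrK ?ratpoly_unit //.
apply: (mulIr (evalV_ratden dD)); apply: (mulIr (evalV_ratden dE)).
rewrite mulrAC divrK ?evalV_ratden // divrK ?evalV_ratden //.
by rewrite /evalV -!hornerM -!rmorphM e.
Qed.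

End RatfunOps.
Arguments ratT {R}.

Declare Scope cat_scope.
Delimit Scope cat_scope with cat.
Local Open Scope cat_scope.

Reserved Notation "g ∘ f" (at level 40, left associativity).
Reserved Notation "X ⊗ Y" (at level 38, left associativity).
Reserved Notation "f ⊠ g" (at level 38, left associativity).
Reserved Notation "X ⊕ Y" (at level 39, left associativity).
Reserved Notation "X ≅ Y" (at level 70, no associativity).

Record linearCategory (K : fieldType) := LinearCategory {
  Ob :> Type;
  Hom : Ob -> Ob -> lmodType K;
  idm : forall X, Hom X X;
  comp : forall X Y Z, Hom Y Z -> Hom X Y -> Hom X Z;
  comp_idl : forall X Y (f : Hom X Y), comp (idm Y) f = f;
  comp_idr : forall X Y (f : Hom X Y), comp f (idm X) = f;
  compA : forall X Y Z W (h : Hom Z W) (g : Hom Y Z) (f : Hom X Y),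
    comp h (comp g f) = comp (comp h g) f;
  comp_linear_l : forall X Y Z (f : Hom X Y), linear (fun g : Hom Y Z => comp g f);
  comp_linear_r : forall X Y Z (g : Hom Y Z), linear (fun f : Hom X Y => comp g f)
}.
Arguments idm {K C} X : rename.
Notation "g ∘ f" := (comp g f) : cat_scope.

Definition iso (K : fieldType) (C : linearCategory K) (X Y : C) : Prop :=
  exists (f : Hom X Y) (g : Hom Y X), g ∘ f = idm X /\ f ∘ g = idm Y.
Notation "X ≅ Y" := (iso X Y) : cat_scope.

Definition is_zero (K : fieldType) (C : linearCategory K) (X : C) : Prop :=
  idm X = 0.

(* Additive and idempotent-complete, with chosen zero object, biproducts and
   images.  An image is chosen for every endomorphism e, but it is only required
   to split e when e is idempotent. *)
Record pseudoAbelianCategory (K : fieldType) := PseudoAbelianCategory {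
  pa_lin :> linearCategory K;
  zero_ob : pa_lin;
  zero_obP : is_zero zero_ob;
  bip : pa_lin -> pa_lin -> pa_lin;
  in1 : forall X Y, Hom X (bip X Y);
  in2 : forall X Y, Hom Y (bip X Y);
  pr1 : forall X Y, Hom (bip X Y) X;
  pr2 : forall X Y, Hom (bip X Y) Y;
  pr1_in1 : forall X Y, pr1 X Y ∘ in1 X Y = idm X;
  pr2_in2 : forall X Y, pr2 X Y ∘ in2 X Y = idm Y;
  pr1_in2 : forall X Y, pr1 X Y ∘ in2 X Y = 0;
  pr2_in1 : forall X Y, pr2 X Y ∘ in1 X Y = 0;
  bip_id : forall X Y,
    in1 X Y ∘ pr1 X Y + in2 X Y ∘ pr2 X Y = idm (bip X Y);
  img : forall X : pa_lin, Hom X X -> pa_lin;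
  img_in : forall (X : pa_lin) (e : Hom X X), Hom (img e) X;
  img_pr : forall (X : pa_lin) (e : Hom X X), Hom X (img e);
  img_prK : forall (X : pa_lin) (e : Hom X X), e ∘ e = e ->
    img_pr e ∘ img_in e = idm (img e);
  img_inK : forall (X : pa_lin) (e : Hom X X), e ∘ e = e ->
    img_in e ∘ img_pr e = e
}.
Notation "X ⊕ Y" := (bip X Y) : cat_scope.

(* Symmetric monoidal, with bilinear tensor product: ⊗ on objects, ⊠ on
   morphisms. *)
Record tensorCategory (K : fieldType) := TensorCategory {
  tc_pa :> pseudoAbelianCategory K;
  one_ob : tc_pa;
  ten : tc_pa -> tc_pa -> tc_pa;
  tenm : forall X X' Y Y' : tc_pa,
    Hom X X' -> Hom Y Y' -> Hom (ten X Y) (ten X' Y');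
  tenm_id : forall X Y, tenm (idm X) (idm Y) = idm (ten X Y);
  tenm_comp : forall (X X' X'' Y Y' Y'' : tc_pa) (f' : Hom X' X'')
      (f : Hom X X') (g' : Hom Y' Y'') (g : Hom Y Y'),
    tenm (f' ∘ f) (g' ∘ g) = tenm f' g' ∘ tenm f g;
  tenm_linear_l : forall (X X' Y Y' : tc_pa) (g : Hom Y Y'),
    linear (fun f : Hom X X' => tenm f g);
  tenm_linear_r : forall (X X' Y Y' : tc_pa) (f : Hom X X'),
    linear (fun g : Hom Y Y' => tenm f g);

  assoc : forall X Y Z, Hom (ten (ten X Y) Z) (ten X (ten Y Z));
  assocV : forall X Y Z, Hom (ten X (ten Y Z)) (ten (ten X Y) Z);
  assocK : forall X Y Z, assocV X Y Z ∘ assoc X Y Z = idm _;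
  assocVK : forall X Y Z, assoc X Y Z ∘ assocV X Y Z = idm _;
  assoc_nat : forall (X X' Y Y' Z Z' : tc_pa)
      (f : Hom X X') (g : Hom Y Y') (h : Hom Z Z'),
    assoc X' Y' Z' ∘ tenm (tenm f g) h = tenm f (tenm g h) ∘ assoc X Y Z;

  lun : forall X, Hom (ten one_ob X) X;
  lunV : forall X, Hom X (ten one_ob X);
  lunK : forall X, lunV X ∘ lun X = idm _;
  lunVK : forall X, lun X ∘ lunV X = idm _;
  lun_nat : forall (X X' : tc_pa) (f : Hom X X'),
    lun X' ∘ tenm (idm one_ob) f = f ∘ lun X;

  run : forall X, Hom (ten X one_ob) X;
  runV : forall X, Hom X (ten X one_ob);
  runK : forall X, runV X ∘ run X = idm _;
  runVK : forall X, run X ∘ runV X = idm _;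
  run_nat : forall (X X' : tc_pa) (f : Hom X X'),
    run X' ∘ tenm f (idm one_ob) = f ∘ run X;

  pentagon : forall X Y Z W,
    assoc X Y (ten Z W) ∘ assoc (ten X Y) Z W
    = tenm (idm X) (assoc Y Z W) ∘ assoc X (ten Y Z) W
        ∘ tenm (assoc X Y Z) (idm W);
  triangle : forall X Y,
    tenm (idm X) (lun Y) ∘ assoc X one_ob Y = tenm (run X) (idm Y);

  braid : forall X Y, Hom (ten X Y) (ten Y X);
  braid_nat : forall (X X' Y Y' : tc_pa) (f : Hom X X') (g : Hom Y Y'),
    braid X' Y' ∘ tenm f g = tenm g f ∘ braid X Y;
  braidK : forall X Y, braid Y X ∘ braid X Y = idm _;
  hexagon : forall X Y Z,
    assoc Y Z X ∘ braid X (ten Y Z) ∘ assoc X Y Z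
    = tenm (idm Y) (braid X Z) ∘ assoc Y X Z ∘ tenm (braid X Y) (idm Z)
}.
Arguments one_ob {K C} : rename.
Notation "𝟙" := one_ob : cat_scope.
Notation "X ⊗ Y" := (ten X Y) : cat_scope.
Notation "f ⊠ g" := (tenm f g) : cat_scope.

(* Every object has a dual, and End(𝟙) = K. *)
Record rigidTensorCategory (K : fieldType) := RigidTensorCategory {
  rtc_tc :> tensorCategory K;
  dual : rtc_tc -> rtc_tc;
  ev : forall X, Hom (dual X ⊗ X) 𝟙;
  coev : forall X, Hom 𝟙 (X ⊗ dual X);
  zigzag : forall X,
    run X ∘ (idm X ⊠ ev X) ∘ assoc X (dual X) X ∘ (coev X ⊠ idm X) ∘ lunV X
    = idm X;
  zagzig : forall X,
    lun (dual X) ∘ (ev X ⊠ idm (dual X)) ∘ assocV (dual X) X (dual X)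
      ∘ (idm (dual X) ⊠ coev X) ∘ runV (dual X)
    = idm (dual X);
  end_unit : bijective (fun a : K => a *: idm (𝟙 : rtc_tc))
}.

Section Powers.
Variables (K : fieldType) (C : tensorCategory K).
Implicit Types X : C.

Fixpoint tpow X (n : nat) : C := if n is n'.+1 then X ⊗ tpow X n' else 𝟙.

Definition swap12 X Y : Hom (X ⊗ (X ⊗ Y)) (X ⊗ (X ⊗ Y)) :=
  assoc X X Y ∘ (braid X X ⊠ idm Y) ∘ assocV X X Y.

(* The first factor of X ⊗ X^⊗n is moved to position i (counted from 0), the
   relative order of the other factors being unchanged. *)
Fixpoint insert_factor X (n i : nat) : Hom (tpow X n.+1) (tpow X n.+1) :=
  match n, i with
  | n'.+1, i'.+1 => (idm X ⊠ insert_factor X n' i') ∘ swap12 X (tpow X n')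
  | _, _ => idm _
  end.

Definition perm_tail_fun n (s : 'S_n.+1) (k : 'I_n) : 'I_n :=
  odflt k (unlift (s ord0) (s (lift ord0 k))).

Lemma perm_tail_funE n (s : 'S_n.+1) (k : 'I_n) :
  lift (s ord0) (perm_tail_fun s k) = s (lift ord0 k).
Proof.
rewrite /perm_tail_fun; case: unliftP => [j -> //|/perm_inj/eqP].
by rewrite eq_sym (negbTE (neq_lift _ _)).
Qed.

Lemma perm_tail_inj n (s : 'S_n.+1) : injective (perm_tail_fun s).
Proof.
move=> j k e; apply: (@lift_inj _ ord0); apply: (@perm_inj _ s).
by rewrite -!perm_tail_funE e.
Qed.

Definition perm_tail n (s : 'S_n.+1) : 'S_n := perm (@perm_tail_inj n s).

(* The action of the symmetric group: the factor in position k is moved to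
   position s k.  One has s = lift_perm ord0 (s ord0) (perm_tail s). *)
Fixpoint perm_act X (n : nat) : 'S_n -> Hom (tpow X n) (tpow X n) :=
  match n with
  | 0 => fun=> idm _
  | n'.+1 => fun s =>
      insert_factor X n' (s ord0) ∘ (idm X ⊠ perm_act X (perm_tail s))
  end.

Definition symmetrizer X n : Hom (tpow X n) (tpow X n) :=
  (n`!%:R)^-1 *: \sum_(s : 'S_n) perm_act X s.

Definition antisymmetrizer X n : Hom (tpow X n) (tpow X n) :=
  (n`!%:R)^-1 *: \sum_(s : 'S_n) (-1) ^+ s *: perm_act X s.

Definition Sym n X : C := img (symmetrizer X n).
Definition Alt n X : C := img (antisymmetrizer X n).

Definition positive X : Prop := exists2 N, (0 < N)%N & is_zero (Alt N X).
Definition negative X : Prop := exists2 N, (0 < N)%N & is_zero (Sym N X).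

End Powers.

(* The group completion of a commutative semiring; (x, y) stands for x - y. *)
Module Completion.
Section Completion.
Variable S : comPzSemiRingType.

Record diff := Diff { pos : S; neg : S }.
HB.instance Definition _ := gen_eqMixin diff.
HB.instance Definition _ := gen_choiceMixin diff.

Definition eqv (x y : diff) : bool :=
  `[< exists z, pos x + neg y + z = pos y + neg x + z >].

Lemma eqv_refl : reflexive eqv.
Proof. by move=> x; apply/asboolP; exists 0. Qed.

Lemma eqv_sym : symmetric eqv.
Proof. by move=> x y; apply/asboolP/asboolP => -[z e]; exists z. Qed.

Lemma eqv_trans : transitive eqv.
Proof.
move=> y x z /asboolP[u xy] /asboolP[v yz]; apply/asboolP.
exists (pos y + neg y + u + v).
transitivity (pos x + neg y + u + (pos y + neg z + v)); first by ring.
by rewrite xy yz; ring.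
Qed.

Canonical eqv_equiv := EquivRel eqv eqv_refl eqv_sym eqv_trans.

Definition type := {eq_quot eqv}.
HB.instance Definition _ : EqQuotient _ eqv type := EqQuotient.on type.
HB.instance Definition _ := Choice.on type.

Lemma pi_eq x y z :
  pos x + neg y + z = pos y + neg x + z -> \pi_type x = \pi_type y.
Proof. by move=> e; apply/eqmodP/asboolP; exists z. Qed.

Lemma pi_inj x y : \pi_type x = \pi_type y ->
  exists z, pos x + neg y + z = pos y + neg x + z.
Proof. by move=> /eqmodP/asboolP. Qed.

Lemma repr_eq x : exists z,
  pos (repr (\pi_type x)) + neg x + z = pos x + neg (repr (\pi_type x)) + z.
Proof. by apply: pi_inj; rewrite reprK. Qed.

Definition addd x y := Diff (pos x + pos y) (neg x + neg y).
Definition oppd x := Diff (neg x) (pos x).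
Definition muld x y :=
  Diff (pos x * pos y + neg x * neg y) (pos x * neg y + neg x * pos y).

Definition add (a b : type) : type := \pi_type (addd (repr a) (repr b)).
Definition opp (a : type) : type := \pi_type (oppd (repr a)).
Definition mul (a b : type) : type := \pi_type (muld (repr a) (repr b)).
Definition of_semi (x : S) : type := \pi_type (Diff x 0).

Lemma addE x y : add (\pi_type x) (\pi_type y) = \pi_type (addd x y).
Proof.
have [u ex] := repr_eq x; have [v ey] := repr_eq y.
rewrite /add; set x' := repr _ in ex *; set y' := repr _ in ey *.
apply: (@pi_eq _ _ (u + v)) => /=.
transitivity ((pos x' + neg x + u) + (pos y' + neg y + v)); first by ring.
by rewrite ex ey; ring.
Qed.

Lemma oppE x : opp (\pi_type x) = \pi_type (oppd x).
Proof.
have [u ex] := repr_eq x; apply: (@pi_eq _ _ u) => /=.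
by rewrite [neg _ + _]addrC [neg x + _]addrC ex.
Qed.

Lemma mulC : commutative mul.
Proof.
by move=> a b; congr \pi_type; rewrite /muld; congr Diff; ring.
Qed.

Lemma mulEl x b : mul (\pi_type x) b = \pi_type (muld x (repr b)).
Proof.
have [u ex] := repr_eq x.
rewrite /mul; set x' := repr _ in ex *; set y := repr b.
apply: (@pi_eq _ _ (u * pos y + u * neg y)) => /=.
transitivity ((pos x' + neg x + u) * pos y + (pos x + neg x' + u) * neg y).
  by ring.
by rewrite -ex {1}ex; ring.
Qed.

Lemma mulE x y : mul (\pi_type x) (\pi_type y) = \pi_type (muld x y).
Proof.
rewrite mulEl; have [v ey] := repr_eq y; set y' := repr _ in ey *.
apply: (@pi_eq _ _ (v * pos x + v * neg x)) => /=.
transitivity ((pos y' + neg y + v) * pos x + (pos y + neg y' + v) * neg x).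
  by ring.
by rewrite -ey {1}ey; ring.
Qed.

Lemma addA : associative add.
Proof.
elim/quotW=> x; elim/quotW=> y; elim/quotW=> z.
rewrite (addE y z) (addE x y) (addE x (addd y z)) (addE (addd x y) z).
by apply: (@pi_eq _ _ 0) => /=; ring.
Qed.

Lemma addC : commutative add.
Proof.
by move=> a b; congr \pi_type; rewrite /addd; congr Diff; ring.
Qed.

Lemma add0 : left_id (of_semi 0) add.
Proof.
by elim/quotW=> x; rewrite (addE (Diff 0 0)); apply: (@pi_eq _ _ 0) => /=; ring.
Qed.

Lemma addN : left_inverse (of_semi 0) opp add.
Proof.
elim/quotW=> x; rewrite (oppE x) (addE (oppd x)).
by apply: (@pi_eq _ _ 0) => /=; ring.
Qed.

HB.instance Definition _ := GRing.isZmodule.Build type addA addC add0 addN.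

Lemma mulA : associative mul.
Proof.
elim/quotW=> x; elim/quotW=> y; elim/quotW=> z.
rewrite (mulE y z) (mulE x y) (mulE x (muld y z)) (mulE (muld x y) z).
by apply: (@pi_eq _ _ 0) => /=; ring.
Qed.

Lemma mul1 : left_id (of_semi 1) mul.
Proof.
by elim/quotW=> x; rewrite (mulE (Diff 1 0)); apply: (@pi_eq _ _ 0) => /=; ring.
Qed.

Lemma mulDl : left_distributive mul add.
Proof.
elim/quotW=> x; elim/quotW=> y; elim/quotW=> z.
rewrite (addE x y) (mulE x z) (mulE y z) (mulE (addd x y)) (addE (muld x z)).
by apply: (@pi_eq _ _ 0) => /=; ring.
Qed.

HB.instance Definition _ :=
  GRing.Zmodule_isComPzRing.Build type mulA mulC mul1 mulDl.

End Completion.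
End Completion.
HB.export Completion.

Section LinearLemmas.
Variable K : fieldType.

Lemma linear_morphD (U V : lmodType K) (f : U -> V) :
  linear f -> {morph f : x y / x + y}.
Proof. by move=> lf x y; have := lf 1 x y; rewrite !scale1r. Qed.

Lemma linear_morph0 (U V : lmodType K) (f : U -> V) : linear f -> f 0 = 0.
Proof.
move=> lf; have := linear_morphD lf 0 0; rewrite addr0 => e.
by apply: (addrI (f 0)); rewrite addr0 -e.
Qed.

Variable C : linearCategory K.

Lemma compDl (X Y Z : C) (g g' : Hom Y Z) (f : Hom X Y) :
  (g + g') ∘ f = g ∘ f + g' ∘ f.
Proof. exact: (linear_morphD (@comp_linear_l K C X Y Z f) g g'). Qed.

Lemma compDr (X Y Z : C) (g : Hom Y Z) (f f' : Hom X Y) :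
  g ∘ (f + f') = g ∘ f + g ∘ f'.
Proof. exact: (linear_morphD (@comp_linear_r K C X Y Z g) f f'). Qed.

Lemma comp0l (X Y Z : C) (f : Hom X Y) : (0 : Hom Y Z) ∘ f = 0.
Proof. exact: (linear_morph0 (@comp_linear_l K C X Y Z f)). Qed.

Lemma comp0r (X Y Z : C) (g : Hom Y Z) : g ∘ (0 : Hom X Y) = 0.
Proof. exact: (linear_morph0 (@comp_linear_r K C X Y Z g)). Qed.

Lemma iso_refl (X : C) : X ≅ X.
Proof. by exists (idm X), (idm X); rewrite comp_idl. Qed.

Lemma iso_sym (X Y : C) : X ≅ Y -> Y ≅ X.
Proof. by move=> [f [g [gf fg]]]; exists g, f. Qed.

Lemma iso_trans (X Y Z : C) : X ≅ Y -> Y ≅ Z -> X ≅ Z.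
Proof.
move=> [f [g [gf fg]]] [h [k [kh hk]]]; exists (h ∘ f), (g ∘ k); split.
  by rewrite compA -(compA g) kh comp_idr gf.
by rewrite compA -(compA h) fg comp_idr hk.
Qed.

End LinearLemmas.

Section PseudoAbelianLemmas.
Variables (K : fieldType) (C : pseudoAbelianCategory K).

Lemma bip_char (W X Y : C) (i1 : Hom X W) (i2 : Hom Y W)
    (p1 : Hom W X) (p2 : Hom W Y) :
  p1 ∘ i1 = idm X -> p2 ∘ i2 = idm Y -> p1 ∘ i2 = 0 -> p2 ∘ i1 = 0 ->
  i1 ∘ p1 + i2 ∘ p2 = idm W -> W ≅ X ⊕ Y.
Proof.
move=> e11 e22 e12 e21 eW.
exists (in1 X Y ∘ p1 + in2 X Y ∘ p2), (i1 ∘ pr1 X Y + i2 ∘ pr2 X Y); split.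
  rewrite !(compDl, compDr) !compA -!(compA i1) -!(compA i2).
  by rewrite pr1_in1 pr2_in2 pr1_in2 pr2_in1 !(comp_idl, comp_idr, comp0l, comp0r) addr0 add0r.
rewrite !(compDl, compDr) !compA -!(compA (in1 X Y)) -!(compA (in2 X Y)).
by rewrite e11 e12 e21 e22 !(comp_idl, comp_idr, comp0l, comp0r) addr0 add0r bip_id.
Qed.

Lemma bip_isoP (W X Y : C) : W ≅ X ⊕ Y ->
  exists (i1 : Hom X W) (i2 : Hom Y W) (p1 : Hom W X) (p2 : Hom W Y),
  [/\ p1 ∘ i1 = idm X, p2 ∘ i2 = idm Y, p1 ∘ i2 = 0, p2 ∘ i1 = 0
    & i1 ∘ p1 + i2 ∘ p2 = idm W].
Proof.
move=> [f [g [gf fg]]].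
exists (g ∘ in1 X Y), (g ∘ in2 X Y), (pr1 X Y ∘ f), (pr2 X Y ∘ f).
have c Z T (h : Hom (X ⊕ Y) Z) (k : Hom T (X ⊕ Y)) :
    (h ∘ f) ∘ (g ∘ k) = h ∘ k.
  by rewrite compA -(compA h) fg comp_idr.
have d Z (h : Hom Z (X ⊕ Y)) (k : Hom (X ⊕ Y) Z) :
    (g ∘ h) ∘ (k ∘ f) = g ∘ (h ∘ k) ∘ f by rewrite !compA.
rewrite !c !d // pr1_in1 pr2_in2 pr1_in2 pr2_in1; split => //.
by rewrite -compDl -compDr bip_id comp_idr gf.
Qed.

Lemma bip_iso (X X' Y Y' : C) : X ≅ X' -> Y ≅ Y' -> X ⊕ Y ≅ X' ⊕ Y'.
Proof.
move=> [f [g [gf fg]]] [h [k [kh hk]]].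
apply: (@bip_char _ _ _ (in1 X Y ∘ g) (in2 X Y ∘ k) (f ∘ pr1 X Y) (h ∘ pr2 X Y));
  rewrite !compA.
- by rewrite -(compA f) pr1_in1 comp_idr.
- by rewrite -(compA h) pr2_in2 comp_idr.
- by rewrite -(compA f) pr1_in2 comp0r comp0l.
- by rewrite -(compA h) pr2_in1 comp0r comp0l.
- by rewrite -!(compA (in1 X Y)) -!(compA (in2 X Y)) gf kh !(comp_idl, comp_idr) bip_id.
Qed.

Lemma bipC (X Y : C) : X ⊕ Y ≅ Y ⊕ X.
Proof.
apply: (@bip_char _ _ _ (in2 X Y) (in1 X Y) (pr2 X Y) (pr1 X Y));
  rewrite ?pr1_in1 ?pr2_in2 ?pr1_in2 ?pr2_in1 //.
by rewrite addrC bip_id.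
Qed.

Lemma bipA (X Y Z : C) : X ⊕ (Y ⊕ Z) ≅ X ⊕ Y ⊕ Z.
Proof.
set W := X ⊕ (Y ⊕ Z).
pose i1 : Hom X W := in1 X (Y ⊕ Z); pose p1 : Hom W X := pr1 X (Y ⊕ Z).
pose j := in2 X (Y ⊕ Z); pose q := pr2 X (Y ⊕ Z).
pose i2 : Hom Y W := j ∘ in1 Y Z; pose p2 : Hom W Y := pr1 Y Z ∘ q.
pose i3 : Hom Z W := j ∘ in2 Y Z; pose p3 : Hom W Z := pr2 Y Z ∘ q.
have qj T U (h : Hom _ T) (k : Hom U _) : (h ∘ q) ∘ (j ∘ k) = h ∘ k.
  by rewrite compA -(compA h) pr2_in2 comp_idr.
have e11 : p1 ∘ i1 = idm X by exact: pr1_in1.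
have e22 : p2 ∘ i2 = idm Y by rewrite qj pr1_in1.
have e33 : p3 ∘ i3 = idm Z by rewrite qj pr2_in2.
have e23 : p2 ∘ i3 = 0 by rewrite qj pr1_in2.
have e32 : p3 ∘ i2 = 0 by rewrite qj pr2_in1.
have e12 : p1 ∘ i2 = 0 by rewrite compA pr1_in2 comp0l.
have e13 : p1 ∘ i3 = 0 by rewrite compA pr1_in2 comp0l.
have e21 : p2 ∘ i1 = 0 by rewrite -compA pr2_in1 comp0r.
have e31 : p3 ∘ i1 = 0 by rewrite -compA pr2_in1 comp0r.
have e : i1 ∘ p1 + (i2 ∘ p2 + i3 ∘ p3) = idm W.
  have -> : i2 ∘ p2 + i3 ∘ p3 = j ∘ q.
    rewrite /i2 /i3 /p2 /p3 !compA -!(compA j) -compDr -compDl.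
    by rewrite bip_id comp_idl.
  exact: bip_id.
clearbody i1 i2 i3 p1 p2 p3.
apply: (@bip_char _ _ _ (i1 ∘ pr1 X Y + i2 ∘ pr2 X Y) i3
          (in1 X Y ∘ p1 + in2 X Y ∘ p2) p3).
- rewrite !(compDl, compDr) !compA -!(compA (in1 X Y)) -!(compA (in2 X Y)).
  by rewrite e11 e12 e21 e22 !(comp_idl, comp_idr, comp0l, comp0r) addr0 add0r bip_id.
- exact: e33.
- by rewrite compDl -!compA e13 e23 !comp0r addr0.
- by rewrite compDr !compA e31 e32 !comp0l addr0.
- rewrite !(compDl, compDr) !compA -!(compA i1) -!(compA i2).
  rewrite pr1_in1 pr1_in2 pr2_in1 pr2_in2 !(comp_idl, comp_idr, comp0l, comp0r).
  by rewrite addr0 add0r -addrA.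
Qed.

Lemma zero_hom_l (X : C) (f : Hom (zero_ob C) X) : f = 0.
Proof. by rewrite -[f]comp_idr (zero_obP C) comp0r. Qed.

Lemma zero_hom_r (X : C) (f : Hom X (zero_ob C)) : f = 0.
Proof. by rewrite -[f]comp_idl (zero_obP C) comp0l. Qed.

Lemma bip0 (X : C) : zero_ob C ⊕ X ≅ X.
Proof.
apply: iso_sym; apply: (@bip_char _ _ _ 0 (idm X) 0 (idm X));
  rewrite ?comp_idl ?comp0l ?comp0r ?add0r //.
by rewrite (zero_obP C).
Qed.

End PseudoAbelianLemmas.

Section TensorLemmas.
Variables (K : fieldType) (C : tensorCategory K).

Lemma ten_iso (X X' Y Y' : C) : X ≅ X' -> Y ≅ Y' -> X ⊗ Y ≅ X' ⊗ Y'.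
Proof.
move=> [f [g [gf fg]]] [h [k [kh hk]]]; exists (f ⊠ h), (g ⊠ k).
by rewrite -!tenm_comp gf kh fg hk !tenm_id.
Qed.

Lemma tenA (X Y Z : C) : X ⊗ (Y ⊗ Z) ≅ X ⊗ Y ⊗ Z.
Proof.
by exists (assocV X Y Z), (assoc X Y Z); rewrite assocK assocVK.
Qed.

Lemma tenC (X Y : C) : X ⊗ Y ≅ Y ⊗ X.
Proof. by exists (braid X Y), (braid Y X); rewrite !braidK. Qed.

Lemma ten1 (X : C) : 𝟙 ⊗ X ≅ X.
Proof. by exists (lun X), (lunV X); rewrite lunK lunVK. Qed.

Lemma tenmDl (X X' Y Y' : C) (f f' : Hom X X') (g : Hom Y Y') :
  (f + f') ⊠ g = f ⊠ g + f' ⊠ g.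
Proof. exact: (linear_morphD (@tenm_linear_l K C X X' Y Y' g) f f'). Qed.

Lemma tenm0l (X X' Y Y' : C) (g : Hom Y Y') : (0 : Hom X X') ⊠ g = 0.
Proof. exact: (linear_morph0 (@tenm_linear_l K C X X' Y Y' g)). Qed.

Lemma ten_bip (X Y Z : C) : (X ⊕ Y) ⊗ Z ≅ X ⊗ Z ⊕ Y ⊗ Z.
Proof.
apply: (@bip_char _ _ _ _ _ (in1 X Y ⊠ idm Z) (in2 X Y ⊠ idm Z)
          (pr1 X Y ⊠ idm Z) (pr2 X Y ⊠ idm Z));
  rewrite -!tenm_comp ?comp_idl ?pr1_in1 ?pr2_in2 ?pr1_in2 ?pr2_in1 ?tenm_id
    ?tenm0l //.
by rewrite -tenmDl bip_id tenm_id.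
Qed.

Lemma ten0 (X : C) : zero_ob C ⊗ X ≅ zero_ob C.
Proof.
exists 0, 0; rewrite !comp0l (zero_obP C); split => //.
by rewrite -tenm_id (zero_obP C) tenm0l.
Qed.

End TensorLemmas.

(* The semiring of isomorphism classes of objects. *)
Module IsoClass.
Section IsoClass.
Variables (K : fieldType) (C : tensorCategory K).

Record obj := Obj { ob : C }.
HB.instance Definition _ := gen_eqMixin obj.
HB.instance Definition _ := gen_choiceMixin obj.

Definition eqv (x y : obj) : bool := `[< ob x ≅ ob y >].

Lemma eqv_refl : reflexive eqv.
Proof. by move=> x; apply/asboolP/iso_refl. Qed.

Lemma eqv_sym : symmetric eqv.
Proof. by move=> x y; apply/asboolP/asboolP; exact: iso_sym. Qed.

Lemma eqv_trans : transitive eqv.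
Proof.
by move=> y x z /asboolP xy /asboolP yz; apply/asboolP/(iso_trans xy yz).
Qed.

Canonical eqv_equiv := EquivRel eqv eqv_refl eqv_sym eqv_trans.

Definition type := {eq_quot eqv}.
HB.instance Definition _ : EqQuotient _ eqv type := EqQuotient.on type.
HB.instance Definition _ := Choice.on type.

Definition class_of (X : C) : type := \pi_type (Obj X).

Lemma classP (X Y : C) : class_of X = class_of Y <-> X ≅ Y.
Proof. by split => [/eqmodP/asboolP|h]; last exact/eqmodP/asboolP. Qed.

Definition repr_ob (a : type) : C := ob (repr a).

Lemma repr_obK a : class_of (repr_ob a) = a.
Proof. by rewrite /class_of /repr_ob -[RHS]reprK; case: (repr a). Qed.

Lemma repr_iso X : repr_ob (class_of X) ≅ X.
Proof. by apply/classP; rewrite repr_obK. Qed.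

Lemma classW (P : type -> Prop) : (forall X, P (class_of X)) -> forall a, P a.
Proof. by move=> h a; rewrite -(repr_obK a). Qed.

Definition add (a b : type) := class_of (repr_ob a ⊕ repr_ob b).
Definition mul (a b : type) := class_of (repr_ob a ⊗ repr_ob b).
Definition zero := class_of (zero_ob C).
Definition one := class_of 𝟙.

Lemma addE X Y : add (class_of X) (class_of Y) = class_of (X ⊕ Y).
Proof. by apply/classP/bip_iso; exact: repr_iso. Qed.

Lemma mulE X Y : mul (class_of X) (class_of Y) = class_of (X ⊗ Y).
Proof. by apply/classP/ten_iso; exact: repr_iso. Qed.

Lemma addA : associative add.
Proof.
elim/classW=> X; elim/classW=> Y; elim/classW=> Z.
rewrite (addE Y Z) (addE X Y) (addE X) (addE _ Z).
exact/classP/bipA.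
Qed.

Lemma addC : commutative add.
Proof.
by elim/classW=> X; elim/classW=> Y; rewrite (addE X) (addE Y); apply/classP/bipC.
Qed.

Lemma add0 : left_id zero add.
Proof. by elim/classW=> X; rewrite (addE _ X); apply/classP/bip0. Qed.

HB.instance Definition _ := GRing.isNmodule.Build type addA addC add0.

Lemma mulA : associative mul.
Proof.
elim/classW=> X; elim/classW=> Y; elim/classW=> Z.
rewrite (mulE Y Z) (mulE X Y) (mulE X) (mulE _ Z).
exact/classP/tenA.
Qed.

Lemma mulC : commutative mul.
Proof.
by elim/classW=> X; elim/classW=> Y; rewrite (mulE X) (mulE Y); apply/classP/tenC.
Qed.

Lemma mul1 : left_id one mul.
Proof. by elim/classW=> X; rewrite (mulE _ X); apply/classP/ten1. Qed.

Lemma mulDl : left_distributive mul add.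
Proof.
elim/classW=> X; elim/classW=> Y; elim/classW=> Z.
rewrite (addE X Y) (mulE X Z) (mulE Y Z) (mulE _ Z) (addE (X ⊗ Z)).
exact/classP/ten_bip.
Qed.

Lemma mul0 : left_zero zero mul.
Proof. by elim/classW=> X; rewrite (mulE _ X); apply/classP/ten0. Qed.

HB.instance Definition _ :=
  GRing.Nmodule_isComPzSemiRing.Build type mulA mulC mul1 mulDl mul0.

End IsoClass.
End IsoClass.
HB.export IsoClass.

Section Coherence.
Variables (K : fieldType) (C : tensorCategory K).
Implicit Types X Y Z W A B : C.

Lemma comp_pre X Y Z W (g : Hom Y Z) (f : Hom X Y) (h : Hom X Z) (x : Hom W X) :
  g ∘ f = h -> g ∘ (f ∘ x) = h ∘ x.
Proof. by move=> <-; rewrite compA. Qed.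

Lemma split_mono X Y Z (r : Hom Z Y) (m : Hom Y Z) (f g : Hom X Y) :
  r ∘ m = idm Y -> m ∘ f = m ∘ g -> f = g.
Proof. by move=> rm e; rewrite -[f]comp_idl -[g]comp_idl -rm -!compA e. Qed.

Lemma split_epi X Y Z (s : Hom X Z) (m : Hom Z X) (f g : Hom X Y) :
  m ∘ s = idm X -> f ∘ m = g ∘ m -> f = g.
Proof. by move=> rm e; rewrite -[f]comp_idr -[g]comp_idr -rm !compA e. Qed.

Lemma tenm_compl X Y Z W (f : Hom Y Z) (g : Hom X Y) :
  (f ∘ g) ⊠ idm W = (f ⊠ idm W) ∘ (g ⊠ idm W).
Proof. by rewrite -tenm_comp comp_idl. Qed.

Lemma tenm_compr X Y Z W (f : Hom Y Z) (g : Hom X Y) :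
  idm W ⊠ (f ∘ g) = (idm W ⊠ f) ∘ (idm W ⊠ g).
Proof. by rewrite -tenm_comp comp_idl. Qed.

Lemma tenm_swap X X' Y Y' (f : Hom X X') (g : Hom Y Y') :
  (f ⊠ idm Y') ∘ (idm X ⊠ g) = (idm X' ⊠ g) ∘ (f ⊠ idm Y).
Proof. by rewrite -!tenm_comp !comp_idl !comp_idr. Qed.

Lemma one_ten_inj X Y (f g : Hom X Y) : idm 𝟙 ⊠ f = idm 𝟙 ⊠ g -> f = g.
Proof.
by move=> e; apply: (split_epi (lunVK X)); rewrite -!lun_nat e.
Qed.

Lemma ten_one_inj X Y (f g : Hom X Y) : f ⊠ idm 𝟙 = g ⊠ idm 𝟙 -> f = g.
Proof.
by move=> e; apply: (split_epi (runVK X)); rewrite -!run_nat e.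
Qed.

Lemma lunV_nat X Y (f : Hom X Y) : (idm 𝟙 ⊠ f) ∘ lunV X = lunV Y ∘ f.
Proof.
apply: (split_mono (lunK Y)).
by rewrite (comp_pre _ (lun_nat f)) -compA lunVK (comp_pre _ (lunVK Y)) comp_idl comp_idr.
Qed.

Lemma runV_nat X Y (f : Hom X Y) : (f ⊠ idm 𝟙) ∘ runV X = runV Y ∘ f.
Proof.
apply: (split_mono (runK Y)).
by rewrite (comp_pre _ (run_nat f)) -compA runVK (comp_pre _ (runVK Y)) comp_idl comp_idr.
Qed.

Lemma lun_ten A B : lun (A ⊗ B) ∘ assoc 𝟙 A B = lun A ⊠ idm B.
Proof.
apply: one_ten_inj; rewrite tenm_compr.
have e1 : assocV 𝟙 𝟙 A ⊠ idm B ∘ (assoc 𝟙 𝟙 A ⊠ idm B) = idm _.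
  by rewrite -tenm_compl assocK tenm_id.
have e2 : assoc 𝟙 𝟙 A ⊠ idm B ∘ (assocV 𝟙 𝟙 A ⊠ idm B) = idm _.
  by rewrite -tenm_compl assocVK tenm_id.
apply: (split_epi (assocVK 𝟙 (𝟙 ⊗ A) B)); apply: (split_epi e2).
have := pentagon (𝟙 : C) 𝟙 A B.
move/(congr1 (comp (idm 𝟙 ⊠ lun (A ⊗ B)))); rewrite -!compA => <-.
rewrite (comp_pre _ (triangle _ _)) -tenm_id -assoc_nat -triangle tenm_compl.
by rewrite compA assoc_nat -!compA.
Qed.

Lemma run_ten A B : (idm A ⊠ run B) ∘ assoc A B 𝟙 = run (A ⊗ B).
Proof.
apply: ten_one_inj; rewrite tenm_compl.
apply: (split_mono (assocK A B 𝟙)).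
have := pentagon A B (𝟙 : C) 𝟙.
move/(congr1 (comp (idm A ⊠ (idm B ⊠ lun 𝟙)))); rewrite -!compA.
rewrite (comp_pre _ (esym (assoc_nat _ _ _))) -compA tenm_id triangle => ->.
rewrite compA assoc_nat -!compA; rewrite -triangle tenm_compr -!compA.
by [].
Qed.

Lemma lun_one : lun (𝟙 : C) = run 𝟙.
Proof.
apply: ten_one_inj; rewrite -triangle -lun_ten; congr (_ ∘ _).
by apply: (split_mono (lunK 𝟙)); rewrite lun_nat.
Qed.

Lemma lunV_one : lunV (𝟙 : C) = runV 𝟙.
Proof. by apply: (split_mono (lunK 𝟙)); rewrite {2}lun_one lunVK runVK. Qed.

Lemma run_braid A : lun A ∘ braid A 𝟙 = run A.
Proof.
apply: ten_one_inj.
have bK : braid 𝟙 A ∘ lunV A ∘ (lun A ∘ braid A 𝟙) = idm _.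
  by rewrite -!compA (comp_pre _ (lunK A)) comp_idl braidK.
apply: (split_mono bK).
have e := congr1 (fun h => lun A ∘ ((idm 𝟙 ⊠ lun A) ∘ h)) (hexagon A (𝟙 : C) 𝟙).
move: e; rewrite -!compA !(comp_pre _ (triangle _ _)) -lun_one.
rewrite (comp_pre _ (esym (braid_nat _ _))) -!compA triangle => ->.
rewrite (comp_pre _ (esym (tenm_compr _ _ _))).
rewrite (comp_pre _ (lun_nat _)) -!compA (comp_pre _ (lun_ten _ _)).
by rewrite tenm_compl.
Qed.

End Coherence.

Section Trace.
Variables (K : fieldType) (C : rigidTensorCategory K).
Implicit Types X Y A : C.

Definition trace X (f : Hom X X) : Hom (𝟙 : C) 𝟙 :=
  ev X ∘ braid X (dual X) ∘ (f ⊠ idm (dual X)) ∘ coev X.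

Definition curry X A (k : Hom (A ⊗ X) 𝟙) : Hom A (dual X) :=
  lun (dual X) ∘ ((k ⊠ idm (dual X)) ∘ (assocV A X (dual X)
    ∘ ((idm A ⊠ coev X) ∘ runV A))).

Lemma zigzag_r X :
  run X ∘ ((idm X ⊠ ev X) ∘ (assoc X (dual X) X ∘ ((coev X ⊠ idm X) ∘ lunV X)))
  = idm X.
Proof. by rewrite !compA zigzag. Qed.

Lemma tri_inv (A B : C) : assoc A 𝟙 B ∘ (runV A ⊠ idm B) = idm A ⊠ lunV B.
Proof.
have e : (idm A ⊠ lunV B) ∘ (idm A ⊠ lun B) = idm _.
  by rewrite -tenm_compr lunK tenm_id.
apply: (split_mono e); rewrite (comp_pre _ (triangle _ _)).
by rewrite -tenm_compl runVK tenm_id -tenm_compr lunVK tenm_id.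
Qed.

Lemma lunV_ten (A B : C) : assoc 𝟙 A B ∘ (lunV A ⊠ idm B) = lunV (A ⊗ B).
Proof.
apply: (split_mono (lunK _)); rewrite lunVK (comp_pre _ (lun_ten _ _)).
by rewrite -tenm_compl lunVK tenm_id.
Qed.

Lemma runV_ten (A B : C) : assoc A B 𝟙 ∘ runV (A ⊗ B) = idm A ⊠ runV B.
Proof.
have e : (idm A ⊠ runV B) ∘ (idm A ⊠ run B) = idm _.
  by rewrite -tenm_compr runK tenm_id.
apply: (split_mono e); rewrite (comp_pre _ (run_ten _ _)) runVK.
by rewrite -tenm_compr runVK tenm_id.
Qed.

Lemma ev_curry X A (k : Hom (A ⊗ X) 𝟙) : ev X ∘ (curry k ⊠ idm X) = k.
Proof.
rewrite /curry !tenm_compl -lun_ten.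
rewrite -!compA (comp_pre _ (esym (lun_nat (ev X)))) -!compA.
rewrite (comp_pre _ (assoc_nat _ _ _)) tenm_id -!compA.
rewrite (comp_pre _ (esym (tenm_swap k (ev X)))) -!compA.
rewrite lun_one (comp_pre _ (run_nat k)) -run_ten -!compA -tenm_id.
rewrite (comp_pre _ (assoc_nat _ _ _)) -!compA.
have p : assoc A X (dual X ⊗ X) ∘ (assoc (A ⊗ X) (dual X) X
     ∘ (assocV A X (dual X) ⊠ idm X))
   = (idm A ⊠ assoc X (dual X) X) ∘ assoc A (X ⊗ dual X) X.
  rewrite (comp_pre _ (pentagon _ _ _ _)) -!compA -tenm_compl assocVK.
  by rewrite tenm_id comp_idr.
move: p; rewrite compA => p.
rewrite [assoc A X _ ∘ _]compA (comp_pre _ p) -!compA.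
rewrite (comp_pre _ (assoc_nat _ _ _)) -!compA tri_inv.
by rewrite -!tenm_compr zigzag_r tenm_id comp_idr.
Qed.

Lemma coev_curry X Y (f : Hom X Y) :
  (idm Y ⊠ curry (ev Y ∘ (idm (dual Y) ⊠ f))) ∘ coev Y
  = (f ⊠ idm (dual X)) ∘ coev X.
Proof.
rewrite /curry !tenm_compr -!compA -runV_ten.
rewrite -!compA -runV_nat (comp_pre _ (esym (assoc_nat _ _ _))) tenm_id -!compA.
rewrite (comp_pre _ (esym (tenm_swap (coev Y) (coev X)))) -!compA.
rewrite -lunV_one lunV_nat -lunV_ten -!compA -tenm_id.
rewrite (comp_pre _ (esym (assoc_nat _ _ _))) -!compA.
have p : (idm Y ⊠ assocV (dual Y) X (dual X)) ∘ (assoc Y (dual Y) (X ⊗ dual X)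
     ∘ assoc (Y ⊗ dual Y) X (dual X))
   = assoc Y (dual Y ⊗ X) (dual X) ∘ (assoc Y (dual Y) X ⊠ idm (dual X)).
  rewrite pentagon -!compA (comp_pre _ (esym (tenm_compr _ _ _))) assocK.
  by rewrite tenm_id comp_idl.
move: p; rewrite compA => p.
rewrite [(idm Y ⊠ assocV _ _ _) ∘ _]compA (comp_pre _ p) -!compA.
rewrite (comp_pre _ (esym (assoc_nat _ _ _))) -!compA.
rewrite (comp_pre _ (triangle _ _)).
rewrite !compA -!tenm_compl; congr (_ ⊠ _ ∘ _).
rewrite tenm_compr -!compA (comp_pre _ (esym (assoc_nat _ _ _))) tenm_id -!compA.
rewrite (comp_pre _ (esym (tenm_swap (coev Y) f))) -!compA lunV_nat.
by rewrite -[RHS]comp_idl -[in RHS](zigzag_r Y) -!compA.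
Qed.

Lemma traceC X Y (f : Hom X Y) (g : Hom Y X) : trace (g ∘ f) = trace (f ∘ g).
Proof.
rewrite /trace !tenm_compl -!compA -(coev_curry f).
rewrite (comp_pre _ (tenm_swap g _)) -!compA.
rewrite (comp_pre _ (braid_nat _ _)) -!compA (comp_pre _ (ev_curry _)).
by rewrite -!compA (comp_pre _ (esym (braid_nat _ _))) -!compA.
Qed.

Lemma traceD X (f g : Hom X X) : trace (f + g) = trace f + trace g.
Proof. by rewrite /trace tenmDl compDr compDl. Qed.

Lemma trace_one : trace (idm 𝟙) = idm (𝟙 : C).
Proof.
set D := dual (𝟙 : C).
have b : braid 𝟙 D = runV D ∘ lun D.
  have e : runV D ∘ lun D ∘ braid D 𝟙 = idm _ by rewrite -compA run_braid runK.
  by rewrite -[LHS]comp_idl -e -!compA braidK comp_idr.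
rewrite /trace tenm_id comp_idr b -[RHS](zigzag_r (𝟙 : C)) -/D.
rewrite -{1}lun_one (comp_pre _ (lun_nat _)) -!compA.
rewrite (comp_pre _ (lun_ten _ _)) (comp_pre _ (esym (tenm_compl _ _ _))).
by rewrite lunV_one runV_nat.
Qed.

Lemma trace_bip W X Y : W ≅ X ⊕ Y ->
  trace (idm W) = trace (idm X) + trace (idm Y).
Proof.
move=> /bip_isoP [i1 [i2 [p1 [p2 [e1 e2 _ _ <-]]]]].
by rewrite traceD traceC e1 [X in _ + X]traceC e2.
Qed.

Lemma idm_one_neq0 : idm (𝟙 : C) != 0.
Proof.
apply/eqP => e; have [g gK _] := end_unit C.
have : (1 : K) = 0 by rewrite -[LHS]gK -[RHS]gK e !scaler0.
by move/eqP; rewrite oner_eq0.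
Qed.

End Trace.

Section GrothendieckRing.
Variables (K : fieldType) (C : rigidTensorCategory K).

Definition K0 : Type := Completion.type (IsoClass.type C).
HB.instance Definition _ := GRing.ComPzRing.on K0.

Definition K0_class (X : C) : K0 :=
  Completion.of_semi (IsoClass.class_of X).

Lemma K0_classP (X Y : C) :
  K0_class X = K0_class Y <-> exists Z : C, X ⊕ Z ≅ Y ⊕ Z.
Proof.
split.
  move=> /Completion.pi_inj [z] /=; rewrite !addr0.
  elim/IsoClass.classW: z => Z; rewrite /GRing.add /= (IsoClass.addE X Z).
  by rewrite (IsoClass.addE Y Z) => /IsoClass.classP; exists Z.
move=> [Z XY]; apply: (@Completion.pi_eq _ _ _ (IsoClass.class_of Z)) => /=.
rewrite !addr0 /GRing.add /= (IsoClass.addE X Z) (IsoClass.addE Y Z).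
exact/IsoClass.classP.
Qed.

Lemma K0_nonzero : (1 : K0) != 0.
Proof.
apply/eqP => e; have /K0_classP[Z h] : K0_class 𝟙 = K0_class (zero_ob C) by exact: e.
have /trace_bip := h.
have /trace_bip -> : 𝟙 ⊕ Z ≅ 𝟙 ⊕ Z by exact: iso_refl.
have -> : trace (idm (zero_ob C)) = 0.
  by rewrite (zero_obP C) /trace tenm0l comp0r comp0l.
by move=> /addIr /eqP; rewrite trace_one (negbTE (idm_one_neq0 C)).
Qed.

HB.instance Definition _ := GRing.PzSemiRing_isNonZero.Build K0 K0_nonzero.

Lemma K0_classD (X Y : C) : K0_class (X ⊕ Y) = K0_class X + K0_class Y.
Proof.
rewrite /K0_class /GRing.add /= Completion.addE; congr (\pi_(_) (Completion.Diff _ _)).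
  by rewrite /GRing.add /= IsoClass.addE.
by rewrite addr0.
Qed.

Lemma K0_classM (X Y : C) : K0_class (X ⊗ Y) = K0_class X * K0_class Y.
Proof.
rewrite /K0_class /GRing.mul /= Completion.mulE /Completion.muld /=.
rewrite !(mulr0, mul0r, addr0); congr (\pi_(_) (Completion.Diff _ _)).
by rewrite /GRing.mul /= IsoClass.mulE.
Qed.

Lemma K0_class1 : K0_class 𝟙 = 1.
Proof. by []. Qed.


End GrothendieckRing.

Section Zeta.
Variables (K : fieldType) (C : rigidTensorCategory K).
Implicit Types X L T D : C.

(* chi(X) = n, where chi(X) is the element tr(1_X) of End(𝟙) = K. *)
Definition euler_char X (n : int) : Prop :=
  trace (idm X) = n%:~R *: idm 𝟙.

Definition is_inverse L T : Prop := L ⊗ T ≅ 𝟙.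

(* D is a determinant of Mp ⊕ Mm, for Mp positive and Mm negative. *)
Definition is_det (Mp Mm D : C) : Prop :=
  exists (p q : nat) (L : C),
    [/\ euler_char Mp p%:Z, euler_char Mm (- q%:Z), is_inverse (Sym q Mm) L
      & D ≅ Alt p Mp ⊗ L].

(* The coefficients of the power series Z(X, T). *)
Definition zeta X (n : nat) : K0 C := K0_class (Sym n X).

(* Z is the zeta function of X as a rational function; there is at most one such
   Z, by ratexp_uniq. *)
Definition is_zeta X (Z : ratfun (K0 C)) : Prop := ratexp Z (zeta X).

End Zeta.

(* Main.v *)
Require Import Defs.
From mathcomp Require Import all_boot all_order all_algebra.
From HB Require Import structures.
From mathcomp Require Import all_fingroup zify ring.
(* The libraries above shadow Hom, idm and comp. *)
Import Defs.

Set Implicit Arguments.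
Unset Strict Implicit.
Unset Printing Implicit Defensive.

Import GRing.Theory.
Local Open Scope ring_scope.
Local Open Scope cat_scope.

(* Exterior and symmetric powers are treated together: P_n(X) denotes the
   exterior power if b = true and the symmetric power if b = false, and sgnb b
   is the sign by which a transposition acts on it.  The partial trace of the
   projector of rank n + 1 over one factor is a multiple, (chi + n sgnb b) /
   (n + 1), of the projector of rank n.  So if P_N(X) = 0 for some N, then
   chi(X) = - p sgnb b, where p + 1 is the least such N.  Moreover, as
   P_{p+1}(X) = 0, a Pluecker relation shows that exchanging i factors between
   P_i(X) and P_p(X) is a nonzero scalar on their tensor product; moving the
   i factors on the left to the dual side turns this scalar into a projector onto
   P_{p-i}(X), so that P_i(dual X) ⊗ P_p(X) ≅ P_{p-i}(X).

   In K_0, the Koszul relations and the formula for symmetric powers of a direct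
   sum give Z(M, T) = B(T) / A(T), where B(T) is the sum of the [S^j(M-)] T^j and
   A(T) that of the [Alt^i(M+)] (-T)^i.  By the above, up to invertible factors
   the coefficients of the polynomials of the dual of M are those of A and B in
   the opposite order, and the substitution of T^-1 reverses this order. *)

(** * Stacks *)

(** The isomorphism between P_i(dual X) ⊗ P_p(X) and P_{p-i}(X) comes from two maps in opposite
    directions: contraction of [i] factors of P_p(X) with the dual, and its mirror image. Their two
    composites are found independently. One is the partial trace of the projector of rank [p] over
    [i] factors; its scalar is a product of numbers (chi + n sgnb b) / (n + 1) with n < p, nonzero
    since chi = - p sgnb b and K has characteristic 0. The other is the exchange of [i] factors with
    its left block bent to the dual side. Its scalar comes from the vanishing of P_{p+1}: the
    identity and the transpositions of one factor on the left with each of the [p] factors on the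
    right, taken with signs, sum to 0 on the projectors, and this relates the exchanges of k and of
    k + 1 factors. Idempotents proportional to the two composites of a pair of maps have isomorphic
    images, so the two scalars are never compared in advance. The case i = p proves that the top
    power is invertible. *)

Notation "A ◁ f" := (idm A ⊠ f) (at level 37, right associativity) : cat_scope.

Section Linearity.
Variables (K : fieldType) (C : linearCategory K).
Implicit Types X Y Z : C.

Lemma compZl X Y Z a (g : Hom Y Z) (f : Hom X Y) : (a *: g) ∘ f = a *: (g ∘ f).
Proof.
have := @comp_linear_l K C X Y Z f a g 0.
by rewrite comp0l !addr0.
Qed.

Lemma compZr X Y Z a (g : Hom Y Z) (f : Hom X Y) : g ∘ (a *: f) = a *: (g ∘ f).
Proof.
have := @comp_linear_r K C X Y Z g a f 0.
by rewrite comp0r !addr0.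
Qed.

Lemma comp_suml X Y Z (I : Type) (r : seq I) (P : pred I) (F : I -> Hom Y Z)
    (f : Hom X Y) : (\sum_(i <- r | P i) F i) ∘ f = \sum_(i <- r | P i) F i ∘ f.
Proof. by apply: (big_morph (fun g => g ∘ f)) => [g g'|]; rewrite ?compDl ?comp0l. Qed.

Lemma comp_sumr X Y Z (I : Type) (r : seq I) (P : pred I) (F : I -> Hom X Y)
    (g : Hom Y Z) : g ∘ (\sum_(i <- r | P i) F i) = \sum_(i <- r | P i) g ∘ F i.
Proof. by apply: (big_morph (comp g)) => [f f'|]; rewrite ?compDr ?comp0r. Qed.

End Linearity.

(** Composites are kept nested to the right; the [comp_pre] lemmas rewrite a few consecutive factors
    of such a chain. *)
Lemma comp_pre3 (K : fieldType) (C : linearCategory K) (X Y Z W V : C)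
    (h : Hom Z W) (g : Hom Y Z) (f : Hom X Y) (k : Hom X W) (x : Hom V X) :
  h ∘ (g ∘ f) = k -> h ∘ (g ∘ (f ∘ x)) = k ∘ x.
Proof. by move=> <-; rewrite !compA. Qed.

(* A tensor product A ⊗ (B ⊗ Z) is read as a stack with top A; sw exchanges its
   two topmost objects.  Most constructions below act on the top of a stack,
   which keeps associators out of the computations. *)
HB.lock Definition sw (K : fieldType) (C : tensorCategory K) (A B Z : C) :
    Hom (A ⊗ (B ⊗ Z)) (B ⊗ (A ⊗ Z)) :=
  assoc B A Z ∘ (braid A B ⊠ idm Z) ∘ assocV A B Z.

Section Stack.
Variables (K : fieldType) (C : tensorCategory K).
Implicit Types A B X Y Z W : C.

Lemma tenmZl X X' Y Y' a (f : Hom X X') (g : Hom Y Y') :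
  ((a *: f) ⊠ g : Hom (X ⊗ Y) (X' ⊗ Y')) = a *: (f ⊠ g).
Proof.
by have := @tenm_linear_l K C X X' Y Y' g a f 0; rewrite tenm0l !addr0.
Qed.

Lemma tenm0r X X' Y Y' (f : Hom X X') :
  (f ⊠ 0 : Hom (X ⊗ Y) (X' ⊗ Y')) = 0.
Proof. exact: (linear_morph0 (@tenm_linear_r K C X X' Y Y' f)). Qed.

Lemma tenmZr X X' Y Y' a (f : Hom X X') (g : Hom Y Y') :
  (f ⊠ (a *: g) : Hom (X ⊗ Y) (X' ⊗ Y')) = a *: (f ⊠ g).
Proof.
by have := @tenm_linear_r K C X X' Y Y' f a g 0; rewrite tenm0r !addr0.
Qed.

Lemma tenmDr X X' Y Y' (f : Hom X X') (g g' : Hom Y Y') :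
  f ⊠ (g + g') = f ⊠ g + f ⊠ g'.
Proof. exact: (linear_morphD (@tenm_linear_r K C X X' Y Y' f) g g'). Qed.

Lemma tenm_suml X X' Y Y' (I : Type) (r : seq I) (P : pred I)
    (F : I -> Hom X X') (g : Hom Y Y') :
  (\sum_(i <- r | P i) F i) ⊠ g = \sum_(i <- r | P i) F i ⊠ g.
Proof. by apply: (big_morph (fun f => f ⊠ g)) => [f f'|]; rewrite ?tenmDl ?tenm0l. Qed.

Lemma tenm_sumr X X' Y Y' (I : Type) (r : seq I) (P : pred I)
    (F : I -> Hom Y Y') (f : Hom X X') :
  f ⊠ (\sum_(i <- r | P i) F i) = \sum_(i <- r | P i) f ⊠ F i.
Proof. by apply: (big_morph (fun g => f ⊠ g)) => [g g'|]; rewrite ?tenmDr ?tenm0r. Qed.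

Lemma comp_pre2 X Y Z W V (g : Hom Y Z) (f : Hom X Y) (k : Hom V Z) (l : Hom X V)
    (x : Hom W X) : g ∘ f = k ∘ l -> g ∘ (f ∘ x) = k ∘ (l ∘ x).
Proof. by move=> e; rewrite !compA e. Qed.

Lemma assocV_nat A A' B B' Z Z' (f : Hom A A') (g : Hom B B') (h : Hom Z Z') :
  assocV A' B' Z' ∘ (f ⊠ (g ⊠ h)) = ((f ⊠ g) ⊠ h) ∘ assocV A B Z.
Proof.
apply: (split_mono (assocK A' B' Z')).
by rewrite compA assocVK comp_idl compA assoc_nat -compA assocVK comp_idr.
Qed.

Lemma sw_nat A A' B B' Z Z' (f : Hom A A') (g : Hom B B') (h : Hom Z Z') :
  sw A' B' Z' ∘ (f ⊠ (g ⊠ h)) = (g ⊠ (f ⊠ h)) ∘ sw A B Z.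
Proof.
rewrite sw.unlock -!compA assocV_nat (comp_pre _ (esym (tenm_comp _ _ _ _))).
rewrite braid_nat comp_idl -[h in LHS]comp_idr tenm_comp -!compA.
by rewrite (comp_pre2 _ (assoc_nat _ _ _)).
Qed.

Lemma swK A B Z : sw B A Z ∘ sw A B Z = idm _.
Proof.
rewrite sw.unlock -!compA (comp_pre _ (assocK _ _ _)) comp_idl.
rewrite (comp_pre _ (esym (tenm_comp _ _ _ _))) braidK comp_idl tenm_id comp_idl.
exact: assocVK.
Qed.

Lemma pentagonV X Y Z W :
  assocV X Y Z ⊠ idm W ∘ (assocV X (Y ⊗ Z) W ∘ (X ◁ assocV Y Z W))
  = assocV (X ⊗ Y) Z W ∘ assocV X Y (Z ⊗ W).
Proof.
have e : assoc X Y (Z ⊗ W) ∘ assoc (X ⊗ Y) Z W ∘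
    (assocV (X ⊗ Y) Z W ∘ assocV X Y (Z ⊗ W)) = idm _.
  by rewrite -!compA (comp_pre _ (assocVK _ _ _)) comp_idl assocVK.
rewrite -[LHS]comp_idr -e pentagon -!compA.
rewrite (comp_pre _ (esym (tenm_compr _ _ _))) assocK tenm_id comp_idl.
rewrite (comp_pre _ (assocK _ _ _)) comp_idl.
by rewrite (comp_pre _ (esym (tenm_compl _ _ _))) assocK tenm_id comp_idl.
Qed.

(** The hexagon axiom read on stacks; the other steps carry associators through the pentagon. *)
Lemma sw_hexr A B D Z :
  assoc B D (A ⊗ Z) ∘ sw A (B ⊗ D) Z
  = (B ◁ sw A D Z) ∘ (sw A B (D ⊗ Z) ∘ (A ◁ assoc B D Z)).
Proof.
have hx : braid A (B ⊗ D) = assocV B D A ∘ ((B ◁ braid A D) ∘ (assoc B A D ∘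
    (braid A B ⊠ idm D ∘ assocV A B D))).
  have := congr1 (fun h => assocV B D A ∘ (h ∘ assocV A B D)) (hexagon A B D).
  by rewrite -!compA assocVK comp_idr (comp_pre _ (assocK _ _ _)) comp_idl.
rewrite {1}sw.unlock hx !tenm_compl -!compA.
have -> : assocV A B D ⊠ idm Z ∘ assocV A (B ⊗ D) Z =
    assocV (A ⊗ B) D Z ∘ (assocV A B (D ⊗ Z) ∘ (A ◁ assoc B D Z)).
  rewrite compA -pentagonV -!compA -tenm_compr assocK.
  by rewrite tenm_id comp_idr.
have e2 : assoc B D (A ⊗ Z) ∘ (assoc (B ⊗ D) A Z ∘ assocV B D A ⊠ idm Z)
    = (B ◁ assoc D A Z) ∘ assoc B (D ⊗ A) Z.
  rewrite compA pentagon -!compA -tenm_compl assocVK.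
  by rewrite tenm_id comp_idr.
rewrite [in LHS]compA (comp_pre _ (etrans (esym (compA _ _ _)) e2)) -!compA.
rewrite (comp_pre2 _ (assoc_nat _ _ _)).
rewrite sw.unlock !tenm_compr -!compA; congr (_ ∘ (_ ∘ _)).
have e3 : (B ◁ assocV A D Z) ∘ (assoc B A (D ⊗ Z) ∘ assoc (B ⊗ A) D Z)
    = assoc B (A ⊗ D) Z ∘ (assoc B A D ⊠ idm Z).
  rewrite pentagon -!compA (comp_pre _ (esym (tenm_compr _ _ _))).
  by rewrite assocK tenm_id comp_idl.
rewrite (comp_pre2 _ (esym e3)) -!compA; congr (_ ∘ (_ ∘ _)).
rewrite (comp_pre2 _ (assoc_nat _ _ _)) (comp_pre _ (assocVK _ _ _)).
by rewrite tenm_id comp_idl.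
Qed.

Lemma sw_hexl A B D Z :
  (D ◁ assoc A B Z) ∘ sw (A ⊗ B) D Z
  = sw A D (B ⊗ Z) ∘ ((A ◁ sw B D Z) ∘ assoc A B (D ⊗ Z)).
Proof.
apply: (split_epi (swK (A ⊗ B) D Z)).
rewrite -!compA swK comp_idr sw_hexr.
rewrite (comp_pre _ (esym (tenm_compr _ _ _))) swK tenm_id comp_idl.
by rewrite (comp_pre _ (swK _ _ _)) comp_idl.
Qed.

(** Yang-Baxter: by the hexagon both sides move [A] past the composite [B ⊗ D], and this is natural
    with respect to the braiding of [B] and [D]. *)
Lemma sw_yb A B D Z :
  (D ◁ sw A B Z) ∘ (sw A D (B ⊗ Z) ∘ (A ◁ sw B D Z))
  = sw B D (A ⊗ Z) ∘ ((B ◁ sw A D Z) ∘ sw A B (D ⊗ Z)).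
Proof.
have h B' D' : (B' ◁ sw A D' Z) ∘ sw A B' (D' ⊗ Z)
    = assoc B' D' (A ⊗ Z) ∘ (sw A (B' ⊗ D') Z ∘ (A ◁ assocV B' D' Z)).
  rewrite compA sw_hexr -!compA -tenm_compr assocVK tenm_id comp_idr.
  by [].
rewrite compA !h -!compA -tenm_compr {2}sw.unlock -!compA.
rewrite (comp_pre _ (assocK _ _ _)) comp_idl tenm_compr.
rewrite [in LHS](comp_pre2 _ (sw_nat _ _ _)) sw.unlock tenm_id -!compA.
by rewrite (comp_pre _ (assocK _ _ _)) comp_idl.
Qed.

Lemma sw_one A Z : lun (A ⊗ Z) ∘ sw A 𝟙 Z = A ◁ lun Z.
Proof.
rewrite sw.unlock -!compA (comp_pre _ (lun_ten _ _)).
rewrite (comp_pre _ (esym (tenm_compl _ _ _))) run_braid -triangle.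
by rewrite -compA assocVK comp_idr.
Qed.

Lemma sw_ten A B Z W :
  (B ◁ assoc A Z W) ∘ (assoc B (A ⊗ Z) W ∘ (sw A B Z ⊠ idm W))
  = sw A B (Z ⊗ W) ∘ ((A ◁ assoc B Z W) ∘ assoc A (B ⊗ Z) W).
Proof.
have p U V : (U ◁ assoc V Z W) ∘ (assoc U (V ⊗ Z) W ∘ (assoc U V Z ⊠ idm W))
    = assoc U V (Z ⊗ W) ∘ assoc (U ⊗ V) Z W by rewrite compA -pentagon.
rewrite sw.unlock !tenm_compl -!compA (comp_pre3 _ (p _ _)) -!compA.
rewrite (comp_pre2 _ (assoc_nat _ _ _)) tenm_id; congr (_ ∘ (_ ∘ _)).
apply: (split_mono (assocK A B (Z ⊗ W))).
rewrite (comp_pre _ (assocVK _ _ _)) comp_idl compA -p -!compA.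
by rewrite -tenm_compl assocVK tenm_id comp_idr.
Qed.
End Stack.

(** * Pairings and partial traces *)

Section Pairing.
Variables (K : fieldType) (C : tensorCategory K).
Implicit Types A B D X Y Z W : C.

Lemma whl A X Y Z (g : Hom Y Z) (f : Hom X Y) (k : Hom X Z) :
  g ∘ f = k -> (A ◁ g) ∘ (A ◁ f) = A ◁ k.
Proof. by move=> <-; rewrite tenm_compr. Qed.

Lemma wh2 A X Y Y' Z (g : Hom Y Z) (f : Hom X Y) (k : Hom Y' Z) (l : Hom X Y') :
  g ∘ f = k ∘ l -> (A ◁ g) ∘ (A ◁ f) = (A ◁ k) ∘ (A ◁ l).
Proof. by move=> e; rewrite -!tenm_compr e. Qed.

Lemma wh_id A X : A ◁ idm X = idm (A ⊗ X).
Proof. exact: tenm_id. Qed.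

Lemma wh_swap A B X Y (f : Hom A B) (g : Hom X Y) :
  (B ◁ g) ∘ (f ⊠ idm X) = (f ⊠ idm Y) ∘ (A ◁ g).
Proof. by rewrite -tenm_swap. Qed.

Lemma sw_wh A B Z Z' (h : Hom Z Z') :
  sw A B Z' ∘ (A ◁ B ◁ h) = (B ◁ A ◁ h) ∘ sw A B Z.
Proof. exact: sw_nat. Qed.

(* A duality between A and B, read on stacks: eps and eta act on the top of a
   tensor product B ⊗ (A ⊗ Z), naturally in Z and compatibly with the
   symmetry. *)
Record pairing A B := Pairing {
  eps : forall Z, Hom (B ⊗ (A ⊗ Z)) Z;
  eta : forall Z, Hom Z (B ⊗ (A ⊗ Z));
  eps_nat : forall Z Z' (f : Hom Z Z'), eps Z' ∘ (B ◁ A ◁ f) = f ∘ eps Z;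
  eta_nat : forall Z Z' (f : Hom Z Z'), (B ◁ A ◁ f) ∘ eta Z = eta Z' ∘ f;
  eps_pass : forall W Z,
    eps (W ⊗ Z) ∘ (B ◁ sw W A Z) = (W ◁ eps Z) ∘ sw B W (A ⊗ Z);
  eta_pass : forall W Z,
    (B ◁ sw A W Z) ∘ eta (W ⊗ Z) = sw W B (A ⊗ Z) ∘ (W ◁ eta Z);
  eps_eta : forall Z,
    (B ◁ eps Z) ∘ ((B ◁ sw A B Z) ∘ eta (B ⊗ Z)) = idm (B ⊗ Z)
}.

Section Theory.
Variables (A B : C) (p : pairing A B).

Definition ptr Y Y' (w : Hom (A ⊗ Y) (A ⊗ Y')) : Hom Y Y' :=
  eps p Y' ∘ ((B ◁ w) ∘ eta p Y).

(** The partial transpose of [w]: its strand [A] is reversed and becomes a strand [B]. *)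
Definition bend Y Y' (w : Hom (A ⊗ Y) (A ⊗ Y')) : Hom (B ⊗ Y) (B ⊗ Y') :=
  (B ◁ eps p Y') ∘ ((B ◁ B ◁ w) ∘ ((B ◁ sw A B Y) ∘ eta p (B ⊗ Y))).

(** Transposes are characterized through [eps] only, so that no dual morphism has to be
    constructed. *)
Definition transposed (e' : Hom B B) (e : Hom A A) : Prop :=
  forall Z, eps p Z ∘ (e' ⊠ idm _) = eps p Z ∘ (B ◁ (e ⊠ idm Z)).

Lemma bend_tenm Y Y' (e' : Hom B B) (e : Hom A A) (u : Hom Y Y') :
  transposed e' e -> bend (e ⊠ u) = e' ⊠ u.
Proof.
move=> ee'; rewrite /bend.
have -> : e ⊠ u = (A ◁ u) ∘ (e ⊠ idm Y) by rewrite -tenm_comp comp_idl comp_idr.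
rewrite !tenm_compr -?compA (comp_pre2 _ (wh2 _ (eps_nat p u))).
rewrite (comp_pre2 _ (wh2 _ (esym (ee' _)))).
rewrite -[idm (A ⊗ Y)]tenm_id (comp_pre2 _ (wh2 _ (esym (sw_nat _ _ _)))).
rewrite eta_nat.
rewrite !compA -!(compA (B ◁ u)) -(compA (B ◁ eps p Y)) eps_eta comp_idl.
by rewrite -tenm_swap -tenm_comp comp_idl comp_idr.
Qed.

(** Bending one strand of a crossing turns it into a cap followed by a cup. An exchange of factors
    thus becomes a composite through the smaller object [W]. *)
Lemma bend_sw W Y Y' (u : Hom (A ⊗ W) Y') (v : Hom Y (A ⊗ W)) :
  bend ((A ◁ u) ∘ (sw A A W ∘ (A ◁ v)))
  = (B ◁ u) ∘ (eta p W ∘ (eps p W ∘ (B ◁ v))).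
Proof.
rewrite /bend !tenm_compr -?compA (comp_pre2 _ (wh2 _ (eps_nat p u))).
rewrite -?compA; congr (_ ∘ _).
rewrite (comp_pre2 _ (wh2 _ (eps_pass p A W))).
rewrite (comp_pre2 _ (wh2 _ (esym (sw_wh _ _ _)))).
rewrite (comp_pre _ (whl _ (swK _ _ _))) wh_id comp_idl.
by rewrite eta_nat (comp_pre2 _ (eta_nat p _)).
Qed.

Lemma bendZ Y Y' a (w : Hom (A ⊗ Y) (A ⊗ Y')) : bend (a *: w) = a *: bend w.
Proof. by rewrite /bend !tenmZr compZl compZr. Qed.

Lemma ptrZ Y Y' a (w : Hom (A ⊗ Y) (A ⊗ Y')) : ptr (a *: w) = a *: ptr w.
Proof. by rewrite /ptr !tenmZr compZl compZr. Qed.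

Lemma ptrD Y Y' (w w' : Hom (A ⊗ Y) (A ⊗ Y')) : ptr (w + w') = ptr w + ptr w'.
Proof. by rewrite /ptr !tenmDr compDl compDr. Qed.

Lemma ptr_wh Y Y1 Y2 Y' (u : Hom Y2 Y') (w : Hom (A ⊗ Y1) (A ⊗ Y2)) (v : Hom Y Y1) :
  ptr ((A ◁ u) ∘ (w ∘ (A ◁ v))) = u ∘ (ptr w ∘ v).
Proof.
by rewrite /ptr !tenm_compr -?compA (comp_pre2 _ (eps_nat p u)) eta_nat.
Qed.

(* A loop can be pulled through a strand W. *)
Lemma ptr_pass W Y Y' (w : Hom (A ⊗ Y) (A ⊗ Y')) :
  eps p (W ⊗ Y') ∘ ((B ◁ (sw W A Y' ∘ ((W ◁ w) ∘ sw A W Y))) ∘ eta p (W ⊗ Y))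
  = W ◁ ptr w.
Proof.
rewrite /ptr !tenm_compr -?compA eta_pass.
rewrite (comp_pre2 _ (eps_pass p W Y')) (comp_pre2 _ (sw_wh _ _ _)).
by rewrite (comp_pre _ (swK _ _ _)) comp_idl.
Qed.

End Theory.

End Pairing.

(** * Tensor products of pairings *)

HB.lock Definition flat (K : fieldType) (C : tensorCategory K) (D B X A Z : C) :
    Hom ((D ⊗ B) ⊗ ((X ⊗ A) ⊗ Z)) (D ⊗ (B ⊗ (X ⊗ (A ⊗ Z)))) :=
  (D ◁ B ◁ assoc X A Z) ∘ assoc D B ((X ⊗ A) ⊗ Z).
HB.lock Definition flatV (K : fieldType) (C : tensorCategory K) (D B X A Z : C) :
    Hom (D ⊗ (B ⊗ (X ⊗ (A ⊗ Z)))) ((D ⊗ B) ⊗ ((X ⊗ A) ⊗ Z)) :=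
  assocV D B ((X ⊗ A) ⊗ Z) ∘ (D ◁ B ◁ assocV X A Z).
HB.lock Definition flat_eps (K : fieldType) (C : tensorCategory K) (X D A B : C)
    (p : pairing X D) (q : pairing A B) Z : Hom (D ⊗ (B ⊗ (X ⊗ (A ⊗ Z)))) Z :=
  eps q Z ∘ (eps p (B ⊗ (A ⊗ Z)) ∘ (D ◁ sw B X (A ⊗ Z))).
HB.lock Definition flat_eta (K : fieldType) (C : tensorCategory K) (X D A B : C)
    (p : pairing X D) (q : pairing A B) Z : Hom Z (D ⊗ (B ⊗ (X ⊗ (A ⊗ Z)))) :=
  (D ◁ sw X B (A ⊗ Z)) ∘ (eta p (B ⊗ (A ⊗ Z)) ∘ eta q Z).

Section Composite.
Variables (K : fieldType) (C : tensorCategory K).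
Implicit Types W Z : C.
Variables (X D A B : C) (p : pairing X D) (q : pairing A B).
Let fl := flat D B X A.
Let flV := flatV D B X A.
Let fe := flat_eps p q.
Let ft := flat_eta p q.

Lemma flatK Z : flV Z ∘ fl Z = idm _.
Proof.
rewrite /fl /flV flat.unlock flatV.unlock -?compA (comp_pre _ (whl _ (whl _ (assocK _ _ _)))) !wh_id.
by rewrite comp_idl assocK.
Qed.

Lemma flatVK Z : fl Z ∘ flV Z = idm _.
Proof.
rewrite /fl /flV flat.unlock flatV.unlock -?compA (comp_pre _ (assocVK _ _ _)) comp_idl.
by rewrite -!tenm_compr assocVK !wh_id.
Qed.

Lemma flat_nat Z Z' (f : Hom Z Z') :
  fl Z' ∘ ((D ⊗ B) ◁ (X ⊗ A) ◁ f) = (D ◁ B ◁ X ◁ A ◁ f) ∘ fl Z.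
Proof.
rewrite /fl flat.unlock -?compA -2!tenm_id assoc_nat (comp_pre _ (whl _ (whl _ (assoc_nat _ _ _)))).
by rewrite !tenm_compr -?compA.
Qed.

Lemma flat_eps_nat Z Z' (f : Hom Z Z') : fe Z' ∘ (D ◁ B ◁ X ◁ A ◁ f) = f ∘ fe Z.
Proof.
rewrite /fe flat_eps.unlock -?compA -tenm_compr sw_wh tenm_compr (comp_pre2 _ (eps_nat p _)).
by rewrite (comp_pre2 _ (eps_nat q _)).
Qed.

Lemma flat_eta_nat Z Z' (f : Hom Z Z') : (D ◁ B ◁ X ◁ A ◁ f) ∘ ft Z = ft Z' ∘ f.
Proof.
rewrite /ft flat_eta.unlock -?compA (comp_pre2 _ (wh2 _ (esym (sw_wh _ _ _)))).
by rewrite (comp_pre2 _ (eta_nat p _)) eta_nat.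
Qed.

Lemma flat_eps_pass W Z :
  fe (W ⊗ Z) ∘ (D ◁ B ◁ ((X ◁ sw W A Z) ∘ sw W X (A ⊗ Z)))
  = (W ◁ fe Z) ∘ (sw D W _ ∘ (D ◁ sw B W _)).
Proof.
rewrite /fe flat_eps.unlock !tenm_compr -?compA.
rewrite (comp_pre2 _ (wh2 _ (sw_wh _ _ _))) (comp_pre2 _ (eps_nat p _)).
rewrite (comp_pre2 _ (eps_pass q _ _)); congr (_ ∘ _).
rewrite (comp_pre2 _ (esym (eps_nat p _))).
have := congr1 (fun h => D ◁ h) (sw_yb B W X (A ⊗ Z)).
rewrite !tenm_compr => ->.
rewrite (comp_pre2 _ (eps_pass p _ _)); congr (_ ∘ _).
by rewrite (comp_pre2 _ (sw_wh _ _ _)).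
Qed.

Lemma flat_eta_pass W Z :
  (D ◁ B ◁ (sw X W (A ⊗ Z) ∘ (X ◁ sw A W Z))) ∘ ft (W ⊗ Z)
  = (D ◁ sw W B _) ∘ (sw W D _ ∘ (W ◁ ft Z)).
Proof.
rewrite /ft flat_eta.unlock !tenm_compr -?compA.
rewrite (comp_pre2 _ (wh2 _ (esym (sw_wh _ _ _)))) (comp_pre2 _ (eta_nat p _)).
rewrite eta_pass (comp_pre2 _ (esym (eta_nat p _))).
have e := congr1 (fun h => D ◁ h) (sw_yb X W B (A ⊗ Z)).
rewrite !tenm_compr in e; rewrite (comp_pre3 _ e) -?compA.
rewrite (comp_pre2 _ (eta_pass p _ _)); congr (_ ∘ _).
by rewrite (comp_pre2 _ (esym (sw_wh _ _ _))).
Qed.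

Lemma flatV_nat Z Z' (f : Hom Z Z') :
  ((D ⊗ B) ◁ (X ⊗ A) ◁ f) ∘ flV Z = flV Z' ∘ (D ◁ B ◁ X ◁ A ◁ f).
Proof.
apply: (split_mono (flatK Z')).
by rewrite (comp_pre2 _ (flat_nat f)) flatVK comp_idr (comp_pre _ (flatVK _)) comp_idl.
Qed.

(** The analogue of [fl] for a stack in which [W] sits between [D ⊗ B] and [X ⊗ A]. *)
Let fl' W Z : Hom ((D ⊗ B) ⊗ (W ⊗ ((X ⊗ A) ⊗ Z))) (D ⊗ (B ⊗ (W ⊗ (X ⊗ (A ⊗ Z))))) :=
  (D ◁ B ◁ W ◁ assoc X A Z) ∘ assoc D B (W ⊗ ((X ⊗ A) ⊗ Z)).

Let fl'_mono W Z Y (f g : Hom Y _) : fl' W Z ∘ f = fl' W Z ∘ g -> f = g.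
Proof.
apply: (@split_mono _ _ _ _ _ (assocV D B _ ∘ (D ◁ B ◁ W ◁ assocV X A Z))).
rewrite /fl' -?compA (comp_pre _ (whl _ (whl _ (whl _ (assocK _ _ _))))) !wh_id.
by rewrite comp_idl assocK.
Qed.

Let flat_swl W Z :
  (W ◁ fl Z) ∘ sw (D ⊗ B) W ((X ⊗ A) ⊗ Z)
  = sw D W _ ∘ ((D ◁ sw B W _) ∘ fl' W Z).
Proof.
rewrite /fl flat.unlock /fl' tenm_compr -?compA sw_hexl.
rewrite (comp_pre2 _ (esym (sw_wh _ _ _))).
by rewrite (comp_pre2 _ (wh2 _ (esym (sw_wh _ _ _)))).
Qed.

Let flat_swr W Z :
  fl (W ⊗ Z) ∘ ((D ⊗ B) ◁ sw W (X ⊗ A) Z)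
  = (D ◁ B ◁ ((X ◁ sw W A Z) ∘ sw W X (A ⊗ Z))) ∘ fl' W Z.
Proof.
rewrite /fl flat.unlock /fl' -?compA -tenm_id assoc_nat.
rewrite (comp_pre _ (whl _ (whl _ (sw_hexr _ _ _ _)))).
by rewrite !tenm_compr -?compA.
Qed.

Let flat_swlV W Z :
  fl' W Z ∘ sw W (D ⊗ B) ((X ⊗ A) ⊗ Z)
  = (D ◁ sw W B _) ∘ (sw W D _ ∘ (W ◁ fl Z)).
Proof.
apply: (split_epi (swK W (D ⊗ B) ((X ⊗ A) ⊗ Z))); rewrite -?compA.
rewrite flat_swl swK comp_idr (comp_pre _ (swK _ _ _)) comp_idl.
by rewrite (comp_pre _ (whl _ (swK _ _ _))) wh_id comp_idl.
Qed.

Let flat_swrV W Z :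
  fl' W Z ∘ ((D ⊗ B) ◁ sw (X ⊗ A) W Z)
  = (D ◁ B ◁ (sw X W (A ⊗ Z) ∘ (X ◁ sw A W Z))) ∘ fl (W ⊗ Z).
Proof.
have e U V : ((D ⊗ B) ◁ sw U V Z) ∘ ((D ⊗ B) ◁ sw V U Z) = idm _.
  by rewrite -tenm_compr swK wh_id.
apply: (split_epi (e W (X ⊗ A))); rewrite -?compA flat_swr e comp_idr.
rewrite !tenm_compr -?compA (comp_pre _ (whl _ (whl _ (whl _ (swK _ _ _))))).
by rewrite !wh_id comp_idl (comp_pre _ (whl _ (whl _ (swK _ _ _)))) !wh_id comp_idl.
Qed.

Let eps2 Z := fe Z ∘ fl Z.
Let eta2 Z := flV Z ∘ ft Z.

Let eps2_nat Z Z' (f : Hom Z Z') : eps2 Z' ∘ ((D ⊗ B) ◁ (X ⊗ A) ◁ f) = f ∘ eps2 Z.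
Proof. by rewrite /eps2 -?compA flat_nat (comp_pre2 _ (flat_eps_nat f)). Qed.

Let eta2_nat Z Z' (f : Hom Z Z') : ((D ⊗ B) ◁ (X ⊗ A) ◁ f) ∘ eta2 Z = eta2 Z' ∘ f.
Proof. by rewrite /eta2 -?compA -flat_eta_nat (comp_pre2 _ (flatV_nat f)). Qed.

Let eps2_pass W Z :
  eps2 (W ⊗ Z) ∘ ((D ⊗ B) ◁ sw W (X ⊗ A) Z)
  = (W ◁ eps2 Z) ∘ sw (D ⊗ B) W ((X ⊗ A) ⊗ Z).
Proof.
rewrite /eps2 tenm_compr -?compA flat_swr flat_swl.
by rewrite (comp_pre2 _ (flat_eps_pass W Z)) -?compA.
Qed.

Let eta2_pass W Z :
  ((D ⊗ B) ◁ sw (X ⊗ A) W Z) ∘ eta2 (W ⊗ Z)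
  = sw W (D ⊗ B) ((X ⊗ A) ⊗ Z) ∘ (W ◁ eta2 Z).
Proof.
apply: (@fl'_mono W Z); rewrite /eta2 tenm_compr.
rewrite (comp_pre2 _ (flat_swlV W Z)) (comp_pre2 _ (flat_swrV W Z)) -?compA.
rewrite (comp_pre _ (flatVK _)) comp_idl flat_eta_pass.
by rewrite (comp_pre _ (whl _ (flatVK _))) wh_id comp_idl.
Qed.

(** Once Yang-Baxter has rearranged the crossings, the zigzag identities of [p] and of [q] apply one
    after the other. *)
Let flat_zigzag Z :
  (D ◁ B ◁ (eps q Z ∘ (sw A B Z ∘ (eps p _ ∘ (sw X D _ ∘ (X ◁ sw A D (B ⊗ Z)))))))
    ∘ ft (D ⊗ (B ⊗ Z)) = idm _.
Proof.
rewrite /ft flat_eta.unlock !tenm_compr -?compA.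
rewrite (comp_pre2 _ (wh2 _ (esym (sw_wh _ _ _)))) (comp_pre2 _ (eta_nat p _)).
rewrite eta_pass (comp_pre2 _ (esym (eta_nat p _))).
have e := congr1 (fun h => D ◁ h) (sw_yb X D B (A ⊗ (B ⊗ Z))).
rewrite !tenm_compr in e; rewrite (comp_pre3 _ e) -?compA.
rewrite (comp_pre2 _ (wh2 _ (esym (eps_pass p _ _)))).
rewrite (comp_pre _ (whl _ (whl _ (swK _ _ _)))) !wh_id comp_idl.
rewrite (comp_pre3 _ (eps_eta p _)) comp_idl.
by rewrite -!tenm_compr eps_eta wh_id.
Qed.

Let eps2_eta2 Z :
  ((D ⊗ B) ◁ eps2 Z) ∘ (((D ⊗ B) ◁ sw (X ⊗ A) (D ⊗ B) Z) ∘ eta2 ((D ⊗ B) ⊗ Z))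
  = idm ((D ⊗ B) ⊗ Z).
Proof.
have aw Y Y' (g : Hom Y Y') : assoc D B Y' ∘ ((D ⊗ B) ◁ g) = (D ◁ B ◁ g) ∘ assoc D B Y.
  by rewrite -tenm_id assoc_nat.
apply: (split_mono (assocK D B Z)); rewrite comp_idr.
rewrite (comp_pre2 _ (aw _ _ _)) (comp_pre2 _ (aw _ _ _)).
have -> : assoc D B _ ∘ eta2 ((D ⊗ B) ⊗ Z) = (D ◁ B ◁ assocV X A _) ∘ ft ((D ⊗ B) ⊗ Z).
  by rewrite /eta2 /flV flatV.unlock -?compA (comp_pre _ (assocVK _ _ _)) comp_idl.
rewrite -[RHS]comp_idl -(flat_zigzag Z) -?compA -flat_eta_nat compA.
rewrite [RHS]compA -!tenm_compr -?compA.
rewrite (comp_pre _ (whl _ (whl _ (erefl _)))) -?compA.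
apply: (congr1 (fun h => (D ◁ B ◁ h) ∘ _)).
rewrite /eps2 /fe flat_eps.unlock /fl flat.unlock -?compA.
have e : (B ◁ assoc X A Z) ∘ sw (X ⊗ A) B Z
  = sw X B (A ⊗ Z) ∘ ((X ◁ sw A B Z) ∘ assoc X A (B ⊗ Z)) by exact: sw_hexl.
rewrite (comp_pre2 _ (sw_hexr _ _ _ _)) -?compA.
rewrite (comp_pre _ (whl _ e)) !tenm_compr -?compA (comp_pre2 _ (sw_hexl _ _ _ _)) -?compA.
rewrite (comp_pre _ (whl _ (swK _ _ _))) wh_id comp_idl.
have aw2 : assoc X A (D ⊗ (B ⊗ Z)) ∘ (((X ⊗ A) ◁ assoc D B Z) ∘ assocV X A ((D ⊗ B) ⊗ Z))
    = X ◁ A ◁ assoc D B Z.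
  by rewrite -tenm_id (comp_pre2 _ (assoc_nat _ _ _)) assocVK comp_idr.
rewrite aw2 (comp_pre2 _ (eps_nat p _)).
by rewrite -?compA.
Qed.

Definition pairing_ten : pairing (X ⊗ A) (D ⊗ B) :=
  Pairing eps2_nat eta2_nat eps2_pass eta2_pass eps2_eta2.

(** The loop of [p] crosses the strand [B] of the loop of [q]; [ptr_pass] pulls it off. *)
Lemma ptr_ten Y Y' (w : Hom ((X ⊗ A) ⊗ Y) ((X ⊗ A) ⊗ Y')) :
  ptr pairing_ten w = ptr q (ptr p (assoc X A Y' ∘ (w ∘ assocV X A Y))).
Proof.
rewrite {2}/ptr -(ptr_pass p) /ptr /= /eps2 /eta2 /fe flat_eps.unlock /ft flat_eta.unlock.
rewrite /fl flat.unlock /flV flatV.unlock.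
have aw Y1 Y2 (g : Hom Y1 Y2) : assoc D B Y2 ∘ ((D ⊗ B) ◁ g) = (D ◁ B ◁ g) ∘ assoc D B Y1.
  by rewrite -tenm_id assoc_nat.
rewrite -?compA (comp_pre2 _ (aw _ _ _)) (comp_pre _ (assocVK _ _ _)) comp_idl.
by rewrite !tenm_compr -?compA.
Qed.

Lemma flat_tenl (e' : Hom B B) Z :
  fl Z ∘ ((D ◁ e') ⊠ idm ((X ⊗ A) ⊗ Z)) = (D ◁ (e' ⊠ idm _)) ∘ fl Z.
Proof.
rewrite /fl flat.unlock -?compA assoc_nat !compA -!tenm_compr.
by rewrite wh_swap.
Qed.

Lemma flat_tenr (e : Hom A A) Z :
  fl Z ∘ ((D ⊗ B) ◁ ((X ◁ e) ⊠ idm Z)) = (D ◁ B ◁ X ◁ (e ⊠ idm Z)) ∘ fl Z.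
Proof.
rewrite /fl flat.unlock -?compA -[idm (D ⊗ B)]tenm_id assoc_nat !compA -!tenm_compr.
by rewrite assoc_nat.
Qed.

Lemma transposed_tenr (e' : Hom B B) (e : Hom A A) :
  transposed q e' e -> transposed pairing_ten (D ◁ e') (X ◁ e).
Proof.
move=> ee' Z; rewrite /= /eps2 -?compA flat_tenl flat_tenr !compA.
congr (_ ∘ _); rewrite /fe flat_eps.unlock -?compA -!tenm_compr sw_wh.
rewrite -[idm (X ⊗ _)]tenm_id sw_nat !tenm_compr.
by rewrite !(comp_pre2 _ (eps_nat p _)) (comp_pre2 _ (ee' _)) -?compA.
Qed.

(** A crossing of the two strands [D] slides through both caps, by [eps_pass], and comes out as a
    crossing of the two strands [X]. *)
Lemma eps_double Y :
  eps p Y ∘ (eps p _ ∘ ((D ◁ sw D X _) ∘ sw D D (X ⊗ (X ⊗ Y))))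
  = eps p Y ∘ (eps p _ ∘ ((D ◁ sw D X _) ∘ (D ◁ D ◁ sw X X Y))).
Proof.
rewrite (comp_pre2 _ (eps_pass p _ _)) swK comp_idr.
rewrite (comp_pre2 _ (eps_pass p _ _)) sw_wh.
rewrite (comp_pre2 _ (wh2 _ (eps_pass p _ _))).
rewrite (comp_pre2 _ (eps_nat p _)) (comp_pre2 _ (eps_pass p _ _)).
by rewrite swK comp_idr.
Qed.
End Composite.

HB.lock Definition flat3 (K : fieldType) (C : tensorCategory K) (D B X A Z : C) :
    Hom ((D ⊗ (D ⊗ B)) ⊗ ((X ⊗ (X ⊗ A)) ⊗ Z))
    (D ⊗ (D ⊗ (B ⊗ (X ⊗ (X ⊗ (A ⊗ Z)))))) :=
  (D ◁ D ◁ B ◁ X ◁ assoc X A Z) ∘ ((D ◁ assoc D B _) ∘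
    ((D ◁ (D ⊗ B) ◁ assoc X (X ⊗ A) Z) ∘ assoc D (D ⊗ B) _)).

Section Transposition.
Variables (K : fieldType) (C : tensorCategory K).
Variables (X D A B : C) (p : pairing X D) (q : pairing A B).
Let fl3 := flat3 D B X A.

Let eps3E Z : eps (pairing_ten p (pairing_ten p q)) Z
  = eps q Z ∘ (eps p _ ∘ (eps p _ ∘ ((D ◁ sw D X _) ∘
     ((D ◁ D ◁ ((X ◁ sw B X _) ∘ sw B X _)) ∘ fl3 Z)))).
Proof.
rewrite /fl3 flat3.unlock /= flat_eps.unlock flat.unlock /= flat_eps.unlock -?compA.
rewrite [in RHS]tenm_compr [in RHS]tenm_compr -?compA.
rewrite [in RHS](comp_pre2 _ (wh2 _ (sw_wh _ _ _))) [in RHS](comp_pre2 _ (eps_nat p _)).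
do 3!apply: (congr1 (comp _)).
rewrite flat.unlock -?compA.
rewrite (comp_pre2 _ (esym (eps_nat p _))) (comp_pre2 _ (esym (eps_nat p _))).
apply: (congr1 (comp _)).
rewrite (comp_pre2 _ (wh2 _ (sw_hexl _ _ _ _))) tenm_compr -?compA.
rewrite (comp_pre2 _ (wh2 _ (esym (sw_wh _ _ _)))); congr (_ ∘ _).
by rewrite -?compA (comp_pre2 _ (wh2 _ (wh2 _ (esym (sw_wh _ _ _))))).
Qed.

(** Yang-Baxter moves the strand [B] past the crossing of the two [X]; what remains is
    [eps_double]. *)
Lemma transposed_sw :
  transposed (pairing_ten p (pairing_ten p q)) (sw D D B) (sw X X A).
Proof.
move=> Z; rewrite eps3E -?compA.
have -> : fl3 Z ∘ (sw D D B ⊠ idm _) = sw D D _ ∘ fl3 Z.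
  rewrite /fl3 flat3.unlock -?compA.
  have n1 U V (g : Hom U V) :
      assoc D (D ⊗ B) V ∘ ((D ⊗ (D ⊗ B)) ◁ g) = (D ◁ (D ⊗ B) ◁ g) ∘ assoc D (D ⊗ B) U.
    by rewrite -tenm_id assoc_nat.
  rewrite -(n1 _ _ (assoc X (X ⊗ A) Z)) (comp_pre2 _ (esym (n1 _ _ _))) wh_swap.
  by rewrite (comp_pre3 _ (sw_ten D D B _)) -?compA (comp_pre2 _ (esym (sw_wh _ _ _))).
have -> : fl3 Z ∘ (_ ◁ (sw X X A ⊠ idm _)) = (D ◁ D ◁ B ◁ sw X X _) ∘ fl3 Z.
  have n2 U V (g : Hom U V) : (D ◁ assoc D B V) ∘ (D ◁ (D ⊗ B) ◁ g)
      = (D ◁ D ◁ B ◁ g) ∘ (D ◁ assoc D B U).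
    by rewrite -!tenm_compr -[idm (D ⊗ B)]tenm_id assoc_nat.
  have e := congr1 (fun h => D ◁ D ◁ B ◁ h) (sw_ten X X A Z).
  rewrite !tenm_compr -?compA in e.
  rewrite /fl3 flat3.unlock -?compA -[idm (D ⊗ (D ⊗ B))]tenm_id assoc_nat.
  by rewrite !(comp_pre2 _ (n2 _ _ _)) (comp_pre3 _ e) -?compA.
rewrite (comp_pre2 _ (esym (sw_wh _ _ _))).
have yb := congr1 (fun h => D ◁ D ◁ h) (sw_yb B X X (A ⊗ Z)).
have e := eps_double p (B ⊗ (A ⊗ Z)); rewrite ?compA in e.
rewrite !tenm_compr -?compA; rewrite !tenm_compr -?compA in yb.
by rewrite (comp_pre3 _ yb) -?compA; apply: (congr1 (comp _)); rewrite ?compA e.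
Qed.

End Transposition.

(** * The pairing of the unit object with itself *)

Section UnitPairing.
Variables (K : fieldType) (C : tensorCategory K).
Implicit Types W Z : C.

Lemma sw_oneV W Z : (W ◁ lun Z) ∘ sw 𝟙 W Z = lun (W ⊗ Z).
Proof. by rewrite -sw_one -compA swK comp_idr. Qed.

Lemma sw_lunV W Z : sw 𝟙 W Z ∘ lunV (W ⊗ Z) = W ◁ lunV Z.
Proof.
apply: (@split_mono _ _ _ _ _ (W ◁ lunV Z) (W ◁ lun Z)).
  by rewrite -tenm_compr lunK wh_id.
by rewrite compA sw_oneV lunVK -tenm_compr lunVK wh_id.
Qed.

Lemma sw_runV W Z : sw W 𝟙 Z ∘ (W ◁ lunV Z) = lunV (W ⊗ Z).
Proof. by rewrite -sw_lunV compA swK comp_idl. Qed.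

Let eps1 Z := lun Z ∘ lun (𝟙 ⊗ Z).
Let eta1 Z := lunV (𝟙 ⊗ Z) ∘ lunV Z.

Let eps1_nat Z Z' (f : Hom Z Z') : eps1 Z' ∘ (𝟙 ◁ 𝟙 ◁ f) = f ∘ eps1 Z.
Proof. by rewrite /eps1 -?compA lun_nat (comp_pre2 _ (lun_nat _)). Qed.

Let eta1_nat Z Z' (f : Hom Z Z') : (𝟙 ◁ 𝟙 ◁ f) ∘ eta1 Z = eta1 Z' ∘ f.
Proof. by rewrite /eta1 (comp_pre2 _ (lunV_nat _)) lunV_nat -?compA. Qed.

Let eps1_pass W Z : eps1 (W ⊗ Z) ∘ (𝟙 ◁ sw W 𝟙 Z) = (W ◁ eps1 Z) ∘ sw 𝟙 W (𝟙 ⊗ Z).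
Proof.
by rewrite /eps1 -?compA lun_nat tenm_compr (comp_pre _ (sw_one _ _)) -compA sw_oneV.
Qed.

Let eta1_pass W Z : (𝟙 ◁ sw 𝟙 W Z) ∘ eta1 (W ⊗ Z) = sw W 𝟙 (𝟙 ⊗ Z) ∘ (W ◁ eta1 Z).
Proof.
by rewrite /eta1 (comp_pre2 _ (lunV_nat _)) sw_lunV tenm_compr (comp_pre _ (sw_runV _ _)).
Qed.

Let eps1_eta1 Z :
  (𝟙 ◁ eps1 Z) ∘ ((𝟙 ◁ sw 𝟙 𝟙 Z) ∘ eta1 (𝟙 ⊗ Z)) = idm (𝟙 ⊗ Z).
Proof.
rewrite /eta1 (comp_pre2 _ (lunV_nat _)) (comp_pre2 _ (lunV_nat _)) sw_lunV /eps1.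
by rewrite -?compA lun_nat (comp_pre _ (lunVK _)) comp_idl lunK.
Qed.

Definition pairing_one : pairing (𝟙 : C) 𝟙 :=
  Pairing eps1_nat eta1_nat eps1_pass eta1_pass eps1_eta1.

Lemma ptr_one Y Y' (w : Hom (𝟙 ⊗ Y) (𝟙 ⊗ Y')) :
  ptr pairing_one w = lun Y' ∘ (w ∘ lunV Y).
Proof.
rewrite /ptr /= /eps1 /eta1 -?compA (comp_pre2 _ (lun_nat _)).
by rewrite (comp_pre _ (lunVK _)) comp_idl.
Qed.

End UnitPairing.

(** * The pairing of an object with its dual *)

HB.lock Definition eps_dual (K : fieldType) (C : rigidTensorCategory K) (X Z : C) :
    Hom (dual X ⊗ (X ⊗ Z)) Z :=
  lun Z ∘ ((ev X ⊠ idm Z) ∘ assocV (dual X) X Z).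
HB.lock Definition coev_st (K : fieldType) (C : rigidTensorCategory K) (X Z : C) :
    Hom Z (X ⊗ (dual X ⊗ Z)) :=
  assoc X (dual X) Z ∘ ((coev X ⊠ idm Z) ∘ lunV Z).
HB.lock Definition eta_dual (K : fieldType) (C : rigidTensorCategory K) (X Z : C) :
    Hom Z (dual X ⊗ (X ⊗ Z)) :=
  sw X (dual X) Z ∘ coev_st X Z.

Section DualPairing.
Variables (K : fieldType) (C : rigidTensorCategory K) (X : C).
Implicit Types W Z : C.
Let D := dual X.
Let ed := eps_dual X.
Let cd := coev_st X.
Let td := eta_dual X.

Let ed_nat Z Z' (f : Hom Z Z') : ed Z' ∘ (D ◁ X ◁ f) = f ∘ ed Z.
Proof.
rewrite /ed eps_dual.unlock -?compA assocV_nat tenm_id.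
by rewrite (comp_pre2 _ (esym (wh_swap _ _))) (comp_pre2 _ (lun_nat _)).
Qed.

Let cd_nat Z Z' (f : Hom Z Z') : (X ◁ D ◁ f) ∘ cd Z = cd Z' ∘ f.
Proof.
rewrite /cd coev_st.unlock -?compA -lunV_nat (comp_pre2 _ (esym (wh_swap _ _))).
by rewrite -[idm (X ⊗ dual X)]tenm_id (comp_pre2 _ (assoc_nat _ _ _)).
Qed.

Let td_nat Z Z' (f : Hom Z Z') : (D ◁ X ◁ f) ∘ td Z = td Z' ∘ f.
Proof.
by rewrite /td eta_dual.unlock -?compA -cd_nat (comp_pre2 _ (sw_wh _ _ _)).
Qed.

Let ed_pass W Z : ed (W ⊗ Z) ∘ (D ◁ sw W X Z) = (W ◁ ed Z) ∘ sw D W (X ⊗ Z).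
Proof.
rewrite /ed eps_dual.unlock -?compA.
have e : (W ◁ assocV D X Z) ∘ sw D W (X ⊗ Z)
   = sw (D ⊗ X) W Z ∘ (assocV D X (W ⊗ Z) ∘ (D ◁ sw W X Z)).
  apply: (@split_mono _ _ _ _ _ (W ◁ assocV D X Z) (W ◁ assoc D X Z)).
    by rewrite -tenm_compr assocK wh_id.
  rewrite (comp_pre _ (sw_hexl _ _ _ _)) -?compA (comp_pre _ (assocVK _ _ _)).
  rewrite comp_idl -tenm_compr swK wh_id comp_idr.
  by rewrite compA -tenm_compr assocVK wh_id comp_idl.
rewrite !tenm_compr -?compA e (comp_pre2 _ (esym (sw_nat _ _ _))) wh_id.
by rewrite (comp_pre _ (sw_oneV _ _)).
Qed.

Let cd_pass W Z : (X ◁ sw W D Z) ∘ (sw W X (D ⊗ Z) ∘ (W ◁ cd Z)) = cd (W ⊗ Z).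
Proof.
rewrite /cd coev_st.unlock !tenm_compr -?compA.
rewrite (comp_pre3 _ (esym (sw_hexr _ _ _ _))) -?compA.
by rewrite (comp_pre2 _ (sw_nat _ _ _)) -?compA sw_runV wh_id.
Qed.

Let td_pass W Z : (D ◁ sw X W Z) ∘ td (W ⊗ Z) = sw W D (X ⊗ Z) ∘ (W ◁ td Z).
Proof.
rewrite /td eta_dual.unlock -[coev_st X (W ⊗ Z)]cd_pass tenm_compr.
rewrite (comp_pre3 _ (sw_yb X W D Z)) -?compA.
by rewrite (comp_pre _ (swK _ _ _)) comp_idl.
Qed.

Let ed_cd Z : ed (D ⊗ Z) ∘ (D ◁ cd Z) = idm (D ⊗ Z).
Proof.
rewrite /ed /cd eps_dual.unlock coev_st.unlock !tenm_compr -?compA.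
have e : assocV D X (D ⊗ Z) ∘ (D ◁ assoc X D Z)
    = assoc (D ⊗ X) D Z ∘ ((assocV D X D ⊠ idm Z) ∘ assocV D (X ⊗ D) Z).
  apply: (split_mono (assocVK (D ⊗ X) D Z)).
  rewrite (comp_pre _ (assocK _ _ _)) comp_idl compA -pentagonV -?compA.
  by rewrite -tenm_compr assocK wh_id comp_idr.
rewrite (comp_pre _ e) -?compA (comp_pre2 _ (assocV_nat _ _ _)).
have e2 : assocV D 𝟙 Z ∘ (D ◁ lunV Z) = runV D ⊠ idm Z.
  by rewrite -(tri_inv D Z) compA assocK comp_idl.
rewrite e2 -[idm (D ⊗ Z)]tenm_id (comp_pre2 _ (esym (assoc_nat _ _ _))).
rewrite (comp_pre _ (lun_ten _ _)) -!tenm_compl.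
by have := zagzig X; rewrite -?compA => ->.
Qed.

Let td_zigzag Z : (D ◁ ed Z) ∘ ((D ◁ sw X D Z) ∘ td (D ⊗ Z)) = idm (D ⊗ Z).
Proof.
rewrite td_pass (comp_pre2 _ (esym (ed_pass _ _))) -tenm_compr.
rewrite /td eta_dual.unlock (comp_pre _ (swK _ _ _)) comp_idl.
exact: ed_cd.
Qed.

Definition pairing_dual : pairing X D :=
  Pairing ed_nat td_nat ed_pass td_pass td_zigzag.

Let cd_ed Z : (X ◁ ed Z) ∘ cd (X ⊗ Z) = idm (X ⊗ Z).
Proof.
rewrite /ed /cd eps_dual.unlock coev_st.unlock !tenm_compr -?compA.
rewrite -lunV_ten -[idm (X ⊗ Z)]tenm_id (comp_pre2 _ (esym (assoc_nat _ _ _))).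
have e : (X ◁ assocV D X Z) ∘ (assoc X D (X ⊗ Z) ∘ assoc (X ⊗ D) X Z)
    = assoc X (D ⊗ X) Z ∘ (assoc X D X ⊠ idm Z).
  by rewrite pentagon -?compA (comp_pre _ (whl _ (assocK _ _ _))) wh_id comp_idl.
rewrite (comp_pre3 _ e) -?compA (comp_pre2 _ (esym (assoc_nat _ _ _))).
rewrite (comp_pre _ (triangle _ _)) -!tenm_compl.
by rewrite zigzag_r.
Qed.

(** Closing one strand of a crossing leaves a single strand with a kink, which a zigzag identity
    straightens. *)
Lemma ptr_dual_sw Z : ptr pairing_dual (sw X X Z) = idm (X ⊗ Z).
Proof.
rewrite /ptr /= -[RHS]cd_ed /td eta_dual.unlock.
rewrite (comp_pre2 _ (ed_pass X Z)).
by rewrite (comp_pre _ (swK _ _ _)) comp_idl.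
Qed.

Lemma ptr_dual_id Z (chi : K) :
  trace (idm X) = chi *: idm 𝟙 -> ptr pairing_dual (idm (X ⊗ Z)) = chi *: idm Z.
Proof.
rewrite /trace tenm_id comp_idr => e.
rewrite /ptr /= wh_id comp_idl /ed /td eps_dual.unlock eta_dual.unlock.
rewrite sw.unlock coev_st.unlock -?compA.
rewrite !(comp_pre _ (assocK _ _ _)) !comp_idl.
rewrite (comp_pre _ (esym (tenm_compl _ _ _))) (comp_pre _ (esym (tenm_compl _ _ _))).
by rewrite compA e tenmZl tenm_id !(compZl, compZr) ?comp_idl ?comp_idr lunVK.
Qed.

End DualPairing.

(** * The action of the symmetric group *)

Section AdjacentInduction.
Variable n : nat.
Implicit Types (a b : 'I_n) (s t : 'S_n) (P : 'S_n -> Prop).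

(* A submonoid containing tperm a b whenever a and b are adjacent in an
   interval contains it for all a, b in this interval. *)
Lemma tperm_adj_ind (Q : 'S_n -> Prop) (J : pred nat) :
  Q 1%g -> (forall s t, Q s -> Q t -> Q (s * t)%g) ->
  (forall a b, b = a.+1 :> nat -> J a -> Q (tperm a b)) ->
  forall a b, (forall k : nat, a <= k < b -> J k)%N -> (a <= b)%N -> Q (tperm a b).
Proof.
move=> Q1 QM Qadj a b; move: {2}(b - a)%N (erefl (b - a)%N) => d.
elim: d b => [|d IH] b db ab Jab.
  suff -> : b = a by rewrite tperm1.
  by apply/val_inj => /=; lia.
have hb : (b.-1 < n)%N by have := ltn_ord b; lia.
pose c := Ordinal hb.
have cb : b = c.+1 :> nat by rewrite /=; lia.
have Qcb : Q (tperm c b) by apply: Qadj => //; apply: ab => /=; lia.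
have [ac|ac] := eqVneq (a : nat) c.
  by suff -> : a = c by []; exact: val_inj.
have -> : tperm a b = (tperm c b * tperm a c * tperm c b)%g.
  have := tpermJ a c (tperm c b); rewrite /conjg tpermV mulgA tpermL.
  rewrite tpermD // -val_eqE /=; first by rewrite eq_sym.
  by apply/eqP; lia.
do 2!apply: (QM) => //.
by apply: IH => /=; [lia| move=> k hk; apply: ab; lia | lia].
Qed.

(** Reduces identities on [perm_act] to the adjacent transpositions, where the action is [tr]. *)
Lemma perm_adj_ind P :
  P 1%g -> (forall s a b, b = a.+1 :> nat -> P s -> P (s * tperm a b)%g) ->
  forall s, P s.
Proof.
move=> P1 PM.
pose Q t := forall s, P s -> P (s * t)%g.
have QT a b : Q (tperm a b).
  wlog ab : a b / (a <= b)%N.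
    by case: (leqP a b) => [|/ltnW] h H; [exact: H | rewrite tpermC; exact: H].
  apply: (@tperm_adj_ind Q xpredT) => //.
  - by move=> s; rewrite mulg1.
  - by move=> s t Qs Qt u Pu; rewrite mulgA; apply: Qt; apply: Qs.
  - by move=> c d cd _ s; apply: PM.
move=> s; have [ts -> _] := prod_tpermP s.
elim: ts {s} => [|t ts IH] ; first by rewrite big_nil.
suff H : forall s, P s -> P (s * \prod_(t <- ts) tperm t.1 t.2)%g.
  by rewrite big_cons; apply: H; rewrite -[tperm _ _]mul1g; apply: QT.
elim: ts {IH} => [|u ts IH] s Ps; first by rewrite big_nil mulg1.
by rewrite big_cons mulgA; apply: IH; apply: QT.
Qed.

End AdjacentInduction.

Section PermAct.
Variables (K : fieldType) (C : tensorCategory K) (X : C).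
Local Notation T := (tpow X).
Local Notation ins := (insert_factor X).

(* Exchanges the factors j and j + 1, counted from 0; the identity if there are
   no such factors. *)
Fixpoint tr (n j : nat) : Hom (T n) (T n) :=
  match n, j with
  | n'.+2, 0 => sw X X (T n')
  | n'.+1, j'.+1 => X ◁ tr n' j'
  | _, _ => idm _
  end.

Lemma trS n j : tr n.+1 j.+1 = X ◁ tr n j.
Proof. by case: n => //= ; rewrite wh_id. Qed.

Lemma trK n j : tr n j ∘ tr n j = idm _.
Proof.
elim: n j => [|[|n] IH] [|j] /=; rewrite ?comp_idl ?swK //.
  by rewrite -tenm_compr IH wh_id.
by rewrite -tenm_compr IH wh_id.
Qed.

Lemma ins0 n : ins n 0 = idm _.
Proof. by case: n. Qed.

Lemma insS n i : ins n.+1 i.+1 = (X ◁ ins n i) ∘ sw X X (T n).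
Proof. by rewrite /= /swap12 sw.unlock. Qed.

Lemma tr_ins n i : (i < n)%N -> tr n.+1 i ∘ ins n i = ins n i.+1.
Proof.
elim: n i => // n IH [|i] hi.
  by rewrite insS !ins0 wh_id comp_idl comp_idr.
by rewrite trS !insS (comp_pre _ (whl _ (IH _ _))).
Qed.

Lemma tr_insS n i : (i < n)%N -> tr n.+1 i ∘ ins n i.+1 = ins n i.
Proof. by move=> hi; rewrite -tr_ins // compA trK comp_idl. Qed.

(** The inserted factor jumps over the factors exchanged by [tr], which had positions [j + 1] and
    [j + 2] before the insertion. The case [j = 0] is Yang-Baxter. *)
Lemma tr_ins_gt n i j : (j.+1 < i <= n)%N ->
  tr n.+1 j ∘ ins n i = ins n i ∘ (X ◁ tr n j).
Proof.
elim: n i j => [|n IH] [|i] j hij; try by exfalso; lia.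
case: j hij => [|j] hij.
  case: n i hij {IH} => [|n] [|i] hij; try by exfalso; lia.
  rewrite [tr n.+3 0]/= [tr n.+2 0]/= !insS !tenm_compr -?compA.
  rewrite (comp_pre2 _ (sw_wh _ _ _)); congr (_ ∘ _).
  by rewrite -sw_yb.
rewrite !trS insS (comp_pre _ (whl _ (IH _ _ _))) //.
by rewrite tenm_compr -?compA sw_wh.
Qed.

Lemma tr_ins_lt n i j : (i < j)%N -> tr n.+1 j ∘ ins n i = ins n i ∘ (X ◁ tr n j.-1).
Proof.
elim: n i j => [|n IH] [|i] [|j] // hij; rewrite ?ins0 ?comp_idl ?comp_idr ?trS //.
rewrite insS (comp_pre _ (whl _ (IH _ _ _))) //.
by case: j hij => // j _; rewrite trS tenm_compr -?compA sw_wh.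
Qed.

Lemma lift_tperm n (a b : 'I_n.+1) (x : 'I_n) :
  b = a.+1 :> nat -> tperm a b (lift a x) = lift b x.
Proof.
move=> ab; apply/val_inj; case: tpermP => [/eqP|/(congr1 val)|_ e] /=.
- by rewrite eq_sym (negbTE (neq_lift _ _)).
- by rewrite /= /bump; lia.
- by move/eqP: e; rewrite -val_eqE /= /bump; lia.
Qed.

(** If [s ord0] is [a] or [b], the transposition only changes the position of the insertion and
    leaves the tail of [s] alone; otherwise it acts as an adjacent transposition on the tail. *)
Lemma perm_act_tr n (s : 'S_n) (a b : 'I_n) : b = a.+1 :> nat ->
  tr n a ∘ perm_act X s = perm_act X (s * tperm a b)%g.
Proof.
elim: n s a b => [|n IH] s a b ab; first by case: a ab.
rewrite /= permM.
have tailE (u : 'S_n.+1) (v : 'S_n) :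
    (forall k, u (lift ord0 k) = lift (u ord0) (v k)) -> perm_tail u = v.
  move=> uv; apply/permP => k; rewrite permE; apply: (@lift_inj _ (u ord0)).
  by rewrite perm_tail_funE.
have sE k : s (lift ord0 k) = lift (s ord0) (perm_tail s k).
  by rewrite -perm_tail_funE permE.
have [ea|na] := eqVneq (s ord0) a.
  have -> : perm_tail (s * tperm a b)%g = perm_tail s.
    by apply: tailE => k; rewrite !permM sE ea tpermL lift_tperm.
  by rewrite ea tpermL ab compA tr_ins // -ltnS -ab.
have [eb|nb] := eqVneq (s ord0) b.
  have -> : perm_tail (s * tperm a b)%g = perm_tail s.
    apply: tailE => k; rewrite !permM sE eb tpermR.
    by rewrite -(lift_tperm _ ab) tpermK.
  by rewrite eb tpermR ab compA tr_insS // -ltnS -ab.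
have liftE (c : 'I_n.+1) : s ord0 != c -> exists c' : 'I_n, c = lift (s ord0) c'.
  by case: (unliftP (s ord0) c) => [c' -> _|->]; [exists c' | rewrite eqxx].
have [a' ea] := liftE a na; have [b' eb] := liftE b nb.
have -> : perm_tail (s * tperm a b)%g = (perm_tail s * tperm a' b')%g.
  apply: tailE => k; rewrite !permM sE ea eb.
  rewrite -(inj_tperm _ _ _ (@lift_inj _ (s ord0))); congr (lift _ _).
  by rewrite tpermD // eq_sym neq_lift.
have e : (a : nat) = bump (s ord0) a' by rewrite ea.
have e' : (b : nat) = bump (s ord0) b' by rewrite eb.
rewrite /bump in e e'; have hs := ltn_ord (s ord0).
rewrite tpermD // ?ea ?eb 1?eq_sym ?neq_lift //.
rewrite -(IH _ a' b') ?tenm_compr; last by lia.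
rewrite !compA; congr (_ ∘ _); rewrite /= /bump -/(tr n.+1 _); case: (leqP (s ord0) a') => h.
  by rewrite tr_ins_lt //; lia.
by rewrite tr_ins_gt //; lia.
Qed.

Lemma perm_act1 n : perm_act X 1%g = idm (T n).
Proof.
elim: n => //= n IH; rewrite perm1 ins0 comp_idl.
have -> : perm_tail (1%g : 'S_n.+1) = 1%g; last by rewrite IH wh_id.
apply/permP => k; rewrite permE perm1; apply: (@lift_inj _ ord0).
by have := perm_tail_funE (1%g : 'S_n.+1) k; rewrite !perm1.
Qed.

(** In a product [s * t] of permutations [s] acts first, hence the reversed order. *)
Lemma perm_actM n (s t : 'S_n) : perm_act X (s * t)%g = perm_act X t ∘ perm_act X s.
Proof.
elim/perm_adj_ind: t => [|t a b ab IH].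
  by rewrite mulg1 perm_act1 comp_idl.
by rewrite mulgA -!(perm_act_tr _ ab) IH compA.
Qed.

Lemma perm_act_tperm n (a b : 'I_n) : b = a.+1 :> nat -> perm_act X (tperm a b) = tr n a.
Proof. by move=> ab; rewrite -[tperm a b]mul1g -perm_act_tr // perm_act1 comp_idr. Qed.

End PermAct.

(** * Projectors *)

Section Juxtaposition.
Variables (K : fieldType) (C : tensorCategory K) (X : C).
Local Notation T := (tpow X).

(* The identity if m = N; this replaces a transport along m = N. *)
Fixpoint tpow_cast (m N : nat) : Hom (T m) (T N) :=
  match m, N with
  | 0, 0 => idm _
  | m'.+1, N'.+1 => X ◁ tpow_cast m' N'
  | _, _ => 0
  end.

Lemma tpow_cast_id m : tpow_cast m m = idm _.
Proof. by elim: m => //= m ->; rewrite wh_id. Qed.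

(* Meaningful only for N = n + m. *)
Fixpoint juxt (n m N : nat) : Hom (T n ⊗ T m) (T N) :=
  match n, N with
  | 0, _ => tpow_cast m N ∘ lun (T m)
  | n'.+1, N'.+1 => (X ◁ juxt n' m N') ∘ assoc X (T n') (T m)
  | _, _ => 0
  end.

Fixpoint juxtV (n m N : nat) : Hom (T N) (T n ⊗ T m) :=
  match n, N with
  | 0, _ => lunV (T m) ∘ tpow_cast N m
  | n'.+1, N'.+1 => assocV X (T n') (T m) ∘ (X ◁ juxtV n' m N')
  | _, _ => 0
  end.

Lemma juxtK n m : juxtV n m (n + m) ∘ juxt n m (n + m) = idm _.
Proof.
elim: n => [|n IH] /=.
  by rewrite tpow_cast_id comp_idl comp_idr lunK.
by rewrite -?compA (comp_pre _ (whl _ IH)) wh_id comp_idl assocK.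
Qed.

Lemma juxtVK n m : juxt n m (n + m) ∘ juxtV n m (n + m) = idm _.
Proof.
elim: n => [|n IH] /=.
  by rewrite tpow_cast_id comp_idl comp_idr lunVK.
by rewrite -?compA (comp_pre _ (assocVK _ _ _)) comp_idl -tenm_compr IH wh_id.
Qed.

Lemma juxt_trl n m a : (a.+1 < n)%N ->
  juxt n m (n + m) ∘ (tr X n a ⊠ idm _) = tr X (n + m) a ∘ juxt n m (n + m).
Proof.
elim: n a => // n IH [|a] ha.
  case: n ha {IH} => // n _ /=; rewrite tenm_compr -?compA sw_ten.
  by rewrite (comp_pre2 _ (esym (sw_wh _ _ _))) -?compA.
rewrite !addSn !trS /= -?compA assoc_nat.
by rewrite (comp_pre _ (whl _ (IH _ _))) // tenm_compr -?compA.
Qed.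

Lemma juxt_trr n m a :
  juxt n m (n + m) ∘ (T n ◁ tr X m a) = tr X (n + m) (n + a) ∘ juxt n m (n + m).
Proof.
elim: n => [|n IH].
  by rewrite /= !add0n tpow_cast_id comp_idl lun_nat.
rewrite !addSn !trS /= -?compA -tenm_id assoc_nat.
by rewrite (comp_pre _ (whl _ IH)) tenm_compr -?compA.
Qed.

Lemma juxtV_trl n m a : (a.+1 < n)%N ->
  (tr X n a ⊠ idm _) ∘ juxtV n m (n + m) = juxtV n m (n + m) ∘ tr X (n + m) a.
Proof.
move=> ha; apply: (split_mono (juxtK n m)).
by rewrite compA juxt_trl // -compA juxtVK comp_idr compA juxtVK comp_idl.
Qed.

Lemma juxtV_trr n m a :
  (T n ◁ tr X m a) ∘ juxtV n m (n + m) = juxtV n m (n + m) ∘ tr X (n + m) (n + a).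
Proof.
apply: (split_mono (juxtK n m)).
by rewrite compA juxt_trr // -compA juxtVK comp_idr compA juxtVK comp_idl.
Qed.

End Juxtaposition.

Section Scalars.
Variables (K : fieldType) (charK : [pchar K] =i pred0).

Definition sgnb (b : bool) : K := (-1) ^+ b.
Definition epsb (b : bool) n (s : 'S_n) : K := (-1) ^+ (b && s).

Lemma sgnbK b : sgnb b * sgnb b = 1.
Proof. by case: b; rewrite /sgnb ?mulr1 // mulrNN mulr1. Qed.

Lemma sgnb_neq0 b : sgnb b != 0.
Proof. by rewrite /sgnb signr_eq0. Qed.

Lemma epsbK b n (s : 'S_n) : epsb b s * epsb b s = 1.
Proof. exact: (sgnbK (b && s)). Qed.

Lemma epsb1 b n : epsb b (1%g : 'S_n) = 1.
Proof. by rewrite /epsb odd_perm1 andbF. Qed.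

Lemma epsbM b n (s t : 'S_n) : epsb b (s * t)%g = epsb b s * epsb b t.
Proof. by rewrite /epsb odd_permM; case: b; rewrite //= ?signr_addb ?mulr1. Qed.

Lemma epsb_tperm b n (i j : 'I_n) : i != j -> epsb b (tperm i j) = sgnb b.
Proof. by move=> ij; rewrite /epsb odd_tperm ij andbT. Qed.

Lemma natr_neq0 n : n.+1%:R != 0 :> K.
Proof. by have /pcharf0P -> := charK. Qed.

Lemma fact_neq0 n : n`!%:R != 0 :> K.
Proof. by have /pcharf0P -> := charK; rewrite -lt0n fact_gt0. Qed.

Section Average.
Variables (C : linearCategory K) (b : bool) (n : nat) (Y : C).
Variable u : 'S_n -> Hom Y Y.
Hypothesis u1 : u 1%g = idm Y.
Hypothesis uM : forall s t, u (s * t)%g = u t ∘ u s.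

Lemma act_absl Z (x : Hom Z Y) :
  (forall i j : 'I_n, j = i.+1 :> nat -> u (tperm i j) ∘ x = sgnb b *: x) ->
  forall s, u s ∘ x = epsb b s *: x.
Proof.
move=> ux; elim/perm_adj_ind => [|s i j ij IH].
  by rewrite u1 comp_idl epsb1 scale1r.
rewrite uM -compA IH compZr ux // scalerA epsbM epsb_tperm //.
by rewrite -val_eqE /=; lia.
Qed.

Lemma act_absr Z (x : Hom Y Z) :
  (forall i j : 'I_n, j = i.+1 :> nat -> x ∘ u (tperm i j) = sgnb b *: x) ->
  forall s, x ∘ u s = epsb b s *: x.
Proof.
move=> ux; elim/perm_adj_ind => [|s i j ij IH].
  by rewrite u1 comp_idr epsb1 scale1r.
rewrite uM compA ux // compZl IH scalerA epsbM mulrC epsb_tperm //.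
by rewrite -val_eqE /=; lia.
Qed.

Definition average := (n`!%:R)^-1 *: \sum_s epsb b s *: u s.

Lemma average_absl Z (x : Hom Z Y) :
  (forall i j : 'I_n, j = i.+1 :> nat -> u (tperm i j) ∘ x = sgnb b *: x) ->
  average ∘ x = x.
Proof.
move=> /act_absl ux; rewrite compZl comp_suml (eq_bigr (fun=> x)) => [|s _].
  rewrite sumr_const card_Sn -scaler_nat scalerA mulVf ?fact_neq0 //.
  by rewrite scale1r.
by rewrite compZl ux scalerA epsbK scale1r.
Qed.

Lemma average_absr Z (x : Hom Y Z) :
  (forall i j : 'I_n, j = i.+1 :> nat -> x ∘ u (tperm i j) = sgnb b *: x) ->
  x ∘ average = x.
Proof.
move=> /act_absr ux; rewrite compZr comp_sumr (eq_bigr (fun=> x)) => [|s _].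
  rewrite sumr_const card_Sn -scaler_nat scalerA mulVf ?fact_neq0 //.
  by rewrite scale1r.
by rewrite compZr ux scalerA epsbK scale1r.
Qed.

Lemma average_actl s : u s ∘ average = epsb b s *: average.
Proof.
rewrite compZr comp_sumr scalerA mulrC -scalerA; congr (_ *: _).
rewrite scaler_sumr [RHS](reindex_inj (mulIg s)) /=.
by apply: eq_bigr => t _; rewrite compZr uM scalerA epsbM mulrCA epsbK mulr1.
Qed.

Lemma average_actr s : average ∘ u s = epsb b s *: average.
Proof.
rewrite compZl comp_suml scalerA mulrC -scalerA; congr (_ *: _).
rewrite scaler_sumr [RHS](reindex_inj (mulgI s)) /=.
by apply: eq_bigr => t _; rewrite compZl uM scalerA epsbM mulrA epsbK mul1r.
Qed.

Lemma average_adjl (i j : 'I_n) :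
  j = i.+1 :> nat -> u (tperm i j) ∘ average = sgnb b *: average.
Proof.
by move=> ij; rewrite average_actl epsb_tperm // -val_eqE /=; lia.
Qed.

Lemma average_adjr (i j : 'I_n) :
  j = i.+1 :> nat -> average ∘ u (tperm i j) = sgnb b *: average.
Proof.
by move=> ij; rewrite average_actr epsb_tperm // -val_eqE /=; lia.
Qed.

End Average.
End Scalars.
Arguments sgnb {K} b.
Arguments epsb {K} b {n} s.

HB.lock Definition proj (K : fieldType) (C : tensorCategory K) (X : C) (b : bool)
    (n : nat) : Hom (tpow X n) (tpow X n) :=
  average b (@perm_act K C X n).
(* The projectors on the first n, respectively the last N - n, factors. *)
HB.lock Definition projl (K : fieldType) (C : tensorCategory K) (X : C) (b : bool)
    (n N : nat) : Hom (tpow X N) (tpow X N) :=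
  juxt X n (N - n) N ∘ ((proj X b n ⊠ idm _) ∘ juxtV X n (N - n) N).
HB.lock Definition projr (K : fieldType) (C : tensorCategory K) (X : C) (b : bool)
    (n N : nat) : Hom (tpow X N) (tpow X N) :=
  juxt X n (N - n) N ∘ ((tpow X n ◁ proj X b (N - n)) ∘ juxtV X n (N - n) N).

Section Projectors.
Variables (K : fieldType) (charK : [pchar K] =i pred0).

(* J collects the positions j such that the adjacent factors j and j + 1 are
   symmetrized (b = false) or antisymmetrized (b = true) by e; e is determined
   by these properties, see is_proj_uniq. *)
Definition is_proj (C : tensorCategory K) (X : C) b n (J : pred nat)
    (e : Hom (tpow X n) (tpow X n)) : Prop :=
  [/\ forall j, J j -> tr X n j ∘ e = sgnb b *: e,
      forall j, J j -> e ∘ tr X n j = sgnb b *: e,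
      forall Z (x : Hom Z (tpow X n)),
        (forall j, J j -> tr X n j ∘ x = sgnb b *: x) -> e ∘ x = x
    & forall Z (x : Hom (tpow X n) Z),
        (forall j, J j -> x ∘ tr X n j = sgnb b *: x) -> x ∘ e = x].

Section Proj.
Variables (C : tensorCategory K) (X : C) (b : bool).
Local Notation T := (tpow X).

(** Both projectors equal [e ∘ e'], since each absorbs what has the symmetry of the other. *)
Lemma is_proj_uniq n J e e' :
  @is_proj C X b n J e -> @is_proj C X b n J e' -> e = e'.
Proof.
move=> [_ e2 e3 _] [e1' _ _ e4'].
by rewrite -[RHS]e3 // -[LHS]e4'.
Qed.

Lemma is_proj_idem n J e : @is_proj C X b n J e -> e ∘ e = e.
Proof. by move=> [e1 _ e3 _]; apply: e3. Qed.

Lemma is_proj_subl n (J J' : pred nat) e e' : (forall j, J j -> J' j) ->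
  @is_proj C X b n J e -> @is_proj C X b n J' e' -> e ∘ e' = e'.
Proof. by move=> JJ [_ _ e3 _] [e1' _ _ _]; apply: e3 => j /JJ; apply: e1'. Qed.

Lemma is_proj_subr n (J J' : pred nat) e e' : (forall j, J j -> J' j) ->
  @is_proj C X b n J e -> @is_proj C X b n J' e' -> e' ∘ e = e'.
Proof. by move=> JJ [_ _ _ e4] [_ e2' _ _]; apply: e4 => j /JJ; apply: e2'. Qed.

Local Notation proj := (proj X b).
Local Notation projl := (projl X b).
Local Notation projr := (projr X b).

(** Transports the average over ['S_n] along an algebra morphism that matches the adjacent
    transpositions of [T n] with the positions in [J]. It serves for the projectors on all, the
    first, the last, and all but the first factors. *)
Lemma act_is_proj n N (J : pred nat) (phi : Hom (T n) (T n) -> Hom (T N) (T N)) :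
  linear phi -> phi (idm _) = idm _ ->
  (forall f g, phi (f ∘ g) = phi f ∘ phi g) ->
  (forall j, J j -> exists2 i, (i.+1 < n)%N & tr X N j = phi (tr X n i)) ->
  (forall i, (i.+1 < n)%N -> exists2 j, J j & tr X N j = phi (tr X n i)) ->
  is_proj b J (phi (proj n)).
Proof.
move=> lphi phi1 phiM Jphi phiJ.
have phiZ a f : phi (a *: f) = a *: phi f.
  by have := lphi a f 0; rewrite (linear_morph0 lphi) !addr0.
have -> : phi (proj n) = average b (fun s : 'S_n => phi (perm_act X s)).
  rewrite proj.unlock /average phiZ; congr (_ *: _).
  rewrite (big_morph phi (linear_morphD lphi) (linear_morph0 lphi)).
  by apply: eq_bigr => s _; rewrite phiZ.
set u := fun s : 'S_n => _.
have u1 : u 1%g = idm _ by rewrite /u perm_act1.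
have uM s t : u (s * t)%g = u t ∘ u s by rewrite /u perm_actM phiM.
have uJ j : J j -> exists i k : 'I_n, k = i.+1 :> nat /\ tr X N j = u (tperm i k).
  move=> /Jphi[i hi ->]; exists (Ordinal (ltnW hi)), (Ordinal hi); split => //.
  by rewrite /u perm_act_tperm.
have Ju (i k : 'I_n) : k = i.+1 :> nat -> exists2 j, J j & tr X N j = u (tperm i k).
  move=> ik; have [|j Jj e] := phiJ i; first by rewrite -ik.
  by exists j => //; rewrite e /u perm_act_tperm.
split=> [j /uJ [i [k [ik ->]]]|j /uJ [i [k [ik ->]]]|Z x hx|Z x hx].
- exact: average_adjl.
- exact: average_adjr.
- by apply: (average_absl charK) => // i k /Ju[j Jj <-]; apply: hx.
- by apply: (average_absr charK) => // i k /Ju[j Jj <-]; apply: hx.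
Qed.

Lemma proj_is_proj n : is_proj b (fun j => j.+1 < n)%N (proj n).
Proof.
by apply: (@act_is_proj n n _ id) => //; [move=> j hj; exists j | move=> j hj; exists j].
Qed.

Lemma projl_is_proj n N : (n <= N)%N -> is_proj b (fun j => j.+1 < n)%N (projl n N).
Proof.
move=> hn; rewrite projl.unlock; move: (N - n)%N (subnKC hn) => m <- {hn}.
apply: (@act_is_proj n (n + m) _
  (fun f => juxt X n m (n + m) ∘ ((f ⊠ idm _) ∘ juxtV X n m (n + m)))).
- by move=> a f g; rewrite tenmDl tenmZl !(compDl, compDr) !(compZl, compZr).
- by rewrite tenm_id comp_idl juxtVK.
- move=> f g; rewrite tenm_compl -?compA; congr (_ ∘ (_ ∘ _)).
  by rewrite (comp_pre _ (juxtK X n m)) comp_idl.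
- by move=> j hj; exists j => //; rewrite juxtV_trl // compA juxtVK comp_idl.
- by move=> j hj; exists j => //; rewrite juxtV_trl // compA juxtVK comp_idl.
Qed.

Lemma projr_is_proj n N : (n <= N)%N ->
  is_proj b (fun j => n <= j < N.-1)%N (projr n N).
Proof.
move=> hn; rewrite projr.unlock; move: (N - n)%N (subnKC hn) => m <- {hn}.
apply: (@act_is_proj m (n + m) _
  (fun f => juxt X n m (n + m) ∘ ((T n ◁ f) ∘ juxtV X n m (n + m)))).
- by move=> a f g; rewrite tenmDr tenmZr !(compDl, compDr) !(compZl, compZr).
- by rewrite tenm_id comp_idl juxtVK.
- move=> f g; rewrite tenm_compr -?compA; congr (_ ∘ (_ ∘ _)).
  by rewrite (comp_pre _ (juxtK X n m)) comp_idl.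
- move=> j hj; exists (j - n)%N; first by lia.
  rewrite juxtV_trr compA juxtVK comp_idl; congr tr; lia.
- move=> j hj; exists (n + j)%N; first by lia.
  by rewrite juxtV_trr compA juxtVK comp_idl.
Qed.

Lemma projS_is_proj n : @is_proj C X b n.+1 (fun j => 0 < j < n)%N (X ◁ proj n).
Proof.
apply: (@act_is_proj n n.+1 _ (fun f : Hom (T n) (T n) => X ◁ f : Hom (T n.+1) (T n.+1))).
- by move=> a f g; rewrite tenmDr tenmZr.
- by rewrite wh_id.
- by move=> f g; rewrite tenm_compr.
- by case=> // j hj; exists j; rewrite ?trS.
- by move=> j hj; exists j.+1; rewrite ?trS.
Qed.

Lemma perm_act_lift n (i : 'I_n.+1) (t : 'S_n) :
  perm_act X (lift_perm ord0 i t) = insert_factor X n i ∘ (X ◁ perm_act X t).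
Proof.
rewrite /= lift_perm_id; congr (_ ∘ (_ ◁ perm_act X _)).
apply/permP => k; rewrite permE; apply: (@lift_inj _ i).
by have := perm_tail_funE (lift_perm ord0 i t) k; rewrite lift_perm_id lift_perm_lift.
Qed.

Lemma lift_permK n : bijective (fun p : 'I_n.+1 * 'S_n => lift_perm ord0 p.1 p.2).
Proof.
have inj : injective (fun p : 'I_n.+1 * 'S_n => lift_perm ord0 p.1 p.2).
  move=> [i s] [j t] /= /permP e.
  have ij : i = j by have := e ord0; rewrite !lift_perm_id.
  rewrite ij in e *; congr pair; apply/permP => k; apply: (@lift_inj _ j).
  by have := e (lift ord0 k); rewrite !lift_perm_lift.
apply: inj_card_bij inj _.
by rewrite card_prod card_ord !card_Sn factS.
Qed.

Lemma sum_lift_perm (V : nmodType) n (F : 'S_n.+1 -> V) :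
  \sum_s F s = \sum_(i < n.+1) \sum_t F (lift_perm ord0 i t).
Proof. by rewrite pair_bigA (reindex _ (onW_bij _ (lift_permK n))). Qed.

(** The permutations are sorted by the position to which they send the first factor. *)
Lemma projS_sum n :
  n.+1%:R *: proj n.+1
  = \sum_(i < n.+1) sgnb b ^+ i *: (insert_factor X n i ∘ (X ◁ proj n)).
Proof.
rewrite proj.unlock /average sum_lift_perm.
rewrite scalerA factS natrM invfM mulrA mulfV ?(natr_neq0 charK) // mul1r scaler_sumr.
apply: eq_bigr => i _; rewrite tenmZr compZr scalerA mulrC -scalerA; congr (_ *: _).
rewrite tenm_sumr comp_sumr scaler_sumr; apply: eq_bigr => t _.
rewrite perm_act_lift tenmZr compZr scalerA; congr (_ *: _).
rewrite /epsb /sgnb odd_lift_perm /=; case: b; rewrite /= ?expr1n ?mul1r //.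
by rewrite signr_addb signr_odd.
Qed.

Lemma proj_insert n i : (i <= n)%N ->
  proj n.+1 ∘ insert_factor X n i = sgnb b ^+ i *: proj n.+1.
Proof.
elim: i => [|i IH] hi; first by rewrite ins0 comp_idr scale1r.
have [_ h _ _] := proj_is_proj n.+1.
by rewrite -tr_ins // compA h // compZl IH ?scalerA ?exprS // ltnW.
Qed.

(** Multiply [projS_sum] by [X ◁ proj n]: an insertion at a positive position is the exchange of the
    first two factors followed by an insertion into the tail, which the projector absorbs up to
    sign. So the last [n] terms coincide. *)
Lemma projS n :
  n.+1%:R *: proj n.+1
  = (X ◁ proj n) + (n%:R * sgnb b) *: ((X ◁ proj n) ∘ (tr X n.+1 0 ∘ (X ◁ proj n))).
Proof.
have h := projS_is_proj n; have id' := is_proj_idem h.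
have e' : (X ◁ proj n) ∘ proj n.+1 = proj n.+1.
  by apply: (is_proj_subl _ h (proj_is_proj n.+1)) => j /=; lia.
rewrite -{1}e' -compZr projS_sum comp_sumr big_ord_recl ins0 comp_idl scale1r.
rewrite id'; congr (_ + _).
rewrite (eq_bigr (fun=> sgnb b *: ((X ◁ proj n) ∘ (tr X n.+1 0 ∘ (X ◁ proj n))))).
  by rewrite sumr_const card_ord -scaler_nat scalerA.
move=> i _; case: n i {h id' e'} => [|n] i; first by case: i.
rewrite lift0 insS compZr -?compA.
rewrite (comp_pre _ (whl _ (proj_insert _))) ?tenmZr ?compZl ?scalerA; last first.
  by have := ltn_ord i; lia.
by rewrite exprS -mulrA -exprMn sgnbK expr1n mulr1.
Qed.

Lemma projrS n m : let N := (n + m.+1)%N in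
  m.+1%:R *: projr n N
  = projr n.+1 N
    + (m%:R * sgnb b) *: (projr n.+1 N ∘ (tr X N n ∘ projr n.+1 N)).
Proof.
move=> N; pose ph (f : Hom (T m.+1) (T m.+1)) :=
  juxt X n m.+1 N ∘ ((T n ◁ f) ∘ juxtV X n m.+1 N).
have phM f g : ph (f ∘ g) = ph f ∘ ph g.
  rewrite /ph tenm_compr -?compA; congr (_ ∘ (_ ∘ _)).
  by rewrite (comp_pre _ (juxtK X n m.+1)) comp_idl.
have phT j : ph (tr X m.+1 j) = tr X N (n + j).
  by rewrite /ph /N juxtV_trr compA juxtVK comp_idl.
have nN : (n <= N)%N by rewrite leq_addr.
have -> : projr n N = ph (proj m.+1).
  rewrite projr.unlock; have -> : (N - n)%N = m.+1 by rewrite /N addKn.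
  by [].
have -> : projr n.+1 N = ph (X ◁ proj m).
  apply: (is_proj_uniq (projr_is_proj _)); first by rewrite /N; lia.
  apply: (@act_is_proj m N _ (fun f => ph (X ◁ f))).
  - move=> a f g; rewrite /ph !tenmDr !tenmZr.
    by rewrite !(compDl, compDr) !(compZl, compZr).
  - by rewrite wh_id /ph wh_id comp_idl juxtVK.
  - by move=> f g; rewrite tenm_compr phM.
  - move=> j hj; exists (j - n.+1)%N; first by rewrite /N in hj; lia.
    rewrite -trS phT; congr tr; lia.
  - move=> j hj; exists (n + j.+1)%N; first by rewrite /N; lia.
    by rewrite -trS phT.
rewrite -{1}[n]addn0 -phT -!phM.
have phZ a f : a *: ph f = ph (a *: f) by rewrite /ph tenmZr !(compZl, compZr).
have phD f g : ph f + ph g = ph (f + g) by rewrite /ph tenmDr !(compDl, compDr).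
by rewrite !phZ phD projS.
Qed.

(** Reversing the factors exchanges the projectors on the first and on the last factors; this
    reduces [projlS] to [projrS]. *)
Definition rev_perm n : 'S_n := perm (@rev_ord_inj n).

Definition revm n : Hom (T n) (T n) := perm_act X (rev_perm n).

Lemma rev_permK n : (rev_perm n * rev_perm n = 1)%g.
Proof. by apply/permP => k; rewrite permM !permE rev_ordK. Qed.

Lemma revmK n : revm n ∘ revm n = idm _.
Proof. by rewrite -perm_actM rev_permK perm_act1. Qed.

Lemma revm_tr n j : (j.+1 < n)%N -> revm n ∘ tr X n j = tr X n (n - j.+2) ∘ revm n.
Proof.
move=> hj; have e : (rev_perm n)^-1%g = rev_perm n.
  by apply: (mulgI (rev_perm n)); rewrite mulgV rev_permK.
have := tpermJ (Ordinal (ltnW hj)) (Ordinal hj) (rev_perm n).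
rewrite /conjg e => /(congr1 (fun t => perm_act X t)).
rewrite [tperm (rev_perm n _) _]tpermC !perm_actM perm_act_tperm //.
rewrite [X in _ = X -> _]perm_act_tperm; last by rewrite !permE /=; lia.
have -> : nat_of_ord (rev_perm n (Ordinal hj)) = (n - j.+2)%N by rewrite permE.
rewrite -/(revm n) => h.
by rewrite -h -?compA revmK comp_idr.
Qed.

Lemma is_proj_rev n (J : pred nat) e : (forall j, J j -> j.+1 < n)%N -> @is_proj C X b n J e ->
  is_proj b (fun j => (j.+1 < n) && J (n - j.+2))%N (revm n ∘ (e ∘ revm n)).
Proof.
move=> Jn [e1 e2 e3 e4].
have revC j : (j.+1 < n)%N -> tr X n j ∘ revm n = revm n ∘ tr X n (n - j.+2).
  move=> hj; rewrite revm_tr; last by lia.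
  by congr (tr X n _ ∘ _); lia.
have Jrev j : J j -> ((n - j.+2).+1 < n)%N /\ J (n - (n - j.+2).+2)%N.
  move=> Jj; have hj := Jn j Jj; split; first by lia.
  by have -> : (n - (n - j.+2).+2)%N = j by lia.
split=> [j /andP[hj Jj]|j /andP[hj Jj]|Z x hx|Z x hx].
- by rewrite (comp_pre2 _ (revC _ hj)) (comp_pre _ (e1 _ Jj)) compZl compZr.
- by rewrite -?compA revm_tr // (comp_pre _ (e2 _ Jj)) compZl compZr.
- rewrite -?compA e3 ?(comp_pre _ (revmK n)) ?comp_idl // => j Jj.
  have [h1 h2] := Jrev j Jj.
  by rewrite (comp_pre2 _ (revC _ (Jn _ Jj))) hx ?compZr // h1 h2.
- rewrite !compA e4 -?compA ?revmK ?comp_idr // => j Jj.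
  have [h1 h2] := Jrev j Jj.
  by rewrite -?compA revm_tr ?Jn // compA hx ?compZl // h1 h2.
Qed.

Lemma projlE n N : (n <= N)%N -> projl n N = revm N ∘ (projr (N - n) N ∘ revm N).
Proof.
move=> hn; have [p1 p2 p3 p4] := projl_is_proj hn.
have h : (N - n <= N)%N by rewrite leq_subr.
apply: (@is_proj_uniq N (fun j => j.+1 < n)%N); first exact: projl_is_proj.
have [q1 q2 q3 q4] : is_proj b (fun j => (j.+1 < N) && (N - n <= N - j.+2 < N.-1))%N
    (revm N ∘ (projr (N - n) N ∘ revm N)).
  by apply: (is_proj_rev _ (projr_is_proj h)) => j /=; lia.
have e j : (j.+1 < n)%N = ((j.+1 < N) && (N - n <= N - j.+2 < N.-1))%N by lia.
split=> [j|j|Z x hx|Z x hx].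
- by rewrite e; apply: q1.
- by rewrite e; apply: q2.
- by apply: q3 => j; rewrite -e; apply: hx.
- by apply: q4 => j; rewrite -e; apply: hx.
Qed.

Lemma projlS n N : (n < N)%N ->
  n.+1%:R *: projl n.+1 N
  = projl n N + (n%:R * sgnb b) *: (projl n N ∘ (tr X N n.-1 ∘ projl n N)).
Proof.
move=> hn; have [m eN] : exists m, N = (m + n.+1)%N by exists (N - n.+1)%N; lia.
rewrite !projlE // 1?ltnW //; subst N.
have -> : (m + n.+1 - n.+1 = m)%N by lia.
have -> : (m + n.+1 - n = m.+1)%N by lia.
rewrite -compZr -compZl projrS !(compDl, compDr) !(compZl, compZr); congr (_ + _).
(* For [n = 0] the position [n.-1] has no meaning, but its coefficient is 0. *)
case: n hn => [|n] hn; first by rewrite mul0r !scale0r.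
rewrite -?compA (comp_pre2 _ (revm_tr _)); last by lia.
rewrite !(comp_pre _ (revmK _)) comp_idl.
by congr (_ *: (_ ∘ (_ ∘ (tr X _ _ ∘ _)))); lia.
Qed.

End Proj.
End Projectors.

(** * Images in the Grothendieck ring *)

Section Images.
Variables (K : fieldType) (C : tensorCategory K).
Implicit Types X Y Z : C.

Lemma split_idem X Z (i : Hom Z X) (p : Hom X Z) (e : Hom X X) :
  p ∘ i = idm Z -> i ∘ p = e -> p ∘ (e ∘ i) = idm Z.
Proof. by move=> pi <-; rewrite -?compA pi comp_idr. Qed.

Lemma img_iso1 X Y (e : Hom X X) (f : Hom Y Y) (x : Hom X Y) (y : Hom Y X) :
  e ∘ e = e -> f ∘ f = f -> y ∘ (f ∘ x) = e -> x ∘ (e ∘ y) = f -> img e ≅ img f.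
Proof.
move=> ee ff yfx xey.
exists (img_pr f ∘ (x ∘ img_in e)), (img_pr e ∘ (y ∘ img_in f)); split.
  rewrite -?compA (comp_pre _ (img_inK ff)) (comp_pre3 _ yfx).
  exact: split_idem (img_prK ee) (img_inK ee).
rewrite -?compA (comp_pre _ (img_inK ee)) (comp_pre3 _ xey).
exact: split_idem (img_prK ff) (img_inK ff).
Qed.

(* The scalars c and d are not required to agree; they do unless e = 0. *)
Lemma img_iso X Y (e : Hom X X) (f : Hom Y Y) (x : Hom X Y) (y : Hom Y X) (c d : K) :
  e ∘ e = e -> f ∘ f = f -> c != 0 -> d != 0 ->
  e = c *: (y ∘ x) -> f = d *: (x ∘ y) -> img e ≅ img f.
Proof.
move=> ee ff c0 d0 eE fE.
have MM : y ∘ (x ∘ (y ∘ x)) = c^-1 *: (y ∘ x).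
  apply: (scalerI c0); rewrite scalerA mulfV // scale1r; apply: (scalerI c0).
  by rewrite -[in RHS]eE -ee eE compZl compZr -?compA.
have NN : x ∘ (y ∘ (x ∘ y)) = d^-1 *: (x ∘ y).
  apply: (scalerI d0); rewrite scalerA mulfV // scale1r; apply: (scalerI d0).
  by rewrite -[in RHS]fE -ff fE compZl compZr -?compA.
(* The cube of [y ∘ x] is evaluated by [MM] alone and by [NN] followed by [MM]; so [c] and [d] agree
   on [y ∘ x]. *)
have dM : d *: (y ∘ x) = c *: (y ∘ x).
  have := congr1 (fun h => y ∘ (h ∘ x)) NN; rewrite compZl compZr -?compA MM.
  rewrite !compZr MM !scalerA => h.
  have := congr1 (fun h => (c * c * d) *: h) h; rewrite !scalerA.
  have -> : c * c * d * (c^-1 / c) = d by field.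
  by have -> : c * c * d * (d^-1 / c) = c by field; rewrite d0 c0.
have dN : d *: (x ∘ y) = c *: (x ∘ y).
  have := congr1 (fun h => x ∘ (h ∘ y)) MM; rewrite compZl compZr -?compA NN.
  rewrite !compZr NN !scalerA => h.
  have := congr1 (fun h => (d * d * c) *: h) h; rewrite !scalerA.
  have -> : d * d * c * (d^-1 / d) = c by field.
  by have -> : d * d * c * (c^-1 / d) = d by field; rewrite d0 c0.
apply: (@img_iso1 _ _ _ _ x (c *: y)) => //.
  rewrite fE !(compZl, compZr) -?compA MM eE !scalerA.
  have -> : c * d / c = d by field.
  by rewrite dM.
rewrite eE !(compZl, compZr) -?compA NN fE.
transitivity ((c / d) *: (c *: (x ∘ y))); last by rewrite -dN scalerA divfK.
by rewrite !scalerA; congr (_ *: _); ring.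
Qed.

Lemma img_in_idem X (e : Hom X X) : e ∘ e = e -> e ∘ img_in e = img_in e.
Proof.
move=> ee; have : (img_in e ∘ img_pr e) ∘ img_in e = img_in e.
  by rewrite -compA (img_prK ee) comp_idr.
by rewrite (img_inK ee).
Qed.

Lemma img_pr_idem X (e : Hom X X) : e ∘ e = e -> img_pr e ∘ e = img_pr e.
Proof.
move=> ee; have : img_pr e ∘ (img_in e ∘ img_pr e) = img_pr e.
  by rewrite compA (img_prK ee) comp_idl.
by rewrite (img_inK ee).
Qed.

Lemma img_bip X (e e1 e2 : Hom X X) :
  e1 ∘ e1 = e1 -> e2 ∘ e2 = e2 -> e1 ∘ e2 = 0 -> e2 ∘ e1 = 0 -> e = e1 + e2 ->
  img e ≅ img e1 ⊕ img e2.
Proof.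
move=> e11 e22 e12 e21 eE.
have ee : e ∘ e = e by rewrite eE !(compDl, compDr) e11 e12 e21 e22 addr0 add0r.
have ein (f : Hom X X) : f ∘ f = f -> e ∘ f = f -> e ∘ img_in f = img_in f.
  by move=> ff ef; rewrite -(img_in_idem ff) compA ef.
have ein1 : e ∘ img_in e1 = img_in e1 by apply: ein => //; rewrite eE compDl e11 e21 addr0.
have ein2 : e ∘ img_in e2 = img_in e2 by apply: ein => //; rewrite eE compDl e22 e12 add0r.
have orth (f f' : Hom X X) : f ∘ f = f -> f' ∘ f' = f' -> f ∘ f' = 0 -> img_pr f ∘ img_in f' = 0.
  move=> ff ff' ff'0; rewrite -(img_in_idem ff') -(img_pr_idem ff).
  by rewrite -compA (comp_pre _ ff'0) comp0l comp0r.
apply: (@bip_char _ _ _ _ _ (img_pr e ∘ img_in e1) (img_pr e ∘ img_in e2)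
          (img_pr e1 ∘ img_in e) (img_pr e2 ∘ img_in e));
  rewrite -?compA ?(comp_pre _ (img_inK ee)) ?ein1 ?ein2 ?(img_prK e11) ?(img_prK e22)
    ?(orth _ _ e11 e22 e12) ?(orth _ _ e22 e11 e21) //.
rewrite (comp_pre _ (img_inK e11)) (comp_pre _ (img_inK e22)) -compDr -compDl -eE.
exact: split_idem (img_prK ee) (img_inK ee).
Qed.

Lemma img_ten X Y (e : Hom X X) (f : Hom Y Y) :
  e ∘ e = e -> f ∘ f = f -> img (e ⊠ f) ≅ img e ⊗ img f.
Proof.
move=> ee ff; have eff : (e ⊠ f) ∘ (e ⊠ f) = e ⊠ f by rewrite -tenm_comp ee ff.
exists ((img_pr e ⊠ img_pr f) ∘ img_in (e ⊠ f)),
  (img_pr (e ⊠ f) ∘ (img_in e ⊠ img_in f)); split; rewrite -?compA.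
  rewrite (comp_pre _ (esym (tenm_comp _ _ _ _))) !img_inK //.
  exact: split_idem (img_prK eff) (img_inK eff).
rewrite (comp_pre _ (img_inK eff)) -!tenm_comp.
by rewrite !split_idem ?tenm_id //; [exact: img_prK|exact: img_inK|exact: img_prK|exact: img_inK].
Qed.

Lemma img_zero X (e : Hom X X) : e ∘ e = e -> is_zero (img e) -> e = 0.
Proof.
by move=> ee z; rewrite -[LHS](img_inK ee) -[img_pr e]comp_idl z comp0l comp0r.
Qed.

Lemma img_id X : img (idm X) ≅ X.
Proof.
have ii : idm X ∘ idm X = idm X by rewrite comp_idl.
by exists (img_in (idm X)), (img_pr (idm X)); rewrite img_prK ?img_inK.
Qed.

Lemma zero_img X : is_zero (img (0 : Hom X X)).
Proof. by rewrite /is_zero -img_prK ?comp0l // -[img_pr 0]img_pr_idem ?comp0l ?comp0r ?comp0l. Qed.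

End Images.

Section K0Images.
Variables (K : fieldType) (C : rigidTensorCategory K).
Implicit Types X Y Z : C.

Lemma K0_iso X Y : X ≅ Y -> K0_class X = K0_class Y.
Proof.
by move=> h; apply/K0_classP; exists X; apply: bip_iso h (iso_refl X).
Qed.

Lemma K0_zero X : is_zero X -> K0_class X = 0.
Proof.
move=> z; have h : X ⊕ X ≅ X.
  apply/iso_sym/(@bip_char _ _ _ _ _ 0 0 0 0); rewrite ?comp0l ?z ?addr0 //.
by apply: (addrI (K0_class X)); rewrite addr0 -K0_classD (K0_iso h).
Qed.

Definition kimg X (e : Hom X X) : K0 C := K0_class (img e).

Lemma kimg0 X : kimg (0 : Hom X X) = 0.
Proof. exact/K0_zero/zero_img. Qed.

Lemma kimgD X (e e1 e2 : Hom X X) :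
  e1 ∘ e1 = e1 -> e2 ∘ e2 = e2 -> e1 ∘ e2 = 0 -> e2 ∘ e1 = 0 -> e = e1 + e2 ->
  kimg e = kimg e1 + kimg e2.
Proof. by move=> h1 h2 h3 h4 h5; rewrite -K0_classD; apply/K0_iso/img_bip. Qed.

Lemma kimg_iso X Y (e : Hom X X) (f : Hom Y Y) (x : Hom X Y) (y : Hom Y X) (c d : K) :
  e ∘ e = e -> f ∘ f = f -> c != 0 -> d != 0 ->
  e = c *: (y ∘ x) -> f = d *: (x ∘ y) -> kimg e = kimg f.
Proof.
by move=> h1 h2 h3 h4 h5 h6; apply: K0_iso; apply: img_iso h5 h6.
Qed.

Lemma kimg_ten X Y (e : Hom X X) (f : Hom Y Y) :
  e ∘ e = e -> f ∘ f = f -> kimg (e ⊠ f) = kimg e * kimg f.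
Proof. by move=> h1 h2; rewrite -K0_classM; apply/K0_iso/img_ten. Qed.

Lemma kimg_id X : kimg (idm X) = K0_class X.
Proof. exact/K0_iso/img_id. Qed.

End K0Images.

(** * Koszul relations *)

Lemma alternating_telescope (R : comNzRingType) (q g : nat -> R) n :
  q 0%N = g 0%N -> (forall i, (i < n)%N -> q i.+1 = g i.+1 + g i) ->
  \sum_(i < n.+1) (-1) ^+ i * q i = (-1) ^+ n * g n.
Proof.
elim: n => [|n IH] q0 qS; first by rewrite big_ord1 q0.
rewrite big_ord_recr IH => [|//|i hi]; last by apply/qS/ltnW.
by rewrite /= qS // exprS; ring.
Qed.

Section Koszul.
Variables (K : fieldType) (charK : [pchar K] =i pred0).
Variables (C : rigidTensorCategory K) (X : C).

Lemma proj_idem b n : proj X b n ∘ proj X b n = proj X b n.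
Proof. exact: is_proj_idem (proj_is_proj charK X b n). Qed.

Lemma symmetrizerE n : symmetrizer X n = proj X false n.
Proof.
rewrite proj.unlock /symmetrizer /average; congr (_ *: _).
by apply: eq_bigr => s _; rewrite /epsb scale1r.
Qed.

Lemma antisymmetrizerE n : antisymmetrizer X n = proj X true n.
Proof. by rewrite proj.unlock. Qed.

Definition kpow b n : K0 C := kimg (proj X b n).

Lemma kpow_sym n : K0_class (Sym n X) = kpow false n.
Proof. by rewrite /Sym symmetrizerE. Qed.

Lemma kpow_alt n : K0_class (Alt n X) = kpow true n.
Proof. by rewrite /Alt antisymmetrizerE. Qed.

Lemma kpow0 b : kpow b 0 = 1.
Proof.
have -> : kpow b 0 = kimg (idm (tpow X 0)); last by rewrite kimg_id K0_class1.
congr kimg; have [_ _ h _] := proj_is_proj charK X b 0.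
by rewrite -[LHS]comp_idr h.
Qed.

Lemma proj_tenm_idem b c n m :
  (proj X b n ⊠ proj X c m) ∘ (proj X b n ⊠ proj X c m) = proj X b n ⊠ proj X c m.
Proof. by rewrite -tenm_comp !proj_idem. Qed.

Lemma projlr_tenm b c n N : (n <= N)%N ->
  projl X b n N ∘ projr X c n N
  = juxt X n (N - n) N ∘ ((proj X b n ⊠ proj X c (N - n)) ∘ juxtV X n (N - n) N).
Proof.
move=> hn; rewrite projl.unlock projr.unlock.
move: (N - n)%N (subnKC hn) => m <-; rewrite -?compA; congr (_ ∘ _).
rewrite (comp_pre _ (juxtK _ _ _)) comp_idl compA -tenm_comp.
by rewrite comp_idl comp_idr.
Qed.

Lemma projrl_tenm b c n N : (n <= N)%N ->
  projr X c n N ∘ projl X b n N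
  = juxt X n (N - n) N ∘ ((proj X b n ⊠ proj X c (N - n)) ∘ juxtV X n (N - n) N).
Proof.
move=> hn; rewrite projl.unlock projr.unlock.
move: (N - n)%N (subnKC hn) => m <-; rewrite -?compA; congr (_ ∘ _).
rewrite (comp_pre _ (juxtK _ _ _)) comp_idl compA -tenm_comp.
by rewrite comp_idl comp_idr.
Qed.

Lemma projlrC b c n N : (n <= N)%N ->
  projl X b n N ∘ projr X c n N = projr X c n N ∘ projl X b n N.
Proof. by move=> hn; rewrite projlr_tenm // projrl_tenm. Qed.

Lemma projl_idem b n N : (n <= N)%N -> projl X b n N ∘ projl X b n N = projl X b n N.
Proof. by move=> hn; apply: is_proj_idem (projl_is_proj charK X b hn). Qed.

Lemma projr_idem b n N : (n <= N)%N -> projr X b n N ∘ projr X b n N = projr X b n N.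
Proof. by move=> hn; apply: is_proj_idem (projr_is_proj charK X b hn). Qed.

Lemma projlr_idem b c n N : (n <= N)%N ->
  (projl X b n N ∘ projr X c n N) ∘ (projl X b n N ∘ projr X c n N)
  = projl X b n N ∘ projr X c n N.
Proof.
move=> hn; rewrite {2}projlrC // -?compA (comp_pre _ (projr_idem _ _)) //.
by rewrite -projlrC // (comp_pre _ (projl_idem _ _)).
Qed.

Lemma kimg_projlr b c n N : (n <= N)%N ->
  kimg (projl X b n N ∘ projr X c n N) = kpow b n * kpow c (N - n).
Proof.
move=> hn; rewrite -kimg_ten ?proj_idem //.
have h := projlr_idem b c hn; move: h; rewrite projlr_tenm //.
move: (N - n)%N (subnKC hn) => m <- h.
apply: (@kimg_iso _ _ _ _ _ _ (juxtV X n m (n + m))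
  (juxt X n m (n + m) ∘ (proj X b n ⊠ proj X c m)) 1 1) => //.
- exact: proj_tenm_idem.
- exact: oner_neq0.
- exact: oner_neq0.
- by rewrite scale1r compA.
- by rewrite scale1r compA juxtK comp_idl.
Qed.

Variable N : nat.
Let a i := projl X true i N.
Let s i := projr X false i N.
Let Q i := a i ∘ s i.
Let T i := tr X N i.

Let ass i : (i < N)%N -> a i ∘ a i.+1 = a i.+1.
Proof.
move=> hi; apply: (is_proj_subl _ (projl_is_proj _ _ _ _) (projl_is_proj _ _ _ _));
  rewrite // 1?ltnW // => j /=; lia.
Qed.

Let aSa i : (i < N)%N -> a i.+1 ∘ a i = a i.+1.
Proof.
move=> hi; apply: (is_proj_subr _ (projl_is_proj _ _ _ _) (projl_is_proj _ _ _ _));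
  rewrite // 1?ltnW // => j /=; lia.
Qed.

Let ssS i : (i < N)%N -> s i ∘ s i.+1 = s i.
Proof.
move=> hi; apply: (is_proj_subr _ (projr_is_proj _ _ _ _) (projr_is_proj _ _ _ _));
  rewrite // 1?ltnW // => j /=; lia.
Qed.

Let sSs i : (i < N)%N -> s i.+1 ∘ s i = s i.
Proof.
move=> hi; apply: (is_proj_subl _ (projr_is_proj _ _ _ _) (projr_is_proj _ _ _ _));
  rewrite // 1?ltnW // => j /=; lia.
Qed.

Let aa i : (i <= N)%N -> a i ∘ a i = a i.
Proof. exact: projl_idem. Qed.
Let ss i : (i <= N)%N -> s i ∘ s i = s i.
Proof. exact: projr_idem. Qed.
Let asC i : (i <= N)%N -> a i ∘ s i = s i ∘ a i.
Proof. exact: projlrC. Qed.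

Lemma double_eq0 (V : lmodType K) (v : V) : v = - v -> v = 0.
Proof.
move=> /eqP; rewrite -subr_eq0 opprK -mulr2n -scaler_nat scaler_eq0.
by rewrite (negbTE (natr_neq0 charK 1)) => /eqP.
Qed.

(* The ranges of s i and a i.+2 share the adjacent factors i and i + 1. *)
Let sa0 i : (i.+1 < N)%N -> s i ∘ a i.+2 = 0.
Proof.
move=> hi; have [_ e _ _] := projr_is_proj charK X false (ltnW (ltnW hi)).
have [e' _ _ _] := projl_is_proj charK X true hi.
apply: double_eq0; rewrite -[s i in LHS]scale1r -[1 in LHS](expr0 (-1)).
rewrite -[_ *: s i](e i) /=; last by lia.
by rewrite -compA e' // compZr scaleN1r.
Qed.

Let as0 i : (i.+1 < N)%N -> a i.+2 ∘ s i = 0.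
Proof.
move=> hi; have [e _ _ _] := projr_is_proj charK X false (ltnW (ltnW hi)).
have [_ e' _ _] := projl_is_proj charK X true hi.
apply: double_eq0; rewrite -[s i in LHS]scale1r -[1 in LHS](expr0 (-1)).
rewrite -[_ *: s i](e i) /=; last by lia.
by rewrite compA e' // compZl scaleN1r.
Qed.

(* c i *: U i and c i *: V i are idempotents with isomorphic images, and Q i.+1 is
   the sum of c i.+1 *: U i.+1 and c i *: V i, so the alternating sum of the
   classes of the Q i telescopes. *)
Let U i := s i ∘ (a i.+1 ∘ s i).
Let V i := a i.+1 ∘ (s i ∘ a i.+1).
(** For [i < N], [s i ∘ a i.+1] is a normalized Young symmetrizer of the hook [(N - i, 1^i)], and
    its square is itself divided by [c i]. Here [1 / c i] is the product of the hook lengths,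
    [N (N - i - 1)! i!], divided by [(N - i)! (i + 1)!]. *)
Let c i : K := (N - i)%:R * i.+1%:R / N%:R.

Let QU i : (i < N)%N -> Q i ∘ U i = U i.
Proof.
move=> hi; have hi' := ltnW hi; rewrite /Q /U -?compA.
by rewrite (comp_pre _ (ss hi')) (comp_pre2 _ (asC hi')) (comp_pre _ (ass hi)).
Qed.

Let QV i : (i < N)%N -> Q i.+1 ∘ V i = V i.
Proof.
move=> hi; rewrite /Q /V -?compA.
by rewrite (comp_pre2 _ (esym (asC hi))) (comp_pre _ (aa hi)) (comp_pre _ (sSs hi)).
Qed.

Let UV0 i : (i.+1 < N)%N -> U i.+1 ∘ V i = 0.
Proof.
move=> hi; have hi' := ltnW hi; rewrite /U /V -?compA.
rewrite (comp_pre2 _ (esym (asC hi'))) (comp_pre _ (aSa hi)) (comp_pre _ (sSs hi')).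
by rewrite (comp_pre _ (as0 hi)) comp0l comp0r.
Qed.

Let VU0 i : (i.+1 < N)%N -> V i ∘ U i.+1 = 0.
Proof.
move=> hi; have hi' := ltnW hi; rewrite /U /V -?compA.
rewrite (comp_pre2 _ (asC hi')) (comp_pre _ (ass hi)) (comp_pre _ (ssS hi')).
by rewrite (comp_pre _ (sa0 hi)) comp0l comp0r.
Qed.

Let N0 i : (i < N)%N -> N%:R != 0 :> K.
Proof. by case: N => // n _; apply: natr_neq0. Qed.

(** Expanding [a i.+2] by [projlS] and [s i] by [projrS] gives the same cross term [W]. With
    [k = i.+1], the weights [(N - k) / N] and [k / N] add up to 1 and make [W] cancel. *)
Let QE i : (i.+1 < N)%N -> Q i.+1 = c i.+1 *: U i.+1 + c i *: V i.
Proof.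
move=> hi; have hi' := ltnW hi; have n0 := N0 hi.
set k := i.+1; pose W := a k ∘ (s k ∘ (T i ∘ (a k ∘ s k))).
have eU : k.+1%:R *: U k = Q k - k%:R *: W.
  rewrite /U -compZr -compZl /a projlS // -/(a k) -/(T i).
  rewrite compDl compDr !compZl !compZr -?compA (comp_pre2 _ (esym (asC hi'))).
  rewrite (comp_pre2 _ (esym (asC hi'))) (ss hi') -scaleNr.
  by rewrite /W /Q /sgnb mulrN1.
have eV : (N - i)%:R *: V i = Q k + (N - k)%:R *: W.
  have := projrS charK X false i (N - i.+1).
  have -> : (i + (N - i.+1).+1)%N = N by lia.
  have -> : (N - i.+1).+1 = (N - i)%N by lia.
  rewrite -/(s i) -/(s k) -/(T i) /sgnb mulr1 => e.
  rewrite /V -compZr -compZl e compDl compDr !compZl !compZr -?compA.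
  rewrite -(asC hi') (comp_pre _ (aa hi')) /W /Q.
  by have -> : (N - k = N - i.+1)%N by [].
have nN : N%:R = (N - k)%:R + k%:R :> K by rewrite -natrD; congr (_%:R); lia.
have -> : c k *: U k = ((N - k)%:R / N%:R) *: (Q k - k%:R *: W).
  by rewrite -eU scalerA /c mulrAC.
have -> : c i *: V i = (k%:R / N%:R) *: (Q k + (N - k)%:R *: W).
  by rewrite -eV scalerA /c -mulrA [_ * (_ / _)]mulrC.
rewrite !(scalerDr, scalerN, scalerA) addrACA -scalerDl -mulrDl -nN mulfV // scale1r.
rewrite [X in - (X *: _)](_ : _ = k%:R / N%:R * (N - k)%:R); last first.
  by rewrite mulrAC [_ * k%:R]mulrC mulrAC.
by rewrite addNr addr0.
Qed.

Let Q0E : (0 < N)%N -> Q 0 = c 0 *: U 0.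
Proof.
move=> hN; have n0 := N0 hN.
have a1 : a 1 = a 0.
  by have := projlS charK X true hN; rewrite mul0r scale0r addr0 scale1r.
have a01 : a 0 = idm _.
  have [_ _ h _] := projl_is_proj charK X true (leq0n N).
  by rewrite -[LHS]comp_idr h.
rewrite /Q /U a1 a01 !comp_idl (ss (leq0n N)) /c subn0 mulr1 mulfV // scale1r.
by [].
Qed.

Let QNE i : i.+1 = N -> Q i.+1 = c i *: V i.
Proof.
move=> hi; have hi' : (i < N)%N by lia.
have n0 := N0 hi'.
have sN : s i.+1 = idm _.
  have [_ _ h _] := projr_is_proj charK X false (eq_leq hi).
  by rewrite -[LHS]comp_idr h // => j; lia.
have si : s i = idm _.
  have [_ _ h _] := projr_is_proj charK X false (ltnW hi').
  by rewrite -[LHS]comp_idr h // => j; lia.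
rewrite /Q /V sN si comp_idl comp_idr (aa hi') /c.
have -> : (N - i = 1)%N by lia.
by rewrite mul1r hi mulfV // scale1r.
Qed.

Let QQ i : (i <= N)%N -> Q i ∘ Q i = Q i.
Proof. exact: projlr_idem. Qed.

(** For positive [i], [Q i] fixes [U i], while the other summand of [Q i] in [QE] kills it; hence
    idempotence without any computation with permutations. *)
Let uu i : (i < N)%N -> (c i *: U i) ∘ (c i *: U i) = c i *: U i.
Proof.
case: i => [|i] hi; first by rewrite -Q0E // QQ.
transitivity (Q i.+1 ∘ (c i.+1 *: U i.+1)); last by rewrite compZr QU.
by rewrite QE // compDl !(compZl, compZr) VU0 // !scaler0 addr0.
Qed.

Let vv i : (i < N)%N -> (c i *: V i) ∘ (c i *: V i) = c i *: V i.
Proof.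
move=> hi; have [e|ne] := eqVneq i.+1 N; first by rewrite -QNE // QQ.
have hi' : (i.+1 < N)%N by lia.
transitivity (Q i.+1 ∘ (c i *: V i)); last by rewrite compZr QV.
by rewrite QE // compDl !(compZl, compZr) UV0 // !scaler0 add0r.
Qed.

Let c0 i : (i < N)%N -> c i != 0.
Proof.
move=> hi; rewrite /c !mulf_neq0 ?invr_eq0 ?(N0 hi) ?(natr_neq0 charK) //.
by rewrite -(subnSK hi) natr_neq0.
Qed.

Let uv i : (i < N)%N -> kimg (c i *: U i) = kimg (c i *: V i).
Proof.
move=> hi; have hi' := ltnW hi.
apply: (@kimg_iso _ _ _ _ _ _ (a i.+1 ∘ s i) (s i ∘ a i.+1) (c i) (c i)).
- exact: uu.
- exact: vv.
- exact: c0.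
- exact: c0.
- by rewrite /U -?compA (comp_pre _ (aa hi)).
- by rewrite /V -?compA (comp_pre _ (ss hi')).
Qed.

(** The classes of the hooks [(N - i, 1^i)], extended by 0 at [i = N] so that the alternating sum
    telescopes to 0. *)
Let g i : K0 C := if (i < N)%N then kimg (c i *: U i) else 0.

Let kQS i : (i < N)%N -> kimg (Q i.+1) = g i.+1 + g i.
Proof.
move=> hi; rewrite /g hi; case: ltnP => hi'; last first.
  by rewrite add0r QNE ?uv //; lia.
rewrite (uv hi); apply: kimgD (QE hi'); rewrite ?uu ?vv // !(compZl, compZr).
  by rewrite UV0 // !scaler0.
by rewrite VU0 // !scaler0.
Qed.

Lemma koszul_sum : (0 < N)%N ->
  \sum_(i < N.+1) (-1) ^+ i * (kpow true i * kpow false (N - i)) = 0.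
Proof.
move=> hN; rewrite (eq_bigr (fun i : 'I_N.+1 => (-1) ^+ i * kimg (Q i))); last first.
  by move=> i _; rewrite kimg_projlr // -ltnS.
rewrite (@alternating_telescope _ (fun i => kimg (Q i)) g).
- by rewrite /g ltnn mulr0.
- by rewrite /g hN Q0E.
- exact: kQS.
Qed.

End Koszul.

(** * The Pluecker relation *)

(* The permutations preserving [0, k) are generated by the adjacent
   transpositions other than (k - 1, k). *)
Lemma perm_block_ind n k (Q : 'S_n -> Prop) :
  Q 1%g -> (forall s t, Q s -> Q t -> Q (s * t)%g) ->
  (forall a b : 'I_n, b = a.+1 :> nat -> b != k :> nat -> Q (tperm a b)) ->
  forall s : 'S_n, (forall x : 'I_n, (s x < k) = (x < k))%N -> Q s.
Proof.
move=> Q1 QM Qadj.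
have Qt (a b : 'I_n) : ((a < k) = (b < k))%N -> Q (tperm a b).
  wlog ab : a b / (a <= b)%N.
    case: (leqP a b) => [|/ltnW] h H hk; first exact: H.
    by rewrite tpermC; apply: H.
  move=> hk; apply: (@tperm_adj_ind _ Q (fun j => j.+1 != k)) => //.
  - by move=> c d cd cJ; apply: Qadj => //; rewrite cd.
  - by move=> j hj; apply/eqP; lia.
move=> s; move: {2}#|_| (leqnn #|[set x | s x != x]|) => d.
elim: d s => [|d IH] s hd sk.
  suff -> : s = 1%g by [].
  apply/permP => x; rewrite perm1; apply/eqP; apply: contraTT hd => sx.
  by rewrite -ltnNge; apply/card_gt0P; exists x; rewrite inE.
have [->|[x sx]] : s = 1%g \/ exists x, s x != x.
- case: (pickP (fun x => s x != x)) => [x sx|s1]; first by right; exists x.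
  by left; apply/permP => x; rewrite perm1; apply/eqP; move/negbFE: (s1 x).
- by [].
have xk : (x < k)%N = (s x < k)%N by rewrite sk.
have -> : s = ((s * tperm (s x) x) * tperm (s x) x)%g by rewrite -mulgA tperm2 mulg1.
apply: QM; last by apply: Qt; rewrite sk.
apply: IH => [|y]; last first.
  by rewrite permM; case: tpermP => [/perm_inj->|e|_ _]; rewrite ?sk // -e sk.
rewrite -ltnS; apply: leq_trans hd; apply: proper_card; apply/properP; split.
  apply/subsetP => y; rewrite !inE permM; apply: contraNneq => sy.
  rewrite sy tpermD //; apply: contraNneq sx => e; last by rewrite e sy.
  by apply/eqP/(@perm_inj _ s); rewrite e sy.
by exists x; rewrite !inE ?permM ?tpermL ?eqxx.
Qed.

Definition block_swap_nat i k x : nat :=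
  if (x < k)%N then (x + i)%N else if (i <= x < i + k)%N then (x - i)%N else x.

Lemma block_swap_natS i k x (w := block_swap_nat i k x) : (k < i)%N ->
  block_swap_nat i k.+1 x
  = if w == k then (i + k)%N else if w == (i + k)%N then k else w.
Proof.
rewrite /w /block_swap_nat {w}; case: (ltnP x k) => h1; case: (ltnP x k.+1) => h2;
  case: (leqP i x) => h3; case: (ltnP x (i + k)) => h4;
  case: (ltnP x (i + k.+1)) => h5 /= hk; try (exfalso; lia);
  do ![case: eqVneq => ?]; lia.
Qed.

HB.lock Definition projlr (K : fieldType) (C : tensorCategory K) (X : C) (b : bool)
    (n N : nat) : Hom (tpow X N) (tpow X N) :=
  projl X b n N ∘ projr X b n N.

Section Pluecker.
Variables (K : fieldType) (charK : [pchar K] =i pred0).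
Variables (C : rigidTensorCategory K) (X : C) (b : bool).
Local Notation T := (tpow X).
Local Notation rho := (@perm_act K C X _).
Variables (i p N : nat).
Hypothesis NE : N = (i + p)%N.
Hypothesis ip : (i <= p)%N.
Hypothesis p1 : proj X b p.+1 = 0.

Let E := projlr X b i N.
Lemma leq_block : (i <= N)%N. Proof. by rewrite NE leq_addr. Qed.

Let iN := leq_block.

Let EE : E ∘ E = E. Proof. by rewrite /E projlr.unlock; exact: projlr_idem. Qed.

Let E_adj (x y : 'I_N) : y = x.+1 :> nat -> y != i :> nat ->
  E ∘ rho (tperm x y) = sgnb b *: E /\ rho (tperm x y) ∘ E = sgnb b *: E.
Proof.
have [l1 l2 _ _] := projl_is_proj charK X b iN.
have [r1 r2 _ _] := projr_is_proj charK X b iN.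
move=> xy yi; rewrite !perm_act_tperm // /E projlr.unlock; have hy := ltn_ord y.
case: (ltnP y i) => h.
  split; last by rewrite compA l1 ?compZl //; lia.
  by rewrite projlrC // -compA l2 ?compZr //; lia.
split; first by rewrite -compA r2 ?compZr //; lia.
by rewrite projlrC // compA r1 ?compZl //; lia.
Qed.

Let E_absr (s : 'S_N) : (forall x : 'I_N, (s x < i) = (x < i))%N -> E ∘ rho s = epsb b s *: E.
Proof.
apply: (perm_block_ind (Q := fun s : 'S_N => E ∘ rho s = epsb b s *: E)).
- by rewrite perm_act1 comp_idr epsb1 scale1r.
- move=> s' t hs ht; rewrite perm_actM compA ht compZl hs scalerA epsbM.
  by rewrite mulrC.
- move=> x y xy yi; have [-> _] := E_adj xy yi; rewrite epsb_tperm //.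
  by rewrite -val_eqE /=; lia.
Qed.

Let E_absl (s : 'S_N) : (forall x : 'I_N, (s x < i) = (x < i))%N -> rho s ∘ E = epsb b s *: E.
Proof.
apply: (perm_block_ind (Q := fun s : 'S_N => rho s ∘ E = epsb b s *: E)).
- by rewrite perm_act1 comp_idl epsb1 scale1r.
- move=> s' t hs ht; rewrite perm_actM -compA hs compZr ht scalerA epsbM.
  by [].
- move=> x y xy yi; have [_ ->] := E_adj xy yi; rewrite epsb_tperm //.
  by rewrite -val_eqE /=; lia.
Qed.

Let same_block (x y : 'I_N) : ((x < i) = (y < i))%N ->
  forall z : 'I_N, ((tperm x y z < i) = (z < i))%N.
Proof. by move=> xy z; case: tpermP => [->|->|]. Qed.

(* The sum over coset representatives of the stabilizer of a in the symmetric
   group of a together with the second block: a multiple of the projector on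
   p + 1 factors. *)
Let R (a : 'I_N) := \sum_(l : 'I_N | (l == a) || (i <= l)%N)
  epsb b (tperm a l) *: (E ∘ rho (tperm a l)).

(** Here [a] and the second block are [p + 1] consecutive factors. [R a] has the symmetry of their
    projector, hence is absorbed by it, and this projector vanishes by [p1]. *)
Let R_last (a : 'I_N) : a.+1 = i -> R a = 0.
Proof.
move=> ai; have aN : (a <= N)%N by rewrite ltnW.
have [_ _ _ abs] := projr_is_proj charK X b aN.
have pr0 : projr X b a N = 0.
  rewrite projr.unlock; have -> : (N - a = p.+1)%N by lia.
  by rewrite p1 tenm0r comp0l comp0r.
rewrite -(abs _ (R a)) ?pr0 ?comp0r // => j hj.
have hjN : (j.+1 < N)%N by lia.
pose x := Ordinal (ltnW hjN); pose y := Ordinal hjN.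
have hx : x != y by rewrite -val_eqE /=; lia.
have -> : tr X N j = rho (tperm x y) by rewrite perm_act_tperm.
rewrite comp_suml scaler_sumr (reindex_inj (@perm_inj _ (tperm x y))) /=.
have inS (l : 'I_N) : ((l == a) || (i <= l))%N = (a <= l)%N.
  by rewrite -val_eqE /=; lia.
have inSt (l : 'I_N) : (a <= tperm x y l)%N = (a <= l)%N.
  by case: tpermP => [->|->|] //=; lia.
apply: eq_big => [l|l]; first by rewrite !inS inSt.
rewrite inS inSt => hl; set t := tperm x y.
rewrite compZl -compA -perm_actM.
(* The discrepancy between [t] and a permutation of the coset representatives. It fixes the first
   block pointwise, so [E] absorbs it up to sign. *)
pose g := (tperm a l * t * tperm a (t l))%g.
have gfix (z : 'I_N) : (z < i)%N -> g z = z.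
  move=> zi; rewrite /g !permM; have [->|za] := eqVneq z a.
    by rewrite tpermL tpermR.
  have zx : x != z by move: za; rewrite -!val_eqE /=; lia.
  have zy : y != z by move: za; rewrite -!val_eqE /=; lia.
  have zl : l != z by move: za; rewrite -!val_eqE /=; lia.
  have az : a != z by rewrite eq_sym.
  rewrite [tperm a l z]tpermD // [t z]tpermD // tpermD //.
  by rewrite -[z](@tpermD _ x y) // (inj_eq perm_inj).
have gi (z : 'I_N) : ((g z < i) = (z < i))%N.
  case: (ltnP z i) => zi; first by rewrite gfix.
  apply/negbTE; rewrite -leqNgt leqNgt; apply/negP => gz.
  by move: (gfix _ gz) => /perm_inj e; move: zi; rewrite -e leqNgt gz.
have -> : (t * tperm a (t l))%g = (tperm a l * g)%g.
  by rewrite /g !mulgA tperm2 mul1g.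
rewrite perm_actM compA E_absr // compZl !scalerA; congr (_ *: _).
rewrite /g !epsbM (epsb_tperm _ _ hx) mulrC -!mulrA epsbK mulr1 mulrC.
by [].
Qed.

(** Conjugation by [tperm a a0] preserves the first block, so [E] absorbs it; it carries [R a0] to
    [R a], up to sign. *)
Let R0 (a : 'I_N) : (a < i)%N -> R a = 0.
Proof.
move=> ai; have hi : (i.-1 < N)%N by lia.
pose a0 := Ordinal hi; have a0i : a0.+1 = i by rewrite /=; lia.
have [->|ne] := eqVneq a a0; first exact: R_last.
have ti : forall z : 'I_N, ((tperm a a0 z < i) = (z < i))%N.
  by apply: same_block; rewrite /=; lia.
have Et : E ∘ rho (tperm a a0) = epsb b (tperm a a0) *: E by exact: E_absr.
transitivity (epsb b (tperm a a0) *: (R a0 ∘ rho (tperm a a0))); last first.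
  by rewrite R_last // comp0l scaler0.
set t := tperm a a0 in ti Et *.
rewrite /R comp_suml scaler_sumr (reindex_inj (@perm_inj _ t)) /=.
have ta0 : t a0 = a by rewrite /t tpermR.
apply: eq_big => [l|l _].
  rewrite -{1}ta0 (inj_eq perm_inj); congr (_ || _).
  by rewrite leqNgt ti -leqNgt.
have -> : tperm a (t l) = (t * tperm a0 l * t)%g.
  by rewrite -{1}ta0 -tpermJ /conjg mulgA /t tpermV.
rewrite !perm_actM compZl !compA Et !compZl !scalerA !epsbM.
by rewrite -[X in X *: _]mulrA epsbK mulr1.
Qed.

Let F (s : 'S_N) := E ∘ (rho s ∘ E).

(** Up to sign, [F] depends only on the double coset modulo the permutations preserving both blocks,
    that is, on the number of factors exchanged between them. *)
Let F_block (s g h : 'S_N) :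
  (forall x : 'I_N, (g x < i) = (x < i))%N -> (forall x : 'I_N, (h x < i) = (x < i))%N ->
  F (g * s * h)%g = (epsb b g * epsb b h) *: F s.
Proof.
move=> hg hh; rewrite /F !perm_actM -?compA (E_absl hg) compA (E_absr hh).
by rewrite !(compZl, compZr) scalerA mulrC.
Qed.

Lemma block_ord k (hk : (k < i)%N) : (k < N)%N /\ (i + k < N)%N.
Proof. by lia. Qed.

(* Exchanges the first k factors with the k factors following the first i. *)
Fixpoint block_swap k : 'S_N :=
  if k is k'.+1 then
    match ltnP k' i with
    | LtnNotGeq hk => (block_swap k' * tperm (Ordinal (proj1 (block_ord hk)))
                                     (Ordinal (proj2 (block_ord hk))))%g
    | _ => block_swap k'
    end
  else 1%g.

Let block_swapS k (x y : 'I_N) : x = k :> nat -> y = (i + k)%N :> nat -> (k < i)%N ->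
  block_swap k.+1 = (block_swap k * tperm x y)%g.
Proof.
move=> xk yk hk /=; case: (ltnP k i) => [hk'|]; last by rewrite leqNgt hk.
by congr (_ * tperm _ _)%g; apply/val_inj => /=; lia.
Qed.

Lemma block_swapE k (x : 'I_N) : (k <= i)%N ->
  block_swap k x = block_swap_nat i k x :> nat.
Proof.
elim: k x => [|k IH] x hk.
  by rewrite perm1 /block_swap_nat ltn0 addn0 ltnNge andbN.
have [h1 h2] := block_ord hk.
rewrite (@block_swapS k (Ordinal h1) (Ordinal h2)) // permM.
rewrite block_swap_natS // -IH 1?ltnW // permE /= -!val_eqE /=.
by do ?[case: ifP => _].
Qed.

Let Fs k := F (block_swap k).

Let block_swap_fix k (x : 'I_N) : (k <= i)%N -> (i + k <= x)%N -> block_swap k x = x.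
Proof.
move=> hk hx; apply/val_inj; rewrite [LHS]block_swapE // /block_swap_nat.
by rewrite ltnNge (leq_trans _ hx) ?leq_addl //= andbC ltnNge hx.
Qed.

(* Expansion of R k ∘ block_swap k ∘ E: among the transpositions (k, l), those
   with l not yet exchanged produce block_swap k.+1, the others are absorbed. *)
Lemma block_swap_rec k : (k < i)%N ->
  k.+1%:R *: Fs k + ((p - k)%:R * sgnb b) *: Fs k.+1 = 0.
Proof.
move=> hk; have [h1 h2] := block_ord hk; have hk' := ltnW hk.
pose a := Ordinal h1; pose a' := Ordinal h2.
have term (l : 'I_N) : (i <= l)%N ->
    epsb b (tperm a l) *: (E ∘ rho (tperm a l) ∘ (rho (block_swap k) ∘ E))
    = if (l < i + k)%N then Fs k else sgnb b *: Fs k.+1.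
  move=> hl; have al : a != l by rewrite -val_eqE /=; lia.
  rewrite -?compA (compA (rho (tperm a l))) -perm_actM -/(F _) epsb_tperm //.
  case: ltnP => hlk.
    have hm : (l - i < N)%N by lia.
    (* The factor of the first block that [block_swap k] has moved to [l]: the transposition of [a]
       and [l] is conjugate to one inside the first block. *)
    pose m := Ordinal hm.
    have bm : block_swap k m = l.
      by apply/val_inj; rewrite [LHS]block_swapE // /block_swap_nat /=; case: ltnP; lia.
    have ba : block_swap k a = a.
      by apply/val_inj; rewrite [LHS]block_swapE // /block_swap_nat /= ltnn leqNgt hk.
    have -> : (block_swap k * tperm a l = tperm a m * block_swap k * 1)%g.
      by rewrite mulg1 -{1}ba -bm -tpermJ /conjg mulgA mulgV mul1g.
    have am : a != m by rewrite -val_eqE /=; lia.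
    rewrite F_block ?epsb1 ?mulr1 ?epsb_tperm ?scalerA ?sgnbK ?scale1r // => z.
      by apply: same_block; rewrite /=; lia.
    by rewrite perm1.
  congr (_ *: _); rewrite /Fs (@block_swapS k a a') //.
  have hl' : (i <= a')%N by rewrite /= leq_addr.
  have [->//|ne] := eqVneq l a'.
  have cb : (block_swap k * tperm a l
      = tperm l a' * (block_swap k * tperm a a') * tperm l a')%g.
    have e1 : (block_swap k * tperm l a' = tperm l a' * block_swap k)%g.
      have := tpermJ l a' (block_swap k); rewrite !block_swap_fix //=; last first.
      by rewrite /conjg => e; rewrite -{1}e !mulgA mulgV mul1g.
    have := tpermJ a a' (tperm l a'); rewrite tpermR tpermD; last first.
    - by rewrite -val_eqE /=; lia.
    - by rewrite eq_sym.
    by rewrite /conjg tpermV => <-; rewrite !mulgA e1.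
  rewrite cb F_block ?epsbK ?scale1r // => z.
    by apply: same_block; rewrite !ltnNge hl hl'.
  by apply: same_block; rewrite !ltnNge hl hl'.
have := congr1 (fun h => h ∘ (rho (block_swap k) ∘ E)) (R0 (a := a) hk).
rewrite comp0l /R comp_suml (bigD1 a) ?eqxx //= tperm1 epsb1 scale1r.
rewrite perm_act1 comp_idr -/(F _) -/(Fs k) => h.
rewrite -[RHS]h mulrSr scalerDl scale1r [k%:R *: _ + _]addrC -addrA; congr (_ + _).
pose G (l : nat) := if (l < i + k)%N then Fs k else sgnb b *: Fs k.+1.
rewrite (eq_bigl (fun l : 'I_N => i <= l)%N); last first.
  move=> l; rewrite -val_eqE /=; lia.
rewrite (eq_bigr (fun l : 'I_N => G l)); last by move=> l hl; rewrite compZl term.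
rewrite -(big_mkord (fun l => i <= l)%N G) -(big_nat_widenl i 0 N predT) //.
rewrite (@big_cat_nat _ _ _ (i + k)) /=; [|lia|lia].
rewrite (eq_big_nat _ _ (F2 := fun=> Fs k)); last by move=> l /andP[_ hl]; rewrite /G hl.
rewrite [X in _ = _ + X](eq_big_nat _ _ (F2 := fun=> sgnb b *: Fs k.+1)); last first.
  by move=> l /andP[hl _]; rewrite /G ltnNge hl.
rewrite !sumr_const_nat addKn -!scaler_nat scalerA.
by have -> : (N - (i + k) = p - k)%N by lia.
Qed.

(** Each step of [block_swap_rec] multiplies the scalar by [- (k + 1) / ((p - k) sgnb b)], where
    [k < i <= p]; in all this gives [(- sgnb b)^i / 'C(p, i)]. *)
Lemma pluecker : exists2 c : K, c != 0 &
  E ∘ (rho (block_swap i) ∘ E) = c *: E.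
Proof.
suff H k : (k <= i)%N -> exists2 c : K, c != 0 & Fs k = c *: E by apply: H.
elim: k => [|k IH] hk.
  exists 1; first exact: oner_neq0.
  by rewrite scale1r /Fs /F [block_swap 0]/= perm_act1 comp_idl EE.
have [c c0 e] := IH (ltnW hk).
have d0 : (p - k)%:R * sgnb b != 0 :> K.
  rewrite mulf_neq0 ?sgnb_neq0 //.
  rewrite (_ : p - k = (p - k).-1.+1)%N; [exact: natr_neq0 | by lia].
exists (- (k.+1%:R * c) / ((p - k)%:R * sgnb b)).
  by apply: mulf_neq0; rewrite ?invr_eq0 // oppr_eq0 mulf_neq0 //; exact: natr_neq0.
apply: (scalerI d0); rewrite scalerA mulrCA mulfV // mulr1 scaleNr -[in RHS]scalerA -e.
by apply/eqP; rewrite -addr_eq0 addrC block_swap_rec.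
Qed.

End Pluecker.

(** * Powers of the dual object *)

Section BlockSwap.
Variables (K : fieldType) (C : tensorCategory K) (X : C).
Local Notation T := (tpow X).

Lemma juxt_sw1 j M N : N = (j + M)%N ->
  juxt X j M.+1 N.+1 ∘ sw X (T j) (T M) = insert_factor X N j ∘ (X ◁ juxt X j M N).
Proof.
elim: j N => [|j IH] N eN.
  rewrite {}eN add0n ins0 comp_idl /= !tpow_cast_id wh_id !comp_idl.
  exact: sw_one.
case: N eN => // N eN.
have eN' : N = (j + M)%N by lia.
rewrite [juxt X j.+1 M.+1 _]/= [juxt X j.+1 M _]/= -compA sw_hexr.
rewrite (comp_pre _ (whl _ (IH _ eN'))) insS tenm_compr -?compA tenm_compr.
by rewrite (comp_pre2 _ (esym (sw_wh _ _ _))).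
Qed.

(** Identifies the crossing of two whole blocks with the action of a permutation, so that
    [pluecker], which is about permutations, applies to [sw]. *)
Lemma juxt_sw i j m N : N = (i + (j + m))%N ->
  exists2 s : 'S_N, (forall k : 'I_N, s k = (if k < i then k + j
      else if k < i + j then k - i else k)%N :> nat) &
  juxt X j (i + m) N ∘ ((T j ◁ juxt X i m (i + m)) ∘ sw (T i) (T j) (T m))
  = perm_act X s ∘ (juxt X i (j + m) N ∘ (T i ◁ juxt X j m (j + m))).
Proof.
elim: i N => [|i IH] N eN.
  exists 1%g => [k|]; first by rewrite perm1 add0n subn0 if_same.
  rewrite perm_act1 comp_idl eN /= tpow_cast_id tpow_cast_id !comp_idl sw_oneV.
  by rewrite lun_nat.
case: N eN => // N [eN]; have [s hs e] := IH _ eN.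
have hj : (j < N.+1)%N by lia.
exists (lift_perm ord0 (Ordinal hj) s) => [k|].
  have [[k' ->]|->] : (exists k' : 'I_N, k = lift ord0 k') \/ k = ord0.
  - by case: (unliftP ord0 k) => [k'|] ->; [left; exists k' | right].
  - rewrite lift_perm_lift /= hs /bump leq0n add1n addSn !ltnS subSS.
    by case: (ltnP k' i) => h1; case: (ltnP k' (i + j)) => h2; lia.
  - by rewrite lift_perm_id.
rewrite perm_act_lift /= !tenm_compr -?compA.
rewrite sw_hexl (comp_pre2 _ (esym (sw_wh _ _ _))).
have eN' : N = (j + (i + m))%N by lia.
rewrite (comp_pre2 _ (juxt_sw1 eN')) -?compA.
have := congr1 (fun h => X ◁ h) e; rewrite !tenm_compr -?compA => e'.
rewrite (comp_pre3 _ e') -?compA; congr (_ ∘ (_ ∘ (_ ∘ _))).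
by rewrite -[idm (X ⊗ T i)]tenm_id assoc_nat.
Qed.
End BlockSwap.

Section Duality.
Variables (K : fieldType) (charK : [pchar K] =i pred0).
Variables (C : rigidTensorCategory K) (X : C) (b : bool).
Let D := dual X.
Local Notation T := (tpow X).
Local Notation P := (proj X b).

(** Because of the crossing built into [pairing_ten], factors in equal positions are paired and no
    reversal of the order occurs. *)
Fixpoint tpairing n : pairing (T n) (tpow D n) :=
  if n is n'.+1 then pairing_ten (pairing_dual X) (tpairing n') else pairing_one C.

Lemma transposed_tr n j : transposed (tpairing n) (tr D n j) (tr X n j).
Proof.
elim: n j => [|n IH] j; first by case: j => [|j] Z; rewrite /= !tenm_id.
case: j => [|j].
  case: n IH => [|n] IH; first by move=> Z; rewrite /= !tenm_id.
  exact: transposed_sw.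
rewrite !trS; exact: transposed_tenr (IH j).
Qed.

Lemma transposedM (A B : C) (p : pairing A B) (e' f' : Hom B B) (e f : Hom A A) :
  transposed p e' e -> transposed p f' f -> transposed p (e' ∘ f') (f ∘ e).
Proof.
move=> ee ff Z; rewrite tenm_compl (comp_pre _ (ee Z)) -?compA wh_swap.
by rewrite (comp_pre _ (ff Z)) -?compA -tenm_compr -tenm_compl.
Qed.

Lemma transposed_sum (A B : C) (p : pairing A B) (I : finType) (e' : I -> Hom B B)
    (e : I -> Hom A A) (c : I -> K) :
  (forall i, transposed p (e' i) (e i)) ->
  transposed p (\sum_i c i *: e' i) (\sum_i c i *: e i).
Proof.
move=> ee Z; rewrite !tenm_suml tenm_sumr !comp_sumr; apply: eq_bigr => i _.
by rewrite !tenmZl tenmZr !compZr ee.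
Qed.

Lemma transposed_act n (s : 'S_n) :
  transposed (tpairing n) (perm_act D s^-1)%g (perm_act X s).
Proof.
elim/perm_adj_ind: s => [|s i j ij IH].
  by rewrite invg1 !perm_act1 => Z; rewrite !tenm_id.
rewrite invMg tpermV !perm_actM; apply: transposedM => //.
by rewrite !perm_act_tperm //; exact: transposed_tr.
Qed.

(** Transposition turns [s] into its inverse, which has the same sign, so the average is
    preserved. *)
Lemma transposed_proj n : transposed (tpairing n) (proj D b n) (P n).
Proof.
move=> Z; rewrite !proj.unlock /average !tenmZl tenmZr !compZr; congr (_ *: _).
rewrite (reindex_inj invg_inj) /=.
rewrite (eq_bigr (fun s : 'S_n => epsb b s *: perm_act D s^-1)); last first.
  by move=> s _; rewrite /epsb odd_permV.
by apply: transposed_sum => s; exact: transposed_act.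
Qed.

Variable chi : K.
Hypothesis trX : trace (idm X) = chi *: idm 𝟙.

(** Take the partial trace of [projS]: the first term closes a loop and contributes [chi], the
    second closes one strand of a crossing and contributes [n sgnb b]. *)
Lemma ptr_projS n :
  ptr (pairing_dual X) (P n.+1) = ((chi + n%:R * sgnb b) / n.+1%:R) *: P n.
Proof.
apply: (scalerI (natr_neq0 charK n)).
rewrite -ptrZ projS // ptrD ptrZ scalerA mulrCA mulfV ?natr_neq0 // mulr1 scalerDl.
have := ptr_wh (pairing_dual X) (P n) (idm _) (idm _).
rewrite wh_id !comp_idr => ->; rewrite (ptr_dual_id _ trX) compZr comp_idr.
congr (_ + _); case: n => [|n]; first by rewrite mul0r !scale0r.
by rewrite (ptr_wh _ (P n.+1) _ (P n.+1)) ptr_dual_sw comp_idl proj_idem.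
Qed.

Lemma ptr_proj i m : (forall n, (m <= n < i + m)%N -> chi + n%:R * sgnb b != 0) ->
  exists2 c : K, c != 0 &
  ptr (tpairing i) (juxtV X i m (i + m) ∘ (P (i + m) ∘ juxt X i m (i + m))) = c *: P m.
Proof.
elim: i => [|i IH] hm.
  exists 1; first exact: oner_neq0.
  rewrite scale1r /= ptr_one !tpow_cast_id !comp_idl !comp_idr -?compA.
  by rewrite !lunVK comp_idr compA lunVK comp_idl.
have [|c c0 e] := IH; first by move=> n hn; apply: hm; lia.
exists (c * ((chi + (i + m)%:R * sgnb b) / (i + m).+1%:R)).
  by rewrite !mulf_neq0 ?invr_eq0 ?natr_neq0 //; apply: hm; lia.
rewrite /= ptr_ten -?compA assocVK comp_idr (comp_pre _ (assocVK _ _ _)) comp_idl.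
rewrite ptr_wh ptr_projS compZl compZr ptrZ e scalerA mulrC.
by [].
Qed.

Lemma proj_zeroS n m : (n <= m)%N -> P n = 0 -> P m = 0.
Proof.
move=> /subnK <-; elim: (m - n)%N => // k IH /IH h.
rewrite addSn; apply: (scalerI (natr_neq0 charK (k + n))).
by rewrite projS // h tenm0r comp0l scaler0 addr0 scaler0.
Qed.

Lemma proj0_neq0 : P 0 != 0.
Proof.
have [_ _ h _] := proj_is_proj charK X b 0.
have -> : P 0 = idm _ by rewrite -[LHS]comp_idr h.
exact: idm_one_neq0.
Qed.

Lemma proj_zero_chi N : P N = 0 ->
  exists2 p : nat, chi = - (p%:R * sgnb b) & P p.+1 = 0.
Proof.
move=> hN; have ex : exists n, P n == 0 by exists N; apply/eqP.
case: (ex_minnP ex) => -[|p] /eqP hp pmin; first by have := proj0_neq0; rewrite hp eqxx.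
exists p => //; apply/eqP; rewrite -addr_eq0.
have pn0 : P p != 0 by apply/negP => /pmin; rewrite ltnn.
have := ptr_projS p; rewrite hp /ptr tenm0r comp0l comp0r => /esym/eqP.
by rewrite scaler_eq0 (negbTE pn0) orbF mulf_eq0 invr_eq0 (negbTE (natr_neq0 charK p)) orbF.
Qed.

Variable p : nat.
Hypothesis chip : chi = - (p%:R * sgnb b).
Hypothesis pS0 : P p.+1 = 0.

Lemma chi_neq0 n : (n < p)%N -> chi + n%:R * sgnb b != 0.
Proof.
move=> np; rewrite chip -(subnK (ltnW np)) natrD mulrDl opprD addrNK oppr_eq0.
by rewrite mulf_neq0 ?sgnb_neq0 // -(subnSK np) natr_neq0.
Qed.

Section Contraction.
Variables (i m : nat).
Hypothesis pE : p = (i + m)%N.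
Let ph := juxt X i m p.
Let phV := juxtV X i m p.
Let phK : phV ∘ ph = idm _. Proof. by rewrite /ph /phV pE juxtK. Qed.
Let phVK : ph ∘ phV = idm _. Proof. by rewrite /ph /phV pE juxtVK. Qed.

Let lP : ph ∘ ((P i ⊠ idm _) ∘ (phV ∘ P p)) = P p.
Proof.
rewrite [LHS](_ : _ = projl X b i p ∘ P p).
  apply: (is_proj_subl _ (projl_is_proj _ _ _ _) (proj_is_proj _ _ _ _)) => //.
    by move=> j /=; lia.
  by rewrite pE leq_addr.
rewrite projl.unlock; have -> : (p - i = m)%N by rewrite pE addKn.
by rewrite -?compA.
Qed.

Let Pl : P p ∘ (ph ∘ ((P i ⊠ idm _) ∘ phV)) = P p.
Proof.
rewrite [LHS](_ : _ = P p ∘ projl X b i p).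
  apply: (is_proj_subr _ (projl_is_proj _ _ _ _) (proj_is_proj _ _ _ _)) => //.
    by move=> j /=; lia.
  by rewrite pE leq_addr.
rewrite projl.unlock; have -> : (p - i = m)%N by rewrite pE addKn.
by [].
Qed.

Let phVP : (P i ⊠ idm _) ∘ (phV ∘ P p) = phV ∘ P p.
Proof. by rewrite -[in RHS]lP (comp_pre _ phK) comp_idl. Qed.

Let Pph : P p ∘ (ph ∘ (P i ⊠ idm _)) = P p ∘ ph.
Proof. by rewrite -[in RHS]Pl -?compA phK comp_idr. Qed.

(** The exchange of a free block [T i] with the first [i] factors of [T p], between two copies of
    [P p], in the form to which [bend_sw] applies. *)
Let w := (T i ◁ (P p ∘ ph)) ∘ (sw (T i) (T i) (T m) ∘ (T i ◁ (phV ∘ P p))).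

(** [P i] on the free block passes through the crossing to the first [i] factors of [T p], where
    [P p] absorbs it. *)
Let w_absorb : (P i ⊠ idm _) ∘ (w ∘ (P i ⊠ idm _)) = w.
Proof.
rewrite /w; have hg := phVP; have hf := Pph; rewrite compA in hf.
set f := P p ∘ ph in hf *; set g := phV ∘ P p in hg *.
rewrite -?compA [(T i ◁ g) ∘ _]wh_swap -[idm (T i ⊗ T m)]tenm_id.
rewrite (comp_pre2 _ (sw_nat _ _ _)) (comp_pre _ (whl _ hf)).
rewrite (comp_pre2 _ (esym (wh_swap _ _))) -[idm (T i ⊗ T m)]tenm_id.
by rewrite (comp_pre2 _ (esym (sw_nat _ _ _))) -tenm_compr hg.
Qed.

Let w_scalar : exists2 c : K, c != 0 & w = c *: (P i ⊠ P p).
Proof.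
pose N := (i + p)%N; have NE : N = (i + p)%N by [].
have ip : (i <= p)%N by rewrite pE leq_addr.
have [c c0] := pluecker charK NE ip pS0.
have [|s hs e] := @juxt_sw K C X i i m N; first by rewrite NE pE.
have -> : block_swap NE ip i = s.
  apply/permP => k; apply/val_inj; rewrite /= block_swapE // hs /block_swap_nat.
  by case: (ltnP k i) => // h; rewrite h.
move=> h; exists c => //.
have iN : (i <= N)%N by rewrite NE leq_addr.
have Np : (N - i = p)%N by rewrite NE addKn.
move: h; rewrite projlr.unlock projlr_tenm // Np.
set J := juxt X i p N; set JV := juxtV X i p N.
have JK : JV ∘ J = idm _ by exact: juxtK.
have JVK : J ∘ JV = idm _ by exact: juxtVK.
have rJ : perm_act X s ∘ J = J ∘ ((T i ◁ ph) ∘ (sw (T i) (T i) (T m) ∘ (T i ◁ phV))).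
  have := congr1 (fun h => h ∘ (T i ◁ phV)) e; rewrite -?compA -!pE -/ph -/J => ->.
  by rewrite -tenm_compr phVK wh_id comp_idr.
move/(congr1 (fun h => JV ∘ (h ∘ J))); rewrite !(compZl, compZr) -?compA JK.
rewrite !(comp_pre _ JK) !comp_idl !comp_idr (comp_pre _ rJ) -?compA (comp_pre _ JK) comp_idl.
have Pr : P i ⊠ P p = (P i ⊠ idm _) ∘ (T i ◁ P p) by rewrite -tenm_comp comp_idl comp_idr.
have Pr' : P i ⊠ P p = (T i ◁ P p) ∘ (P i ⊠ idm _) by rewrite -tenm_comp comp_idl comp_idr.
rewrite {1}Pr {1}Pr' -?compA => <-.
by rewrite -[LHS]w_absorb /w !tenm_compr -?compA.
Qed.

Lemma img_contraction : img (proj D b i) ⊗ img (P p) ≅ img (P m).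
Proof.
have [c c0 wE] := w_scalar.
have [|d d0 dE] := @ptr_proj i m.
  by move=> n hn; apply: chi_neq0; rewrite pE; lia.
apply: iso_trans (iso_sym (img_ten _ _)) _; rewrite ?proj_idem //.
(* [x] contracts the dual block with the first [i] factors of [P p], and [y] is its mirror image. By
   [bend_sw], [y ∘ x] is the bend of [w]; [x ∘ y] is the partial trace of [ptr_proj]. *)
pose x := eps (tpairing i) (T m) ∘ (_ ◁ (phV ∘ P p)).
pose y := (_ ◁ (P p ∘ ph)) ∘ eta (tpairing i) (T m).
apply: (@img_iso _ _ _ _ _ _ x y c^-1 d^-1); rewrite ?invr_eq0 ?proj_idem //.
- by rewrite -tenm_comp !proj_idem.
- apply: (scalerI c0); rewrite scalerA mulfV // scale1r.
  have := congr1 (fun h => bend (tpairing i) h) wE.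
  rewrite bendZ (bend_tenm _ (transposed_proj i)) => <-.
  by rewrite /w bend_sw /x /y -?compA.
- apply: (scalerI d0); rewrite scalerA mulfV // scale1r -dE /ptr /x /y -?compA.
  rewrite (comp_pre _ (esym (tenm_compr _ _ _))) -?compA (comp_pre _ (proj_idem _ _ _ _)) //.
  by rewrite -!pE.
Qed.
End Contraction.

Lemma kpow_contraction i : (i <= p)%N ->
  kpow D b i * kpow X b p = kpow X b (p - i).
Proof.
by move=> ip; rewrite -K0_classM; apply/K0_iso/img_contraction; rewrite subnKC.
Qed.

Lemma img_proj0 : img (P 0) ≅ 𝟙.
Proof.
have [_ _ h _] := proj_is_proj charK X b 0.
have -> : P 0 = idm (T 0) by rewrite -[LHS]comp_idr h.
exact: img_id.
Qed.

Lemma img_top_inverse : is_inverse (img (P p)) (img (proj D b p)).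
Proof.
apply: iso_trans (tenC _ _) (iso_trans (img_contraction _) img_proj0).
by rewrite addn0.
Qed.

(** The projector of the dual is the bend of the projector of [X]. *)
Lemma proj_dual_zero n : P n = 0 -> proj D b n = 0.
Proof.
move=> z; apply: ten_one_inj; rewrite -(bend_tenm _ (transposed_proj n)) z !tenm0l.
by rewrite /bend !tenm0r comp0l comp0r.
Qed.

End Duality.

(** * The dual of a direct sum *)

Section DualSum.
Variables (K : fieldType) (C : rigidTensorCategory K).
Implicit Types X Y Z A W : C.

Lemma curry_ev A X (h : Hom A (dual X)) : curry (ev X ∘ (h ⊠ idm X)) = h.
Proof.
rewrite /curry !tenm_compl -?compA (comp_pre2 _ (esym (assocV_nat _ _ _))) tenm_id.
rewrite (comp_pre2 _ (esym (wh_swap _ _))) runV_nat.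
have := congr1 (fun g => g ∘ h) (zagzig X).
by rewrite -?compA comp_idl.
Qed.

Lemma ev_inj A X (h h' : Hom A (dual X)) :
  ev X ∘ (h ⊠ idm X) = ev X ∘ (h' ⊠ idm X) -> h = h'.
Proof. by move=> e; rewrite -[h]curry_ev e curry_ev. Qed.

Definition dualm X Y (f : Hom X Y) : Hom (dual Y) (dual X) :=
  curry (ev Y ∘ (dual Y ◁ f)).

Lemma ev_dualm X Y (f : Hom X Y) : ev X ∘ (dualm f ⊠ idm X) = ev Y ∘ (dual Y ◁ f).
Proof. exact: ev_curry. Qed.

Lemma dualm_id X : dualm (idm X) = idm (dual X).
Proof. by apply: ev_inj; rewrite ev_dualm. Qed.

Lemma dualm_comp X Y Z (g : Hom Y Z) (f : Hom X Y) :
  dualm (g ∘ f) = dualm f ∘ dualm g.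
Proof.
apply: ev_inj; rewrite ev_dualm tenm_compl compA ev_dualm -?compA wh_swap.
by rewrite compA ev_dualm -compA -tenm_compr.
Qed.

Lemma dualmD X Y (f g : Hom X Y) : dualm (f + g) = dualm f + dualm g.
Proof. by apply: ev_inj; rewrite tenmDl compDr !ev_dualm tenmDr compDr. Qed.

Lemma dualm0 X Y : dualm (0 : Hom X Y) = 0.
Proof. by apply: ev_inj; rewrite ev_dualm tenm0l tenm0r !comp0r. Qed.

Lemma dual_bip W X Y : W ≅ X ⊕ Y -> dual W ≅ dual X ⊕ dual Y.
Proof.
move=> /bip_isoP[i1 [i2 [p1 [p2 [e1 e2 e3 e4 e5]]]]].
apply: (@bip_char _ _ _ _ _ (dualm p1) (dualm p2) (dualm i1) (dualm i2));
  rewrite -!dualm_comp ?e1 ?e2 ?e3 ?e4 ?dualm_id ?dualm0 //.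
by rewrite -dualmD e5 dualm_id.
Qed.

End DualSum.

(** * Powers of a direct sum *)

Section TensorPowerMap.
Variables (K : fieldType) (C : tensorCategory K).
Implicit Types X Y Z : C.

Fixpoint tmap X Y (f : Hom X Y) n : Hom (tpow X n) (tpow Y n) :=
  if n is n'.+1 then f ⊠ tmap f n' else idm _.

Lemma tmap_comp X Y Z (g : Hom Y Z) (f : Hom X Y) n :
  tmap (g ∘ f) n = tmap g n ∘ tmap f n.
Proof. by elim: n => [|n IH] /=; rewrite ?comp_idl // IH tenm_comp. Qed.

Lemma tmap_id X n : tmap (idm X) n = idm _.
Proof. by elim: n => //= n ->; rewrite tenm_id. Qed.

Lemma tmap_tr X Y (f : Hom X Y) n j : tmap f n ∘ tr X n j = tr Y n j ∘ tmap f n.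
Proof.
elim: n j => [|n IH] [|j]; rewrite ?trS /= ?comp_idl ?comp_idr //.
  by case: n {IH} => [|n] /=; rewrite ?comp_idl ?comp_idr // sw_nat.
by rewrite -!tenm_comp IH comp_idl comp_idr.
Qed.

Lemma tmap_act X Y (f : Hom X Y) n (s : 'S_n) :
  tmap f n ∘ perm_act X s = perm_act Y s ∘ tmap f n.
Proof.
elim/perm_adj_ind: s => [|s i j ij IH].
  by rewrite !perm_act1 comp_idl comp_idr.
by rewrite !perm_actM !perm_act_tperm // compA tmap_tr -compA IH compA.
Qed.

Lemma tmap_insert X Y (f : Hom X Y) n i :
  tmap f n.+1 ∘ insert_factor X n i = insert_factor Y n i ∘ tmap f n.+1.
Proof.
elim: n i => [|n IH] [|i].
- by rewrite !ins0 comp_idl comp_idr.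
- by rewrite /= comp_idl comp_idr.
- by rewrite !ins0 comp_idl comp_idr.
have e : (f ⊠ tmap f n.+1) ∘ (X ◁ insert_factor X n i)
    = (Y ◁ insert_factor Y n i) ∘ (f ⊠ tmap f n.+1).
  by rewrite -!tenm_comp IH comp_idl comp_idr.
rewrite !insS -[tmap f n.+2]/(f ⊠ tmap f n.+1) (comp_pre2 _ e) -?compA.
by rewrite -sw_nat.
Qed.

Lemma tmap_proj X Y (f : Hom X Y) b n : tmap f n ∘ proj X b n = proj Y b n ∘ tmap f n.
Proof.
rewrite !proj.unlock /average compZl compZr comp_suml comp_sumr; congr (_ *: _).
by apply: eq_bigr => s _; rewrite compZl compZr tmap_act.
Qed.

Lemma juxtV_insert X k m i : (i <= k)%N ->
  juxtV X k.+1 m (k.+1 + m) ∘ insert_factor X (k + m) i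
  = (insert_factor X k i ⊠ idm _) ∘ juxtV X k.+1 m (k.+1 + m).
Proof.
elim: i => [|i IH] hi; first by rewrite !ins0 tenm_id comp_idl comp_idr.
have h : juxtV X k.+1 m (k.+1 + m) ∘ tr X (k + m).+1 i
    = (tr X k.+1 i ⊠ idm _) ∘ juxtV X k.+1 m (k.+1 + m) by rewrite juxtV_trl.
rewrite -(@tr_ins _ _ _ (k + m)) -?(@tr_ins _ _ _ k) //; last by lia.
by rewrite compA h -compA IH ?tenm_compl -?compA // ltnW.
Qed.

End TensorPowerMap.

Lemma kimg_sum (K : fieldType) (C : rigidTensorCategory K) (X : C) n (F : nat -> Hom X X) :
  (forall i, (i < n)%N -> F i ∘ F i = F i) ->
  (forall i j, (i < n)%N -> (j < n)%N -> i != j -> F i ∘ F j = 0) ->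
  kimg (\sum_(i < n) F i) = \sum_(i < n) kimg (F i).
Proof.
move=> FF F0; suff [] : let S := \sum_(i < n) F i in
    S ∘ S = S /\ kimg S = \sum_(i < n) kimg (F i) by [].
elim: n FF F0 => [|n IH] FF F0 /=; first by rewrite !big_ord0 comp0l kimg0.
have [||ss e] := IH.
- by move=> i hi; apply: FF; apply: ltnW.
- by move=> i j hi hj; apply: F0; apply: ltnW.
have l0 : (\sum_(i < n) F i) ∘ F n = 0.
  rewrite comp_suml big1 // => i _; apply: F0 => //; first by rewrite ltnW ?ltnS.
  by rewrite neq_ltn ltn_ord.
have r0 : F n ∘ (\sum_(i < n) F i) = 0.
  rewrite comp_sumr big1 // => i _; apply: F0 => //; first by rewrite ltnW ?ltnS.
  by rewrite neq_ltn ltn_ord orbT.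
have nn := FF n (ltnSn n); rewrite !big_ord_recr /=; split.
  by rewrite !(compDl, compDr) ss nn l0 r0 addr0 add0r.
by rewrite (kimgD ss nn l0 r0 (erefl _)) e.
Qed.

(** Only the arrangement with all factors from [X] in front is used; the projector on [tpow W N]
    accounts for the others. *)
HB.lock Definition sum_in (K : fieldType) (C : tensorCategory K) (W X Y : C)
    (i1 : Hom X W) (i2 : Hom Y W) k m N : Hom (tpow X k ⊗ tpow Y m) (tpow W N) :=
  juxt W k m N ∘ (tmap i1 k ⊠ tmap i2 m).
HB.lock Definition sum_pr (K : fieldType) (C : tensorCategory K) (W X Y : C)
    (p1 : Hom W X) (p2 : Hom W Y) k m N : Hom (tpow W N) (tpow X k ⊗ tpow Y m) :=
  (tmap p1 k ⊠ tmap p2 m) ∘ juxtV W k m N.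

Section SumFormula.
Variables (K : fieldType) (charK : [pchar K] =i pred0).
Variables (C : rigidTensorCategory K) (W X Y : C) (b : bool).
Variables (i1 : Hom X W) (i2 : Hom Y W) (p1 : Hom W X) (p2 : Hom W Y).
Hypotheses (pi11 : p1 ∘ i1 = idm X) (pi22 : p2 ∘ i2 = idm Y).
Hypotheses (pi12 : p1 ∘ i2 = 0) (pi21 : p2 ∘ i1 = 0).
Hypothesis ip : i1 ∘ p1 + i2 ∘ p2 = idm W.
Local Notation T := (tpow W).
Local Notation P := (proj W b).

Local Notation sum_in := (sum_in i1 i2).
Local Notation sum_pr := (sum_pr p1 p2).

Lemma sum_inS k m N :
  sum_in k.+1 m N.+1 = (i1 ⊠ sum_in k m N) ∘ assoc X (tpow X k) (tpow Y m).
Proof.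
rewrite sum_in.unlock /= -compA assoc_nat (comp_pre _ (esym (tenm_comp _ _ _ _))).
by rewrite comp_idl.
Qed.

Lemma sum_prS k m N :
  sum_pr k.+1 m N.+1 = assocV X (tpow X k) (tpow Y m) ∘ (p1 ⊠ sum_pr k m N).
Proof.
rewrite sum_pr.unlock /= compA -assocV_nat -compA -tenm_comp.
by rewrite comp_idr.
Qed.

Lemma sum_in0 m : sum_in 0 m m = tmap i2 m ∘ lun _.
Proof. by rewrite sum_in.unlock /= tpow_cast_id comp_idl lun_nat. Qed.

Lemma sum_pr0 m : sum_pr 0 m m = lunV _ ∘ tmap p2 m.
Proof. by rewrite sum_pr.unlock /= tpow_cast_id comp_idr lunV_nat. Qed.

(* The grading of T n by the number of factors from X. *)
Fixpoint grading n : Hom (T n) (T n) :=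
  if n is n'.+1 then (i1 ∘ p1) ⊠ idm (T n') + (W ◁ grading n') else 0.

Lemma grading_tr n j : (j.+1 < n)%N -> grading n ∘ tr W n j = tr W n j ∘ grading n.
Proof.
elim: n j => // n IH [|j] hj.
  case: n IH hj => // n IH _ /=; rewrite tenmDr addrA.
  rewrite compDl compDr -[idm (W ⊗ T n)]tenm_id; congr (_ + _); last first.
    by rewrite sw_wh.
  by rewrite compDl compDr !sw_nat addrC.
rewrite trS /= compDl compDr -!tenm_compr IH //; congr (_ + _).
by rewrite -tenm_swap.
Qed.

Lemma grading_act n (s : 'S_n) :
  grading n ∘ perm_act W s = perm_act W s ∘ grading n.
Proof.
elim/perm_adj_ind: s => [|s i j ij IH].
  by rewrite !perm_act1 comp_idl comp_idr.
rewrite !perm_actM !perm_act_tperm // compA grading_tr ?IH -?compA ?IH //.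
by rewrite -ij.
Qed.

Lemma grading_proj n : grading n ∘ P n = P n ∘ grading n.
Proof.
rewrite !proj.unlock /average compZl compZr comp_suml comp_sumr; congr (_ *: _).
by apply: eq_bigr => s _; rewrite compZl compZr grading_act.
Qed.

Lemma grading_in k m : grading (k + m) ∘ sum_in k m (k + m) = k%:R *: sum_in k m (k + m).
Proof.
elim: k => [|k IH].
  rewrite add0n sum_in0 scale0r compA; suff -> : grading m ∘ tmap i2 m = 0 by rewrite comp0l.
  elim: m => [|m IH] /=; first by rewrite comp0l.
  by rewrite compDl -!tenm_comp -compA pi12 comp0r tenm0l add0r comp_idl IH tenm0r.
rewrite addSn sum_inS /= compA compDl -!tenm_comp -compA pi11 comp_idr !comp_idl IH.
rewrite tenmZr compDl compZl -[X in X + _]scale1r -scalerDl.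
by rewrite -natr1 addrC.
Qed.

Lemma grading_pr k m : sum_pr k m (k + m) ∘ grading (k + m) = k%:R *: sum_pr k m (k + m).
Proof.
elim: k => [|k IH].
  rewrite add0n sum_pr0 scale0r -compA; suff -> : tmap p2 m ∘ grading m = 0 by rewrite comp0r.
  elim: m => [|m IH] /=; first by rewrite comp0r.
  by rewrite compDr -!tenm_comp compA pi21 comp0l tenm0l add0r comp_idr IH tenm0r.
rewrite addSn sum_prS /= -compA compDr -!tenm_comp compA pi11 comp_idl !comp_idr IH.
rewrite tenmZr compDr compZr -[X in X + _]scale1r -scalerDl.
by rewrite -natr1 addrC.
Qed.

Lemma sum_pr_insert k m i : (i <= k)%N ->
  sum_pr k.+1 m (k.+1 + m) ∘ insert_factor W (k + m) i
  = (insert_factor X k i ⊠ idm _) ∘ sum_pr k.+1 m (k.+1 + m).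
Proof.
move=> hi; rewrite sum_pr.unlock -compA juxtV_insert // !compA -!tenm_comp tmap_insert.
by rewrite comp_idl comp_idr.
Qed.

(** The insertion puts a factor from [X] into a position that [sum_pr] projects to [Y]. *)
Lemma sum_pr_insert0 k m N i : N.+1 = (k + m)%N -> (k <= i <= N)%N ->
  sum_pr k m N.+1 ∘ (insert_factor W N i ∘ (i1 ⊠ idm (T N))) = 0.
Proof.
elim: k m N i => [|k IH] m N i eN hi.
  rewrite add0n in eN; rewrite -eN sum_pr0 -compA (comp_pre2 _ (tmap_insert _ _ _)).
  by rewrite /= -tenm_comp pi21 tenm0l !comp0r.
case: N i eN hi => [|N] [|i] eN hi; try by exfalso; lia.
rewrite insS sum_prS -?compA -tenm_id sw_nat.
rewrite (comp_pre _ (esym (tenm_compr _ _ _))) (comp_pre _ (esym (tenm_comp _ _ _ _))).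
rewrite -/(tpow W N.+1) -?compA IH ?tenm0r ?comp0l ?comp0r //; lia.
Qed.

(** By [projS_sum], only insertions at positions up to [k] survive, and these rebuild the projector
    of rank [k + 1] on [X]. The constant is [1 / 'C(k + m, k)], the proportion of permutations
    preserving the two blocks. *)
Lemma sum_pr_proj_in k m : exists2 c : K, c != 0 &
  sum_pr k m (k + m) ∘ (P (k + m) ∘ sum_in k m (k + m))
  = c *: (proj X b k ⊠ proj Y b m).
Proof.
elim: k => [|k [c c0 e]].
  exists 1; first exact: oner_neq0.
  rewrite add0n sum_in0 sum_pr0 -?compA (comp_pre2 _ (tmap_proj _ _ _)).
  rewrite (comp_pre _ (esym (tmap_comp _ _ _))) pi22 tmap_id comp_idl scale1r.
  have -> : proj X b 0 = idm 𝟙.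
    have [_ _ h _] := proj_is_proj charK X b 0.
    by rewrite -[LHS]comp_idr h.
  by rewrite -lun_nat compA lunK comp_idl.
exists (c * k.+1%:R / (k + m).+1%:R).
  by rewrite !mulf_neq0 ?invr_eq0 ?(natr_neq0 charK).
apply: (scalerI (natr_neq0 charK (k + m))).
rewrite scalerA mulrCA mulfV ?(natr_neq0 charK) // mulr1.
rewrite addSn -compZr -compZl projS_sum // comp_suml comp_sumr.
transitivity (\sum_(i < (k + m).+1 | (i < k.+1)%N) sgnb b ^+ i *:
    (sum_pr k.+1 m (k + m).+1 ∘ (insert_factor W (k + m) i ∘ ((W ◁ P (k + m))
       ∘ sum_in k.+1 m (k + m).+1)))).
  rewrite [RHS]big_mkcond; apply: eq_bigr => i _.
  rewrite compZl compZr -?compA; case: ifP => // /negbT; rewrite -leqNgt => hi.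
  rewrite sum_inS (comp_pre _ (esym (tenm_comp _ _ _ _))) comp_idl.
  have -> : i1 ⊠ (P (k + m) ∘ sum_in k m (k + m))
      = (i1 ⊠ idm _) ∘ (X ◁ (P (k + m) ∘ sum_in k m (k + m))).
    by rewrite -tenm_comp comp_idl comp_idr.
  rewrite -?compA (comp_pre3 _ (sum_pr_insert0 _ _)) ?comp0l ?scaler0 //.
  by have := ltn_ord i; lia.
have kN : (k.+1 <= (k + m).+1)%N by lia.
rewrite -(big_ord_widen _ (fun i => sgnb b ^+ i *: (sum_pr k.+1 m (k + m).+1 ∘
  (insert_factor W (k + m) i ∘ ((W ◁ P (k + m)) ∘ sum_in k.+1 m (k + m).+1)))) kN).
transitivity (\sum_(i < k.+1) c *: ((sgnb b ^+ i *: (insert_factor X k i ∘ (X ◁ proj X b k)))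
    ⊠ proj Y b m)).
  apply: eq_bigr => i _.
  have hi : (i <= k)%N by rewrite -ltnS.
  rewrite (comp_pre2 _ (sum_pr_insert m hi)).
  rewrite tenmZl scalerA mulrC -scalerA; congr (_ *: _).
  rewrite sum_inS sum_prS -?compA (comp_pre _ (esym (tenm_comp _ _ _ _))) comp_idr.
  rewrite (comp_pre _ (esym (tenm_comp _ _ _ _))) pi11 -compA e tenmZr compZl !compZr.
  rewrite (comp_pre2 _ (assocV_nat _ _ _)) assocK comp_idr.
  by rewrite -tenm_comp comp_idl.
rewrite -scaler_sumr -tenm_suml -projS_sum // tenmZl scalerA.
by [].
Qed.

Lemma insert_proj n i : (i <= n)%N ->
  insert_factor W n i ∘ P n.+1 = sgnb b ^+ i *: P n.+1.
Proof.
elim: i => [|i IH] hi; first by rewrite ins0 comp_idl scale1r.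
have [h _ _ _] := proj_is_proj charK W b n.+1.
by rewrite -tr_ins // -compA (IH (ltnW hi)) compZr h // scalerA -exprSr.
Qed.

Lemma insert_sum_in k m N : N = (k + m)%N ->
  insert_factor W N k ∘ (i2 ⊠ sum_in k m N)
  = sum_in k m.+1 N.+1 ∘ sw Y (tpow X k) (tpow Y m).
Proof.
move=> NE; rewrite sum_in.unlock -compA -sw_nat (comp_pre2 _ (juxt_sw1 _ NE)).
by rewrite -tenm_comp comp_idl.
Qed.

Lemma juxtV_insert_factor k m N : N = (k + m)%N ->
  juxtV W k m.+1 N.+1 ∘ insert_factor W N k
  = sw W (tpow W k) (tpow W m) ∘ (W ◁ juxtV W k m N).
Proof.
move=> NE; apply: (@split_epi _ _ _ _ _ (W ◁ juxtV W k m N) (W ◁ juxt W k m N)).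
  by rewrite NE -tenm_compr juxtVK wh_id.
rewrite -?compA -(juxt_sw1 _ NE) compA.
have -> : N.+1 = (k + m.+1)%N by lia.
rewrite juxtK comp_idl -tenm_compr NE juxtK.
by rewrite wh_id comp_idr.
Qed.

Lemma sum_pr_insert_factor k m N : N = (k + m)%N ->
  sum_pr k m.+1 N.+1 ∘ insert_factor W N k
  = sw Y (tpow X k) (tpow Y m) ∘ (p2 ⊠ sum_pr k m N).
Proof.
move=> NE; rewrite sum_pr.unlock -compA juxtV_insert_factor //.
rewrite [in RHS](_ : p2 ⊠ _ = (p2 ⊠ (tmap p1 k ⊠ tmap p2 m)) ∘ (W ◁ juxtV W k m N)).
  by rewrite (comp_pre2 _ (sw_nat _ _ _)) compA.
by rewrite -tenm_comp comp_idr.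
Qed.

(* Up to the factor 'C(k + m, k), Q k m (k + m) is the projector onto the summand
   of bidegree (k, m). *)
Let V k m N := sum_in k m N ∘ sum_pr k m N.
Let Q k m N := P N ∘ (V k m N ∘ P N).

Let VS k m N : V k.+1 m N.+1 = (i1 ∘ p1) ⊠ V k m N.
Proof.
rewrite /V sum_inS sum_prS -?compA (comp_pre _ (assocVK _ _ _)) comp_idl.
by rewrite -tenm_comp.
Qed.

Let V_insert k m N : N = (k + m)%N ->
  insert_factor W N k ∘ ((i2 ∘ p2) ⊠ V k m N) = V k m.+1 N.+1 ∘ insert_factor W N k.
Proof.
move=> NE; rewrite /V tenm_comp (comp_pre _ (insert_sum_in NE)) -?compA.
by rewrite sum_pr_insert_factor.
Qed.

Let P_tail n (f : Hom W W) (g : Hom (T n) (T n)) :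
  P n.+1 ∘ ((f ⊠ (P n ∘ (g ∘ P n))) ∘ P n.+1) = P n.+1 ∘ ((f ⊠ g) ∘ P n.+1).
Proof.
have hP := proj_is_proj charK W b n.+1; have hS := projS_is_proj charK W b n.
have Pl : (W ◁ P n) ∘ P n.+1 = P n.+1 by apply: (is_proj_subl _ hS hP) => j; lia.
have Pr : P n.+1 ∘ (W ◁ P n) = P n.+1 by apply: (is_proj_subr _ hS hP) => j; lia.
have -> : f ⊠ (P n ∘ (g ∘ P n)) = (W ◁ P n) ∘ ((f ⊠ g) ∘ (W ◁ P n)).
  by rewrite -!tenm_comp comp_idl comp_idr.
by rewrite -?compA Pl (comp_pre _ Pr).
Qed.

Let Q_in1 k m n : P n.+1 ∘ (((i1 ∘ p1) ⊠ Q k m n) ∘ P n.+1) = Q k.+1 m n.+1.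
Proof. by rewrite /Q P_tail VS. Qed.

(** A first factor from [Y] has to pass the [k] factors from [X]. The sign [sgnb b ^+ k] arises on
    both sides and cancels. *)
Let Q_in2 k m n : n = (k + m)%N ->
  P n.+1 ∘ (((i2 ∘ p2) ⊠ Q k m n) ∘ P n.+1) = Q k m.+1 n.+1.
Proof.
move=> nE; rewrite /Q P_tail; have kn : (k <= n)%N by lia.
have h : P n.+1 = sgnb b ^+ k *: (P n.+1 ∘ insert_factor W n k).
  by rewrite proj_insert // scalerA -exprMn sgnbK expr1n scale1r.
rewrite {1}h compZl -?compA (comp_pre2 _ (V_insert nE)) insert_proj // !compZr.
by rewrite scalerA -exprMn sgnbK expr1n scale1r /V -?compA.
Qed.

Lemma binomial_sum_rec (M : lmodType K) (G : nat -> M) n :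
  \sum_(k < n.+1) 'C(n, k)%:R *: (G k.+1 + G k) = \sum_(k < n.+2) 'C(n.+1, k)%:R *: G k.
Proof.
rewrite (eq_bigr (fun k : 'I_n.+1 => 'C(n, k)%:R *: G k.+1 + 'C(n, k)%:R *: G k)).
  rewrite big_split /= [RHS]big_ord_recl bin0 scale1r.
  rewrite [X in _ + X = _]big_ord_recl bin0 scale1r addrCA; congr (_ + _).
  under [RHS]eq_bigr => k _ do rewrite lift0 binS natrD scalerDl.
  rewrite big_split /= addrC [X in _ = X + _]big_ord_recr /= bin_small // scale0r addr0.
  by congr (_ + _); apply: eq_bigr => k _; rewrite lift0.
by move=> k _; rewrite scalerDr.
Qed.

(** Split the first factor by [ip]: the two halves raise the degree in [X] or in [Y], and Pascal's
    rule collects the terms. *)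
Let completeness n : P n = \sum_(k < n.+1) 'C(n, k)%:R *: Q k (n - k) n.
Proof.
have PP m : P m ∘ P m = P m by exact: proj_idem.
elim: n => [|n IH].
  rewrite big_ord1 scale1r /Q /V sum_in0 sum_pr0 /= !comp_idl comp_idr.
  rewrite lunVK comp_idl; exact: esym (PP 0).
have hP := proj_is_proj charK W b n.+1; have hS := projS_is_proj charK W b n.
have Pl : (W ◁ P n) ∘ P n.+1 = P n.+1 by apply: (is_proj_subl _ hS hP) => j; lia.
rewrite -(binomial_sum_rec (fun k => Q k (n.+1 - k) n.+1)).
rewrite -{1}[P n.+1]PP -{2}Pl -ip tenmDl compDl compDr IH.
rewrite !tenm_sumr !comp_suml !comp_sumr -big_split /=.
apply: eq_bigr => k _; rewrite !tenmZr !compZl !compZr -scalerDr; congr (_ *: _).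
have hk := ltn_ord k; rewrite Q_in1 Q_in2; last by lia.
by rewrite subSS subSn // -ltnS.
Qed.

Let natr_inj (k l : nat) : k%:R = l%:R :> K -> k = l.
Proof.
wlog kl : k l / (k <= l)%N.
  by case: (leqP k l) => [|/ltnW] h H /esym e; [apply: H | symmetry; apply: H].
move=> e; apply/eqP; rewrite eqn_leq kl -subn_eq0 eqn0Ngt; apply/negP => h.
have /eqP[] := natr_neq0 charK (l - k).-1.
by rewrite prednK // natrB // e subrr.
Qed.

(** [grading] commutes with [P n] and acts by [k] on one side and by [l] on the other, which differ
    in characteristic 0. *)
Let orthogonal n k l : (k <= n)%N -> (l <= n)%N -> k != l ->
  sum_pr k (n - k) n ∘ (P n ∘ sum_in l (n - l) n) = 0.
Proof.
move=> hk hl kl; have e1 := grading_pr k (n - k); have e2 := grading_in l (n - l).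
rewrite subnKC // in e1; rewrite subnKC // in e2.
set x := _ ∘ _; have : k%:R *: x = l%:R *: x.
  rewrite /x -compZl -e1 -?compA (comp_pre2 _ (grading_proj n)) e2 !compZr.
  by [].
move/eqP; rewrite -subr_eq0 -scalerBl scaler_eq0 subr_eq0 => /orP[/eqP/natr_inj e|/eqP//].
by rewrite e eqxx in kl.
Qed.

Lemma sum_formula n : kpow W b n = \sum_(k < n.+1) kpow X b k * kpow Y b (n - k).
Proof.
pose F k : Hom (T n) (T n) := 'C(n, k)%:R *: Q k (n - k) n.
have PP : P n ∘ P n = P n by exact: proj_idem.
have F0 k l : (k < n.+1)%N -> (l < n.+1)%N -> k != l -> F k ∘ F l = 0.
  move=> hk hl kl; rewrite /F /Q /V compZl compZr -?compA (comp_pre _ PP).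
  by rewrite (comp_pre3 _ (orthogonal _ _ kl)) // ?comp0l !comp0r !scaler0.
have PF k : P n ∘ F k = F k by rewrite /F compZr /Q (comp_pre _ PP).
(* In [F k = F k ∘ P n], expand [P n] by [completeness]: only the term [F k ∘ F k] survives. *)
have FF k : (k < n.+1)%N -> F k ∘ F k = F k.
  move=> hk; rewrite -[RHS]comp_idr.
  have FP : F k ∘ P n = F k by rewrite /F compZl /Q -?compA PP.
  rewrite comp_idr -[RHS]FP completeness comp_sumr (bigD1 (Ordinal hk)) //= big1 ?addr0 //.
  by move=> l lk; apply: F0 => //; rewrite eq_sym -val_eqE in lk *.
rewrite /kpow completeness (kimg_sum FF F0); apply: eq_bigr => k _.
have hk : (k <= n)%N by rewrite -ltnS.
have [c c0 e] := sum_pr_proj_in k (n - k).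
rewrite subnKC // in e.
rewrite -kimg_ten ?proj_idem //.
apply: (@kimg_iso _ _ _ _ _ _ (sum_pr k (n - k) n ∘ P n) (P n ∘ sum_in k (n - k) n)
  'C(n, k)%:R c^-1).
- exact: FF.
- by rewrite -tenm_comp !proj_idem.
- by rewrite -(prednK (_ : 0 < 'C(n, k))%N) ?bin_gt0 // natr_neq0.
- by rewrite invr_eq0.
- by rewrite /F /Q /V -?compA.
- by rewrite -compA (comp_pre _ PP) e scalerA mulVf // scale1r.
Qed.

End SumFormula.

(** * Rational functions *)

Section Reciprocity.
Variable R : comNzRingType.
Implicit Types f g h : nat -> R.

Definition conv f g n := \sum_(i < n.+1) f i * g (n - i)%N.
Definition trunc p f : {poly R} := \poly_(i < p.+1) f i.

Lemma coef_trunc p f n : (forall i, (p < i)%N -> f i = 0) -> (trunc p f)`_n = f n.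
Proof. by move=> f0; rewrite coef_poly ltnS; case: leqP => // /f0 ->. Qed.

Lemma conv_trunc f g n k : (k <= n)%N -> conv f g k = (trunc n f * trunc n g)`_k.
Proof.
move=> kn; rewrite coefM; apply: eq_bigr => i _; rewrite !coef_poly !ltnS.
by rewrite (leq_trans (leq_subr _ _) kn) (leq_trans _ kn) // -ltnS.
Qed.

(** Inherited from the multiplication of polynomials, by truncation in degree [n]. *)
Lemma convA f g h n : conv f (conv g h) n = conv (conv f g) h n.
Proof.
transitivity ((trunc n f * (trunc n g * trunc n h))`_n).
  rewrite coefM; apply: eq_bigr => i _.
  by rewrite (@conv_trunc _ _ n) ?leq_subr // coef_poly ltn_ord.
rewrite mulrA coefM; apply: eq_bigr => i _.
have hi : (i <= n)%N by rewrite -ltnS.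
by rewrite (conv_trunc _ _ hi) coef_poly ltnS leq_subr.
Qed.

Lemma lead_coef_trunc p f c : f p * c = 1 -> lead_coef (trunc p f) = f p.
Proof.
move=> fc; rewrite lead_coef_poly //; apply/eqP => z; move/eqP: fc.
by rewrite z mul0r eq_sym oner_eq0.
Qed.

Lemma ratden_trunc p f c : f 0%N = 1 -> f p * c = 1 -> ratden (trunc p f).
Proof.
move=> f0 fc; exists 0%N, (trunc p f); split; first by rewrite mul1r.
  by rewrite coef_poly.
by exists c; rewrite (lead_coef_trunc fc) mulrC.
Qed.

(** The series [s] is inverse to [a], so multiplying [conv s b] by [a] leaves [b]. *)
Lemma ratexp_trunc p q (a s b : nat -> R) c :
  (forall i, (p < i)%N -> a i = 0) -> (forall i, (q < i)%N -> b i = 0) ->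
  a 0%N = 1 -> a p * c = 1 -> (forall n, conv a s n = (n == 0%N)%:R) ->
  ratexp (ratpoly (trunc q b) / ratpoly (trunc p a)) (conv s b).
Proof.
move=> ap bq a0 ac as1; exists (trunc q b), (trunc p a); split.
- by rewrite coef_poly.
- by exists c; rewrite (lead_coef_trunc ac) mulrC.
- rewrite divrK // ratpoly_unit //; exact: ratden_trunc a0 ac.
move=> n; rewrite (eq_bigr (fun i : 'I_n.+1 => a i * conv s b (n - i))); last first.
  by move=> i _; rewrite coef_trunc.
rewrite -/(conv a (conv s b) n) convA coef_trunc // /conv big_ord_recl subn0.
rewrite -/(conv a s 0) as1 mul1r big1 ?addr0 // => i _.
by rewrite lift0 -/(conv a s i.+1) as1 mul0r.
Qed.

Lemma ratT_unit : @ratT R \is a GRing.unit.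
Proof. by apply: ratpoly_unit; rewrite -['X]expr1; exact: ratdenXn. Qed.

Lemma evalV_trunc p f :
  evalV (trunc p f) * ratT ^+ p = ratpoly (trunc p (fun i => f (p - i)%N)).
Proof.
rewrite /evalV /trunc !poly_def !rmorph_sum horner_sum mulr_suml.
rewrite [RHS](reindex_inj rev_ord_inj) /=; apply: eq_bigr => i _.
have ip : (i <= p)%N by rewrite -ltnS.
rewrite subSS subKn // map_polyZ map_polyXn hornerZ hornerXn -mul_polyC rmorphM rmorphXn /=.
rewrite -mulrA; congr (_ * _).
have -> : ratT ^+ p = ratT ^+ (p - i) * ratT ^+ i :> ratfun R by rewrite -exprD subnK.
by rewrite mulrCA -exprMn mulVr ?ratT_unit // expr1n mulr1.
Qed.

Lemma evalV_trunc_sym p f g c :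
  (forall i, (i <= p)%N -> f i * c = g (p - i)%N) ->
  evalV (trunc p f) * ratT ^+ p * ratC c = ratpoly (trunc p g).
Proof.
move=> fg; rewrite evalV_trunc -rmorphM; congr ratpoly; apply/polyP => i.
rewrite coefMC !coef_poly ltnS; case: leqP => [ip|_]; last by rewrite mul0r.
by rewrite fg ?leq_subr // subKn.
Qed.

(** Here [l] and [m] stand for the classes of the top powers of the positive and the negative part,
    and [d] for the inverse of [m], so [l * d] is the class of the determinant. Reversing the
    numerator costs [ratT ^+ q] and [m], reversing the denominator costs [ratT ^+ p] and [l]. *)
Lemma ratsubV_reciprocity p q (a a' b b' : nat -> R) l c m d :
  a 0%N = 1 -> a p * c = 1 -> a' 0%N = 1 -> a' p * l = (-1) ^+ p -> m * d = 1 ->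
  (forall i, (i <= p)%N -> a' i * l = (-1) ^+ p * a (p - i)%N) ->
  (forall i, (i <= q)%N -> b' i * m = b (q - i)%N) ->
  ratsubV (ratpoly (trunc q b') / ratpoly (trunc p a'))
  = (-1) ^+ p * ratC (l * d) * ratT ^ (p%:Z - q%:Z)
    * (ratpoly (trunc q b) / ratpoly (trunc p a)).
Proof.
move=> a0 pc a0' pc' md aa bb.
have sK : (-1) ^+ p * (-1) ^+ p = 1 :> ratfun R by rewrite -exprMn mulrNN mulr1 expr1n.
have dA := ratden_trunc a0 pc.
have dA' : ratden (trunc p a').
  apply: (@ratden_trunc _ _ (l * (-1) ^+ p)) => //.
  by rewrite mulrA pc' -exprMn mulrNN mulr1 expr1n.
rewrite ratsubV_frac //; apply: (mulIr (evalV_ratden dA')); rewrite divrK ?evalV_ratden //.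
apply: (mulIr (ratpoly_unit dA)).
rewrite [RHS]mulrAC mulrA divrK ?ratpoly_unit //.
rewrite -(evalV_trunc_sym bb).
have eA : evalV (trunc p a') * ratT ^+ p * ratC l = (-1) ^+ p * ratpoly (trunc p a).
  rewrite (@evalV_trunc_sym _ _ (fun i => (-1) ^+ p * a i)) //.
  transitivity (ratpoly ((-1) ^+ p * trunc p a)); last by rewrite rmorphM rmorph_sign.
  congr ratpoly; apply/polyP => i; rewrite -signr_odd -[in RHS]signr_odd.
  case: (odd p); rewrite ?expr1 ?expr0 ?mulN1r ?mul1r ?coefN !coef_poly;
    by case: ltnP; rewrite ?oppr0 // ?mulN1r ?mul1r.
have -> : ratpoly (trunc p a) = (-1) ^+ p * (evalV (trunc p a') * ratT ^+ p * ratC l).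
  by rewrite eA mulrA sK mul1r.
have mdC : ratC m * ratC d = 1 by rewrite -rmorphM md rmorph1.
have -> : ratT ^+ p = ratT ^ (p%:Z - q%:Z) * ratT ^+ q :> ratfun R.
  by rewrite -[ratT ^+ q]/(ratT ^ q%:Z) -exprzDr ?ratT_unit // subrK.
have -> : ratC (l * d) = ratC l * ratC d by rewrite rmorphM.
set T := ratT ^ _; set x := evalV _; set y := evalV _.
transitivity (ratC m * ratC d * (x * ((-1) ^+ p * (y * (T * ratT ^+ q) * ratC l)))).
  by rewrite mdC mul1r.
by ring.
Qed.

End Reciprocity.

(** * The functional equation *)

Section TopPower.
Variables (K : fieldType) (charK : [pchar K] =i pred0).
Variables (C : rigidTensorCategory K) (X : C) (b : bool).

Lemma kpow_zero_top N : proj X b N = 0 -> exists p : nat,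
  [/\ trace (idm X) = - (p%:R * sgnb b) *: idm 𝟙,
      is_inverse (img (proj X b p)) (img (proj (dual X) b p)),
      forall n, (p < n)%N -> kpow X b n = 0 /\ kpow (dual X) b n = 0
    & forall i, (i <= p)%N -> kpow (dual X) b i * kpow X b p = kpow X b (p - i)].
Proof.
(* [end_unit] makes the trace a scalar, which [proj_zero_chi] then identifies. *)
move=> PN; have [g _ gK] := end_unit C; have trX := esym (gK (trace (idm X))).
have [p chip pS] := proj_zero_chi charK trX PN; exists p; split.
- by rewrite -chip.
- exact: (img_top_inverse charK trX chip pS).
- move=> n pn; have Xn : proj X b n = 0 by apply: proj_zeroS pS.
  by rewrite /kpow (proj_dual_zero Xn) Xn !kimg0.
- exact: (kpow_contraction charK trX chip pS).
Qed.

End TopPower.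

Section ZetaFraction.
Variables (K : fieldType) (charK : [pchar K] =i pred0) (C : rigidTensorCategory K).
Implicit Types W X Y : C.

Definition alt_signed X i : K0 C := (-1) ^+ i * kpow X true i.

Lemma conv_alt_sym X n : conv (alt_signed X) (kpow X false) n = (n == 0%N)%:R.
Proof.
case: n => [|n]; first by rewrite /conv big_ord1 /alt_signed !kpow0 // !mulr1.
rewrite -[RHS](koszul_sum charK X (ltn0Sn n)); apply: eq_bigr => i _.
by rewrite /alt_signed mulrA.
Qed.

Lemma zeta_bip W X Y n : W ≅ X ⊕ Y -> zeta W n = conv (kpow X false) (kpow Y false) n.
Proof.
move=> /bip_isoP[i1 [i2 [p1 [p2 [e1 e2 e3 e4 e5]]]]].
by rewrite /zeta kpow_sym // (sum_formula charK false e1 e2 e3 e4 e5).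
Qed.

Lemma is_zeta_frac W X Y p q c : W ≅ X ⊕ Y ->
  (forall i, (p < i)%N -> kpow X true i = 0) ->
  (forall i, (q < i)%N -> kpow Y false i = 0) -> kpow X true p * c = 1 ->
  is_zeta W (ratpoly (trunc q (kpow Y false)) / ratpoly (trunc p (alt_signed X))).
Proof.
move=> WXY Xp Yq Xc.
have [|||P [Q [Q0 Ql fQ QP]]] :=
    @ratexp_trunc _ p q (alt_signed X) (kpow X false) _ ((-1) ^+ p * c) _ Yq _ _ (conv_alt_sym X).
- by move=> i pi; rewrite /alt_signed Xp ?mulr0.
- by rewrite /alt_signed kpow0 // mulr1.
- by rewrite /alt_signed mulrACA Xc mulr1 -exprMn mulrNN mulr1 expr1n.
exists P, Q; split => // n; rewrite -QP; apply: eq_bigr => i _.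
by rewrite (zeta_bip _ WXY).
Qed.

End ZetaFraction.

Theorem theorem1 (K : fieldType) (charK : [pchar K] =i pred0)
    (C : rigidTensorCategory K) (M Mp Mm : C)
    (Mp_pos : positive Mp) (Mm_neg : negative Mm) (M_dec : M ≅ Mp ⊕ Mm) :
  exists (p : nat) (chi : int) (D : C) (Z Zdual : ratfun (K0 C)),
    [/\ euler_char Mp p%:Z, euler_char M chi, is_det Mp Mm D, is_zeta M Z
      & is_zeta (dual M) Zdual]
    /\ ratsubV Zdual = (-1) ^+ p * ratC (K0_class D) * ratT ^ chi * Z.
Proof.
have [N1 _] := Mp_pos; rewrite /Alt antisymmetrizerE.
move=> /(img_zero (proj_idem charK _ _ _)) /(kpow_zero_top charK)[p [trp invp zp dp]].
have [N2 _] := Mm_neg; rewrite /Sym symmetrizerE.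
move=> /(img_zero (proj_idem charK _ _ _)) /(kpow_zero_top charK)[q [trq invq zq dq]].
have chip : euler_char Mp p%:Z by rewrite /euler_char trp /sgnb mulrN1 opprK.
have chiq : euler_char Mm (- q%:Z).
  by rewrite /euler_char trq /sgnb mulr1 mulrNz.
have lc : kpow Mp true p * kpow (dual Mp) true p = 1.
  by rewrite mulrC dp // subnn kpow0.
have md : kpow Mm false q * kpow (dual Mm) false q = 1.
  by rewrite mulrC dq // subnn kpow0.
(* By [invq] the symmetric power of the dual is an inverse of [Sym q Mm]; with this choice the class
   of the determinant is the product [l * d] in [ratsubV_reciprocity]. *)
exists p, (p%:Z - q%:Z), (Alt p Mp ⊗ Sym q (dual Mm)).
exists (ratpoly (trunc q (kpow Mm false)) / ratpoly (trunc p (alt_signed Mp))).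
exists (ratpoly (trunc q (kpow (dual Mm) false)) / ratpoly (trunc p (alt_signed (dual Mp)))).
split; first split => //.
- by rewrite /euler_char (trace_bip M_dec) chip chiq -scalerDl rmorphD.
- exists p, q, (Sym q (dual Mm)); split => //; last exact: iso_refl.
  by rewrite /Sym !symmetrizerE.
- by apply: (is_zeta_frac charK M_dec _ _ lc) => i hi; [have [] := zp i hi | have [] := zq i hi].
- apply: (is_zeta_frac charK (c := kpow Mp true p) (dual_bip M_dec)).
  + by move=> i /zp[].
  + by move=> i /zq[].
  + by rewrite mulrC lc.
rewrite K0_classM kpow_alt // kpow_sym //.
apply: (ratsubV_reciprocity (c := (-1) ^+ p * kpow (dual Mp) true p) (m := kpow Mm false q)) => //.
- by rewrite /alt_signed kpow0 // mulr1.
- by rewrite /alt_signed mulrACA lc mulr1 -exprMn mulrNN mulr1 expr1n.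
- by rewrite /alt_signed kpow0 // mulr1.
- by rewrite /alt_signed -mulrA [X in _ * X]mulrC lc mulr1.
(* The sign [(-1) ^+ i] on the dual side and [(-1) ^+ (p - i)] on the reversed side differ by
   [(-1) ^+ p]: this is the sign in the functional equation. *)
- move=> i ip; rewrite /alt_signed -mulrA dp // mulrA -exprD; congr (_ * _).
  by rewrite -signr_odd -[in RHS]signr_odd oddD oddB //; case: (odd p); case: (odd i).
Qed.
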